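(* Let $n\in\{2,3\}$, $R>0$, $c_1>0$, and let $f\in L^\infty(B_R(0))$ with $f\geq 0$, where $B_R(0)\subseteq\mathbb{R}^n$ is the open ball of radius $R$ centred at the origin. Let $$M:=\{\Omega\subseteq B_R(0)\mid \Omega \text{ is a convex domain and } \mathcal{L}^n(\Omega)=c_1\}.$$ Then there exists an $\Omega_f\in M$ such that for all $\Omega\in M$ we have $$\gamma_f(\Omega_f)\leq\gamma_f(\Omega),$$ where $\gamma_f$ is the functional defined in the context.
   Context: A domain is a nonempty connected open subset of $\mathbb{R}^n$; $\mathcal{L}^n$ is $n$-dimensional Lebesgue measure. $W^{2,2}_0(\Omega)$ is the closure of $C_0^\infty(\Omega)$ (smooth functions with compact support in $\Omega$) in the Sobolev space $W^{2,2}(\Omega)$. For a domain $\Omega\subseteq B_R(0)$ and $\gamma\in\mathbb{R}$ consider the boundary value problem $$(-\Delta)^2u_\gamma-\gamma\Delta u_\gamma=f \text{ in }\Omega,\qquad u_\gamma=\partial_\nu u_\gamma=0\text{ on }\partial\Omega, \qquad ( * )$$ where $\nu$ is the outer unit normal of $\Omega$. A function $u_\gamma$ is called a weak solution of $( * )$ if and only if $u_\gamma\in W^{2,2}_0(\Omega)$ and for all $\varphi\in C_0^\infty(\Omega)$ $$\int_\Omega \Delta u_\gamma\,\Delta\varphi+\gamma\nabla u_\gamma\cdot\nabla\varphi-f\varphi=0.$$ The buckling load of $\Omega$ is $$\mu_1(\Omega):=\inf_{u\in W^{2,2}_0(\Omega)\setminus\{0\}}\frac{\int_\Omega|\Delta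 u|^2}{\int_\Omega|\nabla u|^2}.$$ For $\gamma>-\mu_1(\Omega)$ the problem $( * )$ has a unique weak solution $u_\gamma$. The functional $\gamma_f$ is defined on $M$ by $$\gamma_f(\Omega):=\inf\{\gamma>-\mu_1(\Omega)\mid \forall\,\tilde\gamma\geq\gamma \text{ the weak solution } u_{\tilde\gamma} \text{ of } ( * ) \text{ with } \tilde\gamma \text{ in place of } \gamma \text{ satisfies } u_{\tilde\gamma}\geq 0 \text{ a.e.}\}.$$
   Formalization: The formal theorem additionally assumes that M is nonempty, since for c_1 larger than the measure of B_R(0) the class M is empty and no Ω_f in M can exist. *)

(* Defs.v *)
From HB Require Import structures.
From mathcomp Require Import all_boot all_order all_algebra.
From mathcomp Require Import all_classical all_reals all_analysis.

Set Implicit Arguments.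
Unset Strict Implicit.
Unset Printing Implicit Defensive.

Import Order.TTheory GRing.Theory Num.Theory.
Import numFieldNormedType.Exports.

Local Open Scope classical_set_scope.
Local Open Scope ring_scope.

(* R^n is 'rV[R]_n.  The library has no sigma-algebra on it: it is given the
   one generated by the coordinates, i.e. the Borel one. *)
Section measurable_rV.
Context {R : realType} (n : nat).

Let coords : 'I_n -> 'rV[R]_n -> R := fun i v => v ord0 i.

Let rV_set0 : g_sigma_preimage coords set0.
Proof. exact: sigma_algebra0. Qed.

Let rV_setC A : g_sigma_preimage coords A -> g_sigma_preimage coords (~` A).
Proof. exact: sigma_algebraC. Qed.

Let rV_bigcup (F : (set 'rV[R]_n)^nat) :
  (forall i, g_sigma_preimage coords (F i)) ->
  g_sigma_preimage coords (\bigcup_i (F i)).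
Proof. exact: sigma_algebra_bigcup. Qed.

HB.instance Definition _ :=
  @isMeasurable.Build (measure_tuple_display default_measure_display)
    'rV[R]_n (g_sigma_preimage coords) rV_set0 rV_setC rV_bigcup.

Lemma measurable_coord (i : 'I_n) :
  measurable_fun [set: 'rV[R]_n] (fun v : 'rV[R]_n => v ord0 i).
Proof.
move=> _ Y mY; rewrite setTI; apply: sub_sigma_algebra => /=.
rewrite -bigcup_seq/=; exists i => /=; first by rewrite mem_index_enum.
by exists Y => //; rewrite setTI.
Qed.

Lemma measurable_fun_rV d (T : measurableType d) (f : T -> 'rV[R]_n) :
  (forall i, measurable_fun [set: T] (fun x => f x ord0 i)) ->
  measurable_fun [set: T] f.
Proof.
move=> mf _ A mA; rewrite setTI.
suff : <<s \big[setU/set0]_(i < n)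
    preimage_set_system setT (coords i) measurable >> `<=`
    [set B | measurable (f @^-1` B)] by exact.
apply: smallest_sub.
  split=> /=.
  - by rewrite preimage_set0.
  - by move=> B mB; rewrite setTD -preimage_setC; exact: measurableC.
  - move=> F mF; rewrite preimage_bigcup; exact: bigcupT_measurable.
rewrite -bigcup_seq => B [i _ [C mC <-]] /=.
by rewrite setTI; have := mf i measurableT C mC; rewrite setTI.
Qed.

End measurable_rV.

Section lebesgue_measure_rV.
Context {R : realType}.

Definition rV_cons n (p : measurableTypeR R * 'rV[R]_n) : 'rV[R]_n.+1 :=
  row_mx (const_mx p.1 : 'rV[R]_1) p.2.

Definition rV_uncons n (v : 'rV[R]_n.+1) : measurableTypeR R * 'rV[R]_n :=
  (v ord0 ord0, rsubmx (v : 'rV[R]_(1 + n))).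

Lemma rV_consK n : cancel (@rV_cons n) (@rV_uncons n).
Proof.
move=> [x v]; congr (_, _); last exact: row_mxKr.
have -> : (ord0 : 'I_n.+1) = lshift n (ord0 : 'I_1) by exact/val_inj.
by rewrite [LHS](row_mxEl (const_mx x : 'rV[R]_1) v) mxE.
Qed.

Lemma measurable_rV_cons n : measurable_fun setT (@rV_cons n).
Proof.
apply: measurable_fun_rV => i; case: (@splitP 1 n i) => j ij.
  rewrite (_ : (fun _ => _) = fst); first exact: measurable_fst.
  apply/funext => -[x v] /=.
  have -> : i = lshift n j by exact/val_inj.
  by rewrite [LHS](row_mxEl (const_mx x : 'rV[R]_1) v) mxE.
rewrite (_ : (fun _ => _) = (fun w : 'rV[R]_n => w ord0 j) \o snd).
  by apply: measurableT_comp; [exact: measurable_coord|exact: measurable_snd].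
apply/funext => -[x v] /=.
have -> : i = rshift 1 j by exact/val_inj.
exact: (row_mxEr (const_mx x : 'rV[R]_1) v).
Qed.

Lemma measurable_rV_uncons n : measurable_fun setT (@rV_uncons n).
Proof.
apply: measurable_fun_pair; first exact: (@measurable_coord R n.+1 ord0).
apply: measurable_fun_rV => i.
rewrite (_ : (fun _ => _) = (fun v : 'rV[R]_n.+1 => v ord0 (rshift 1 i))).
  exact: (@measurable_coord R n.+1).
by apply/funext => v; rewrite mxE.
Qed.

Section step.
Variables (n : nat) (mu : {sigma_finite_measure set 'rV[R]_n -> \bar R}).

Definition lebesgue_rVS : set 'rV[R]_n.+1 -> \bar R :=
  pushforward (@lebesgue_measure R \x mu)%E (@rV_cons n).

Let lebesgue_rVS0 : lebesgue_rVS set0 = 0%E.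
Proof. by rewrite /lebesgue_rVS /pushforward preimage_set0 measure0. Qed.

Let lebesgue_rVS_ge0 A : (0 <= lebesgue_rVS A)%E.
Proof. by rewrite /lebesgue_rVS /pushforward measure_ge0. Qed.

Let lebesgue_rVS_sigma_additive : semi_sigma_additive lebesgue_rVS.
Proof.
move=> F mF tF mUF; rewrite /lebesgue_rVS /pushforward preimage_bigcup.
have mc k : measurable (@rV_cons n @^-1` F k).
  by rewrite -[X in measurable X]setTI; exact: measurable_rV_cons.
apply: measure_semi_sigma_additive => //; last exact: bigcupT_measurable.
apply/trivIsetP => i j _ _ ij; rewrite -preimage_setI.
by move/trivIsetP : tF => /(_ _ _ _ _ ij) ->//; rewrite preimage_set0.
Qed.

HB.instance Definition _ := isMeasure.Build _ _ _ lebesgue_rVS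
  lebesgue_rVS0 lebesgue_rVS_ge0 lebesgue_rVS_sigma_additive.

Let lebesgue_rVS_sigma_finite : sigma_finite setT lebesgue_rVS.
Proof.
have /sigma_finiteP[F [TF ndF Foo]] := sigma_finiteT (@lebesgue_measure R).
have /sigma_finiteP[G [TG ndG Goo]] := sigma_finiteT mu.
exists (fun k => @rV_uncons n @^-1` (F k `*` G k)).
  apply/esym; rewrite -subTset => v _.
  have [k _ Fk] : (\bigcup_k F k) (rV_uncons v).1 by rewrite -TF.
  have [l _ Gl] : (\bigcup_k G k) (rV_uncons v).2 by rewrite -TG.
  exists (maxn k l) => //; split.
    by move: Fk; exact/subsetPset/ndF/leq_maxl.
  by move: Gl; exact/subsetPset/ndG/leq_maxr.
move=> k; have [mF Fk] := Foo k; have [mG Gk] := Goo k; split.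
  rewrite -[X in measurable X]setTI; apply: measurable_rV_uncons => //.
  exact: measurableX.
rewrite /lebesgue_rVS /pushforward -comp_preimage.
rewrite (_ : @rV_uncons n \o @rV_cons n = id); last exact/funext/rV_consK.
by rewrite preimage_id product_measure1E// lte_mul_pinfty// ge0_fin_numE.
Qed.

HB.instance Definition _ := Measure_isSigmaFinite.Build _ _ _ lebesgue_rVS
  lebesgue_rVS_sigma_finite.

End step.

Fixpoint lebesgue_rV n : {sigma_finite_measure set 'rV[R]_n -> \bar R} :=
  match n with
  | 0 => dirac (0 : 'rV[R]_0)
  | m.+1 => lebesgue_rVS (lebesgue_rV m)
  end.

Lemma lebesgue_rV_box n (A : 'I_n -> set (measurableTypeR R)) :
  (forall i, measurable (A i)) ->
  lebesgue_rV n [set v : 'rV[R]_n | forall i, A i (v ord0 i)] =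
  (\prod_(i < n) lebesgue_measure (A i))%E.
Proof.
elim: n A => [|n IH] A mA /=.
  by rewrite big_ord0 diracE mem_set//; case.
rewrite /lebesgue_rVS /pushforward.
rewrite (_ : _ @^-1` _ = A ord0 `*`
    [set v : 'rV[R]_n | forall i, A (lift ord0 i) (v ord0 i)]).
  rewrite product_measure1E//; last first.
    rewrite (_ : [set _ | _] = \bigcap_(i in [set: 'I_n])
        ((fun v : 'rV[R]_n => v ord0 i) @^-1` A (lift ord0 i))); last first.
      by apply/seteqP; split=> v /= h i; [move=> _; exact: h|exact: h].
    apply: fin_bigcap_measurable => // i _.
    rewrite -[X in measurable X]setTI.
    exact: (@measurable_coord R n i measurableT _ (mA (lift ord0 i))).
  rewrite big_ord_recl; congr (_ * _)%E.
  by apply: (IH (fun i => A (lift ord0 i))) => i; exact: mA.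
have E0 (x : R) (v : 'rV[R]_n) : rV_cons (x, v) ord0 ord0 = x.
  by have [] := rV_consK (x, v).
have E1 (x : R) (v : 'rV[R]_n) i : rV_cons (x, v) ord0 (lift ord0 i) = v ord0 i.
  have -> : lift ord0 i = rshift 1 i by exact/val_inj.
  exact: (row_mxEr (const_mx x : 'rV[R]_1) v).
apply/seteqP; split => -[x v] /=.
  move=> h; split; first by have := h ord0; rewrite E0.
  by move=> i; have := h (lift ord0 i); rewrite E1.
move=> [h0 h1] i; have [j ->|->] := unliftP ord0 i; first by rewrite E1.
by rewrite E0.
Qed.

End lebesgue_measure_rV.

Section sobolev.
Context {R : realType} {n : nat}.
Local Notation V := 'rV[R]_n.
Local Notation mu := (@lebesgue_rV R n).
Implicit Types (Omega : set V) (phi u g f : V -> R) (i j : 'I_n).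
Implicit Types (s : seq 'I_n) (r c gamma : R).

Definition enorm (x : V) : R := Num.sqrt (\sum_i x ord0 i ^+ 2).

(* The library's ball on 'rV[R]_n is the one of the sup norm. *)
Definition eball r : set V := [set x | enorm x < r].

Definition domain Omega := [/\ Omega !=set0, open Omega & connected Omega].

Definition partial i phi : V -> R := 'D_(delta_mx ord0 i) phi.

Definition partials s phi : V -> R := foldr partial phi s.

Definition laplacian phi : V -> R := fun x => \sum_i partials [:: i; i] phi x.

Fixpoint C_k k phi : Prop :=
  if k is k'.+1 then
    [/\ continuous phi,
        forall i x, derivable phi x (delta_mx ord0 i) &
        forall i, C_k k' (partial i phi)]
  else continuous phi.

Definition smooth phi := forall k, C_k k phi.

Definition support phi : set V := closure [set x | phi x != 0].

(* C_0^oo(Omega), its elements being extended by 0 to R^n. *)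
Definition test_function Omega phi :=
  [/\ smooth phi, compact (support phi) & support phi `<=` Omega].

(* Functions on Omega are represented by total functions, whose values outside
   of Omega are irrelevant. *)
Definition Lp Omega (p : \bar R) u := (u \_ Omega) \in Lfun mu p.

Definition is_weak_partial Omega s u g :=
  Lp Omega 2%:E g /\
  forall phi, test_function Omega phi ->
    \int[mu]_(x in Omega) (u x * partials s phi x) =
    (-1) ^+ size s * \int[mu]_(x in Omega) (g x * phi x).

(* A weak derivative is unique up to a null set; the integrals below do not
   depend on the representative chosen here. *)
Definition weak_partial Omega s u : V -> R :=
  xget (cst 0) [set g | is_weak_partial Omega s u g].

Definition W22 Omega u :=
  Lp Omega 2%:E u /\
  forall s, (0 < size s <= 2)%N -> exists g, is_weak_partial Omega s u g.

Definition W22_norm Omega u : R :=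
  Num.sqrt (\int[mu]_(x in Omega) (u x ^+ 2)
    + \sum_i \int[mu]_(x in Omega) (weak_partial Omega [:: i] u x ^+ 2)
    + \sum_i \sum_j
        \int[mu]_(x in Omega) (weak_partial Omega [:: i; j] u x ^+ 2)).

Definition W022 Omega u :=
  W22 Omega u /\
  forall e, 0 < e -> exists2 phi, test_function Omega phi &
    W22_norm Omega (u \- phi) < e.

Definition weak_laplacian Omega u : V -> R :=
  fun x => \sum_i weak_partial Omega [:: i; i] u x.

Definition weak_solution Omega f gamma u :=
  W022 Omega u /\
  forall phi, test_function Omega phi ->
    \int[mu]_(x in Omega)
      (weak_laplacian Omega u x * laplacian phi x
       + gamma * (\sum_i weak_partial Omega [:: i] u x * partial i phi x)
       - f x * phi x) = 0.

Definition buckling_quotient Omega u : R :=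
  (\int[mu]_(x in Omega) (weak_laplacian Omega u x ^+ 2)) /
  (\int[mu]_(x in Omega) (\sum_i weak_partial Omega [:: i] u x ^+ 2)).

Definition buckling_load Omega : \bar R :=
  ereal_inf [set (buckling_quotient Omega u)%:E | u in
    [set u | W022 Omega u /\ ~ {ae mu, forall x, Omega x -> u x = 0}]].

Definition nonneg_solution Omega f gamma :=
  exists2 u, weak_solution Omega f gamma u &
    {ae mu, forall x, Omega x -> 0 <= u x}.

(* +oo if no gamma is admissible *)
Definition gamma_f f Omega : \bar R :=
  ereal_inf [set gamma%:E | gamma in
    [set gamma | (- buckling_load Omega < gamma%:E)%E /\
      forall gamma', gamma <= gamma' -> nonneg_solution Omega f gamma']].

Definition convex_domains r c : set (set V) :=
  [set Omega | [/\ Omega `<=` eball r,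
                   convex_set (Omega : set (convex_lmodType V)),
                   domain Omega &
                   mu Omega = c%:E]].

End sobolev.

(* Main.v *)
From HB Require Import structures.
From mathcomp Require Import all_boot all_order all_algebra.
From mathcomp Require Import all_classical all_reals all_analysis.
From mathcomp Require Import measurable_realfun ess_sup_inf.
From mathcomp Require Import ring lra.
Require Import Defs.

(** Along a suitable limit of a minimizing sequence of domains the functional
    [gamma_f] cannot jump up, and the limit is again a convex domain of the
    prescribed measure.

    The point is to express admissibility of a parameter by test functions
    alone, since they pass easily from one domain to another.  Write
    [energy F gam phi] for half of [lap_sq phi + gam * grad_sq phi] minus the
    integral of [F * phi], where [F] is [f] extended by 0.  That [gam] exceeds
    minus the buckling load amounts, up to an arbitrarily small change of [gam],
    to the inequality [- gam * grad_sq phi <= lap_sq phi] for all test functions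
    ([buckling_rayleigh], [rayleigh_buckling]).  Under this inequality the
    energy at every larger parameter is coercive with a constant that does not
    depend on the domain ([coercive_of_rayleigh]), and then a nonnegative weak
    solution exists if and only if for every [e > 0] some test function
    minimizes the energy up to [e] and has a negative part of squared L2-norm at
    most [e] ([weak_solution_near_min], [near_min_weak_solution]): such near
    minimizers approximate the solution in one direction, and in the other one
    they form a Cauchy sequence by the parallelogram identity.

    Given a minimizing sequence of domains and an ultrafilter [U] on the indices,
    the limit [limdom] consists of the points some neighbourhood of which lies in
    [U]-almost all domains.  Every compact subset of the limit lies in [U]-almost
    all domains ([limdom_compact]); conversely the points of the domains at
    distance at least [d] from the complement lie in the limit, again for
    [U]-almost all indices ([limdom_inner]).  The boundary layer so neglected
    has a measure that tends to 0 with [d], uniformly over the convex subsets of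
    a cube ([thin_rind]): it is covered by the sets of points of [K] pushed out of
    [K] by one of finitely many short vectors, and many translates of such a set
    are disjoint.  Hence the limit is a convex domain of the same measure
    ([limdom_convex_domains]).

    A test function of the limit is a test function of [U]-almost all domains, so
    the inequality for the buckling load is inherited by the limit.  A near
    minimizer on a domain becomes a test function of the limit after a dilation
    with ratio close to 1, which changes the energy by an amount that is small
    uniformly in the domain ([energy_dilation]), and its negative part does not
    grow.  So near minimizers with small negative part exist on the limit
    ([limdom_near_min]), which therefore has a nonnegative solution for every
    parameter above the infimum of [gamma_f] ([limdom_gamma_f]). *)

Set Implicit Arguments.
Unset Strict Implicit.
Unset Printing Implicit Defensive.

Import Order.TTheory GRing.Theory Num.Theory.
Import numFieldNormedType.Exports.

Local Open Scope classical_set_scope.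
Local Open Scope ring_scope.


(** * Square-integrable functions *)

Section L2.
Context d (T : measurableType d) (R : realType).
Variable mu : {measure set T -> \bar R}.
Implicit Types u v w : T -> R.

Definition L2 u := measurable_fun setT u /\
  mu.-integrable setT (EFin \o (fun x => u x ^+ 2)).

Definition ip u v : R := \int[mu]_x (u x * v x).

Lemma L2_Lfun u : u \in Lfun mu 2%:E <-> L2 u.
Proof.
split=> [hu|[mu_ iu]].
  split; first by move: hu; rewrite inE => /andP[/[!inE]].
  exact: Lfun2_integrable_sqr.
rewrite inE; apply/andP; split; rewrite inE//= /finite_norm unlock /=.
rewrite poweR_lty//.
have [_] := integrableP _ _ _ iu; apply: le_lt_trans.
rewrite le_eqVlt; apply/orP; left; apply/eqP; apply: eq_integral => x _ /=.
by rewrite powR_mulrn// normrX real_normK ?num_real.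
Qed.

Lemma integrable_ip u v : L2 u -> L2 v ->
  mu.-integrable setT (EFin \o (fun x => u x * v x)).
Proof.
move=> /L2_Lfun hu /L2_Lfun hv.
by apply/Lfun1_integrable; exact: Lfun2_mul_Lfun1.
Qed.

Lemma L2D u v : L2 u -> L2 v -> L2 (u + v).
Proof.
move=> Lu Lv; have [mu_ iu] := Lu; have [mv iv] := Lv; split.
  exact: measurable_funD.
have -> : EFin \o (fun x => (u + v) x ^+ 2) =
  ((EFin \o (fun x => u x ^+ 2)) \+ (EFin \o (fun x => u x * v x))) \+
  ((EFin \o (fun x => u x * v x)) \+ (EFin \o (fun x => v x ^+ 2))).
  by apply/funext => x /=; rewrite -!EFinD; congr EFin; rewrite fctE; ring.
by apply: integrableD => //; apply: integrableD => //; exact: integrable_ip.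
Qed.

Lemma L2Z c u : L2 u -> L2 (c *: u).
Proof.
move=> [mu_ iu]; split; first exact: measurable_funM.
have -> : EFin \o (fun x => (c *: u) x ^+ 2) =
  (fun x => (c ^+ 2)%R%:E * (EFin \o (fun x => u x ^+ 2)%R) x)%E.
  apply/funext => x /=; rewrite -EFinM; congr EFin.
  by rewrite fctE [LHS]exprMn.
exact: integrableZl.
Qed.

Lemma L2N u : L2 u -> L2 (- u).
Proof. by move=> Lu; rewrite -scaleN1r; exact: L2Z. Qed.

Lemma L2B u v : L2 u -> L2 v -> L2 (u - v).
Proof. by move=> Lu Lv; apply: L2D => //; exact: L2N. Qed.

Lemma L20 : L2 0.
Proof.
split; first exact: measurable_cst.
have -> : EFin \o (fun x : T => (0 : T -> R) x ^+ 2) = cst 0%E.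
  by apply/funext => x /=; rewrite [X in X%:E]expr0n.
exact: integrable0.
Qed.

Lemma L2_sum (I : Type) (s : seq I) (P : pred I) (F : I -> T -> R) :
  (forall i, P i -> L2 (F i)) -> L2 (\sum_(i <- s | P i) F i).
Proof. by move=> h; apply: big_ind => //; [exact: L20|exact: L2D]. Qed.

Lemma ipC u v : ip u v = ip v u.
Proof. by apply: eq_Rintegral => x _; rewrite mulrC. Qed.

Lemma ipDl u v w : L2 u -> L2 v -> L2 w -> ip (u + v) w = ip u w + ip v w.
Proof.
move=> Lu Lv Lw; rewrite /ip -RintegralD//; try exact: integrable_ip.
by apply: eq_Rintegral => x _; rewrite mulrDl.
Qed.

Lemma ipZl c u w : L2 u -> L2 w -> ip (c *: u) w = c * ip u w.
Proof.
move=> Lu Lw; rewrite /ip -RintegralZl//; try exact: integrable_ip.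
by apply: eq_Rintegral => x _; rewrite mulrA.
Qed.

Lemma ipNl u w : L2 u -> L2 w -> ip (- u) w = - ip u w.
Proof. by move=> Lu Lw; rewrite -scaleN1r ipZl// mulN1r. Qed.

Lemma ipBl u v w : L2 u -> L2 v -> L2 w -> ip (u - v) w = ip u w - ip v w.
Proof. by move=> Lu Lv Lw; rewrite ipDl ?ipNl//; exact: L2N. Qed.

Lemma ipDr u v w : L2 u -> L2 v -> L2 w -> ip w (u + v) = ip w u + ip w v.
Proof. by move=> *; rewrite ipC ipDl// !(ipC w). Qed.

Lemma ipZr c u w : L2 u -> L2 w -> ip w (c *: u) = c * ip w u.
Proof. by move=> *; rewrite ipC ipZl// (ipC w). Qed.

Lemma ipNr u w : L2 u -> L2 w -> ip w (- u) = - ip w u.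
Proof. by move=> *; rewrite ipC ipNl// (ipC w). Qed.

Lemma ip0l u : ip 0 u = 0.
Proof.
rewrite /ip (_ : (fun x => _) = cst 0) ?Rintegral_cst ?mul0r//.
by apply/funext => x /=; rewrite mul0r.
Qed.

Lemma ip0r u : ip u 0 = 0. Proof. by rewrite ipC ip0l. Qed.

Lemma ip_suml (I : Type) (s : seq I) (F : I -> T -> R) w :
  (forall i, L2 (F i)) -> L2 w ->
  ip (\sum_(i <- s) F i) w = \sum_(i <- s) ip (F i) w.
Proof.
move=> LF Lw; elim: s => [|i s IH]; first by rewrite !big_nil ip0l.
by rewrite !big_cons ipDl ?IH//; exact: L2_sum.
Qed.

Lemma ip_sumr (I : Type) (s : seq I) (F : I -> T -> R) w :
  (forall i, L2 (F i)) -> L2 w ->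
  ip w (\sum_(i <- s) F i) = \sum_(i <- s) ip w (F i).
Proof.
by move=> LF Lw; rewrite ipC ip_suml//; apply: eq_bigr => i _; rewrite ipC.
Qed.

Lemma ip_ge0 u : 0 <= ip u u.
Proof. by apply: Rintegral_ge0 => x _; rewrite -expr2 sqr_ge0. Qed.

Lemma ip_sqD u v : L2 u -> L2 v ->
  ip (u + v) (u + v) = ip u u + 2 * ip u v + ip v v.
Proof.
move=> Lu Lv; have Luv := L2D Lu Lv.
by rewrite ipDl// !ipDr// (ipC v u); ring.
Qed.

Lemma ip_sqB u v : L2 u -> L2 v ->
  ip (u - v) (u - v) = ip u u - 2 * ip u v + ip v v.
Proof.
move=> Lu Lv; have LNv := L2N Lv.
by rewrite ip_sqD// (ipNl Lv LNv) !ipNr//; ring.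
Qed.

Lemma ip_young e u v : L2 u -> L2 v -> 0 < e ->
  2 * ip u v <= e * ip u u + e^-1 * ip v v.
Proof.
move=> Lu Lv e0.
have := ip_ge0 (e *: u - v); rewrite ip_sqB//; last exact: L2Z.
rewrite !(ipZl, ipZr)//; last exact: L2Z.
move=> h; have : 0 <= e^-1 * (e * (e * ip u u) - 2 * (e * ip u v) + ip v v).
  by apply: mulr_ge0 => //; rewrite invr_ge0 ltW.
suff -> : e^-1 * (e * (e * ip u u) - 2 * (e * ip u v) + ip v v)
   = e * ip u u + e^-1 * ip v v - 2 * ip u v by rewrite subr_ge0.
by field; rewrite gt_eqF.
Qed.

Lemma ip_CS u v : L2 u -> L2 v -> ip u v ^+ 2 <= ip u u * ip v v.
Proof.
move=> Lu Lv; have [uv0|uv0] := eqVneq (ip u v) 0.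
  by rewrite uv0 expr0n/= mulr_ge0 ?ip_ge0.
have h (c : R) : 0 <= c ^+ 2 * ip u u - 2 * c * ip u v + ip v v.
  have := ip_ge0 (c *: u - v); rewrite ip_sqB//; last exact: L2Z.
  rewrite !(ipZl, ipZr)//; last exact: L2Z.
  by rewrite (_ : c * (c * _) - 2 * (c * _) = c ^+ 2 * ip u u - 2 * c * ip u v)//; ring.
have [uu0|uu0] := eqVneq (ip u u) 0.
  have := h ((ip v v + 1) / (2 * ip u v)).
  rewrite uu0 mulr0 sub0r (_ : 2 * _ * _ = ip v v + 1); last by field.
  by lra.
have uup : 0 < ip u u by rewrite lt_neqAle eq_sym uu0 ip_ge0.
have := h (ip u v / ip u u).
rewrite (_ : _ + _ = (ip u u * ip v v - ip u v ^+ 2) / ip u u); last by field.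
by rewrite pmulr_lge0 ?invr_gt0// subr_ge0.
Qed.

Lemma ip_sqD_le u v : L2 u -> L2 v ->
  ip (u + v) (u + v) <= 2 * ip u u + 2 * ip v v.
Proof.
move=> Lu Lv; rewrite ip_sqD//.
have := ip_young Lu Lv ltr01; rewrite invr1; lra.
Qed.

Lemma le_ip u v : L2 u -> L2 v -> (forall x, `|u x| <= `|v x|) ->
  ip u u <= ip v v.
Proof.
move=> Lu Lv uv; apply: le_Rintegral => //; try exact: integrable_ip.
move=> x _; rewrite -!expr2 -[leLHS]real_normK ?num_real//.
by rewrite -[leRHS]real_normK ?num_real// lerXn2r// nnegrE.
Qed.

Lemma L2_ae_eq u v : L2 u -> measurable_fun setT v -> (u = v %[ae mu]) -> L2 v.
Proof.
move=> [mu_ iu] mv uv; split => //.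
apply/integrableP; split; first by apply/measurable_EFinP; exact: measurable_funX.
have [mui] := integrableP _ _ _ iu; apply: le_lt_trans.
rewrite le_eqVlt; apply/orP; left; apply/eqP; apply: ae_eq_integral => //.
- by apply: measurableT_comp => //; apply/measurable_EFinP; exact: measurable_funX.
- exact: measurableT_comp.
by move: uv; apply: filterS => x h _ /=; rewrite h.
Qed.

Lemma ae_eq_ip u u' v : measurable_fun setT u -> measurable_fun setT u' ->
  measurable_fun setT v -> (u = u' %[ae mu]) ->
  ip u v = ip u' v.
Proof.
move=> mu_ mu' mv uu'; rewrite /ip /Rintegral; congr fine.
apply: ae_eq_integral => //; try by apply/measurable_EFinP; exact: measurable_funM.
by move: uu'; apply: filterS => x h _ /=; rewrite h.
Qed.

Lemma ip_eq0_ae u : L2 u -> ip u u = 0 -> (u = 0 %[ae mu]).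
Proof.
move=> Lu u0.
have [mi _] := integrableP _ _ _ (integrable_ip Lu Lu).
have := integrable_fin_num measurableT (integrable_ip Lu Lu).
move: u0; rewrite /ip /Rintegral => u0 /fineK; rewrite u0 => hu.
have : (\int[mu]_(x in setT) `|(EFin \o (fun x => (u x * u x)%R)) x| = 0)%E.
  apply: etrans (esym hu); apply: eq_integral => x _ /=.
  by rewrite ger0_norm// -expr2 sqr_ge0.
move/(ae_eq_integral_abs _ measurableT mi); apply: filterS => x /(_ I) /=.
by case=> /eqP; rewrite mulf_eq0 orbb => /eqP ->.
Qed.

Lemma ae_eq0_ip u v : L2 u -> L2 v -> (u = 0 %[ae mu]) -> ip u v = 0.
Proof.
move=> [mu_ _] [mv _] u0; rewrite (@ae_eq_ip u 0 v)// ?ip0l//.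
exact: measurable_cst.
Qed.

Lemma EFin_ip u : L2 u -> (\int[mu]_x (u x ^+ 2)%:E)%E = (ip u u)%:E.
Proof.
move=> Lu; rewrite /ip /Rintegral fineK.
  by apply: eq_integral => x _; rewrite expr2.
exact: (integrable_fin_num measurableT (integrable_ip Lu Lu)).
Qed.

(** Identifies the limit when only a pointwise limit and L2-bounds are known. *)
Lemma fatou_ip (w_ : nat -> T -> R) w e : (forall l, L2 (w_ l)) ->
  (forall x, w_ ^~ x @ \oo --> w x) ->
  (forall l, ip (w_ l) (w_ l) <= e) -> L2 w /\ ip w w <= e.
Proof.
move=> Lw cw we.
have mw : measurable_fun setT w.
  by apply: (@measurable_fun_cvg _ _ _ setT w_) => [m|x _//]; case: (Lw m).
have mw2 l : measurable_fun setT (EFin \o (fun x => w_ l x ^+ 2)).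
  by apply/measurable_EFinP/measurable_funX; case: (Lw l).
have key : (\int[mu]_x (w x ^+ 2)%:E <= e%:E)%E.
  have -> : (\int[mu]_x (w x ^+ 2)%:E =
      \int[mu]_x (limn_einf (fun l => (w_ l x ^+ 2)%:E)))%E.
    apply: eq_integral => x _; apply/esym.
    have c2 : (fun l => (w_ l x ^+ 2)%:E) @ \oo --> (w x ^+ 2)%:E.
      apply: cvg_comp; first by apply: (@cvgM _ _ _ _ (w_ ^~ x) (w_ ^~ x)); exact: cw.
      exact: cvg_refl.
    rewrite is_cvg_limn_einfE; last by apply/cvg_ex; exists (w x ^+ 2)%:E.
    exact/cvg_lim.
  apply: le_trans (fatou mu measurableT mw2 _) _.
    by move=> l x _; rewrite lee_fin sqr_ge0.
  rewrite limn_einf_lim; apply: lime_le; first exact: is_cvg_einfs.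
  apply: nearW => l; apply: ereal_inf_le; exists (ip (w_ l) (w_ l))%:E.
    by exists l => //=; rewrite -EFin_ip.
  by rewrite lee_fin.
have Lww : L2 w.
  split=> //; apply/integrableP; split.
    by apply/measurable_EFinP; exact: measurable_funX.
  apply: le_lt_trans (ltry e); apply: le_trans key.
  rewrite le_eqVlt; apply/orP; left; apply/eqP; apply: eq_integral => x _ /=.
  by rewrite ger0_norm// sqr_ge0.
by split=> //; rewrite -lee_fin -EFin_ip.
Qed.

Lemma sum_half_lt (n : nat) : \sum_(0 <= k < n) (2^-1 : R) ^+ k <= 2.
Proof.
have -> : \sum_(0 <= k < n) (2^-1 : R) ^+ k = 2 - 2 * 2^-1 ^+ n.
  elim: n => [|n IH]; first by rewrite big_geq// expr0; lra.
  by rewrite big_nat_recr//= IH exprS; lra.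
by rewrite lerBlDr lerDl mulr_ge0// exprn_ge0// invr_ge0.
Qed.

(** The sum of 2^k |v_(k+1) - v_k|^2 is integrable, hence finite almost
    everywhere, and |a| <= 2^-k + 2^k a^2 then makes the telescoping series of
    v converge absolutely at almost every point. *)
Lemma L2_cvg_fast (v : nat -> T -> R) : (forall k, L2 (v k)) ->
  (forall k, ip (v k.+1 - v k) (v k.+1 - v k) <= (4^-1) ^+ k) ->
  exists (v' : nat -> T -> R) (u : T -> R),
   [/\ forall k, L2 (v' k), forall k, (v k = v' k %[ae mu]) &
    forall x, v' ^~ x @ \oo --> u x].
Proof.
move=> Lv vv.
pose dv k := v k.+1 - v k.
have Ldv k : L2 (dv k) by exact: L2B.
pose g k x := ((2 ^+ k * dv k x ^+ 2)%:E : \bar R).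
have g0 k x : (0 <= g k x)%E by rewrite lee_fin mulr_ge0 ?sqr_ge0// exprn_ge0.
have mg k : measurable_fun setT (g k).
  apply/measurable_EFinP; apply: measurable_funM => //.
  by apply: measurable_funX; case: (Ldv k).
pose W x := (\sum_(0 <= k <oo) g k x)%E.
have W0 x : (0 <= W x)%E by apply: nneseries_ge0.
have mW : measurable_fun setT W.
  apply: (@emeasurable_fun_cvg _ _ _ setT (fun n x => \sum_(0 <= k < n) g k x)%E).
    by move=> m; apply: emeasurable_sum.
  by move=> x _; apply: is_cvg_nneseries.
have iW : mu.-integrable setT W.
  apply/integrableP; split=> //.
  under eq_integral do rewrite gee0_abs//.
  rewrite integral_nneseries//.
  apply: le_lt_trans (ltry 2); apply: lime_le.
    by apply: is_cvg_nneseries => k _ _; exact: integral_ge0.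
  apply: nearW => n.
  apply: le_trans (_ : (\sum_(0 <= k < n) (2^-1 : R) ^+ k)%:E <= _)%E.
    rewrite -sumEFin; apply: lee_sum => k _.
    rewrite /g; under eq_integral do rewrite EFinM.
    rewrite [X in (X <= _)%E](_ : _ = (2 ^+ k)%R%:E * \int[mu]_x (dv k x ^+ 2)%R%:E)%E; last first.
      apply: ge0_integralZl_EFin => //.
      - by move=> x _; rewrite lee_fin sqr_ge0.
      - by apply/measurable_EFinP; apply: measurable_funX; case: (Ldv k).
    rewrite (EFin_ip (Ldv k)) -EFinM lee_fin.
    apply: le_trans (_ : 2 ^+ k * 4^-1 ^+ k <= _).
      by rewrite ler_wpM2l// ?exprn_ge0//; exact: vv.
    by rewrite -exprMn; have -> : 2 * 4^-1 = 2^-1 :> R by lra.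
  by rewrite lee_fin sum_half_lt.
(* N is the null set where the series diverges; v' vanishes on it. *)
have [N [mN N0 WN]] := integrable_ae measurableT iW.
pose A := ~` N.
have mA : measurable A by exact: measurableC.
have WA x : A x -> W x \is a fin_num.
  by move=> Ax; apply: contrapT => nW; apply: Ax; apply: WN => /= /(_ I).
pose v' k := v k \_ A.
have vv' k : (v k = v' k %[ae mu]).
  exists N; split=> // x /= h; apply: contrapT => Nx; apply: h => _.
  by rewrite /v' patchE mem_set.
have cv x : cvgn (v' ^~ x).
  have [Ax|nAx] := pselect (A x); last first.
    rewrite (_ : v' ^~ x = fun=> 0); first exact: is_cvg_cst.
    by apply/funext => k; rewrite /v' patchE memNset.
  rewrite (_ : v' ^~ x = v ^~ x); last first.
    by apply/funext => k; rewrite /v' patchE mem_set.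
  have cS : cvgn (series (fun k => 2 ^+ k * dv k x ^+ 2)).
    apply: nondecreasing_is_cvgn.
      by apply: nondecreasing_series => k _ _; rewrite mulr_ge0 ?sqr_ge0 ?exprn_ge0.
    exists (fine (W x)) => _ [n _ <-].
    rewrite -lee_fin fineK ?WA// /series/= -sumEFin.
    exact: (@nneseries_lim_ge R (g ^~ x) xpredT 0 n).
  have cd : cvgn (series (telescope (v ^~ x))).
    apply: normed_cvg.
    apply: (@series_le_cvg _ _ (geometric 1 2^-1 + (fun k => 2 ^+ k * dv k x ^+ 2))).
    - by move=> k /=.
    - move=> k; rewrite addr_ge0//= ?mul1r ?exprn_ge0// ?invr_ge0//.
      by rewrite mulr_ge0 ?sqr_ge0 ?exprn_ge0.
    - move=> k; rewrite (_ : (_ + _) k = 2^-1 ^+ k + 2 ^+ k * dv k x ^+ 2); last first.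
        by rewrite fctE/= mul1r.
      rewrite /normed_series_of /=.
      have -> : telescope (v ^~ x) k = dv k x by [].
      set p : R := 2^-1 ^+ k; set q := dv k x.
      have p0 : 0 < p by rewrite exprn_gt0// invr_gt0.
      have -> : 2 ^+ k = p^-1 :> R by rewrite /p exprVn invrK.
      have : 0 <= p^-1 * ((`|q| - p) ^+ 2) by rewrite mulr_ge0 ?sqr_ge0// invr_ge0 ltW.
      rewrite sqrrB real_normK ?num_real//.
      rewrite (_ : p^-1 * _ = p + p^-1 * q ^+ 2 - `|q| - `|q|); last first.
        by field; rewrite gt_eqF.
      have := normr_ge0 q; lra.
    apply: is_cvg_seriesD => //; apply: is_cvg_geometric_series.
    by rewrite ger0_norm ?invr_ge0// invf_lt1// ltr1n.
  have -> : v ^~ x = fun n => v 0%N x + series (telescope (v ^~ x)) n.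
    by apply/funext => n; exact: (eq_sum_telescope (v ^~ x)).
  by apply: is_cvgD => //; exact: is_cvg_cst.
exists v', (fun x => lim (v' ^~ x @ \oo)); split=> //.
move=> k; apply: L2_ae_eq (Lv k) _ (vv' k).
by apply/(measurable_restrictT _ mA); apply: measurable_funS (Lv k).1.
Qed.

(** A subsequence with increments below 4^-k converges almost everywhere, and
    Fatou's lemma bounds the distance from every u_k to its limit. *)
Lemma L2_complete (u_ : nat -> T -> R) : (forall k, L2 (u_ k)) ->
  (forall e, 0 < e -> exists N, forall k l, (N <= k)%N -> (N <= l)%N ->
    ip (u_ k - u_ l) (u_ k - u_ l) <= e) ->
  exists2 u, L2 u & forall e, 0 < e -> exists N, forall k, (N <= k)%N ->
    ip (u - u_ k) (u - u_ k) <= e.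
Proof.
move=> Lu cu.
have e0 k : 0 < (4^-1 : R) ^+ k by rewrite exprn_gt0// invr_gt0.
pose N k := sval (cid (cu _ (e0 k))).
have NP k : forall i j, (N k <= i)%N -> (N k <= j)%N ->
    ip (u_ i - u_ j) (u_ i - u_ j) <= 4^-1 ^+ k := svalP (cid (cu _ (e0 k))).
pose M k := (k + \sum_(0 <= i < k.+1) N i)%N.
have NM k : (N k <= M k)%N by rewrite /M big_nat_recr//= addnA leq_addl.
have MM k l : (k <= l)%N -> (M k <= M l)%N.
  move=> kl; rewrite /M (@big_cat_nat _ _ _ k.+1 0 l.+1)//=.
  by rewrite leq_add// leq_addr.
have [v' [u [Lv' vv' cv']]] := @L2_cvg_fast (u_ \o M) (fun k => Lu _)
  (fun k => NP k _ _ (leq_trans (NM k) (MM _ _ (leqnSn k))) (NM k)).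
have key e n : 0 < e -> (forall k l, (n <= k)%N -> (n <= l)%N ->
    ip (u_ k - u_ l) (u_ k - u_ l) <= e) ->
  forall k, (n <= k)%N -> L2 (u - u_ k) /\ ip (u - u_ k) (u - u_ k) <= e.
  move=> e_0 hn k nk.
  have [l0 hl0] : exists l0, forall l, (n <= M (l + l0))%N.
    by exists n => l; apply: leq_trans (leq_addr _ _); exact: leq_addl.
  apply: (@fatou_ip (fun l => v' (l + l0)%N - u_ k)).
  - by move=> l; exact: L2B.
  - move=> x; apply: cvgB; last exact: cvg_cst.
    by move: (cv' x); rewrite -(cvg_shiftn l0).
  - move=> l; have Lw := L2B (Lv' (l + l0)%N) (Lu k).
    have Lw' := L2B (Lu (M (l + l0)%N)) (Lu k).
    apply: le_trans (hn (M (l + l0)%N) k _ _) => //.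
    have ww : (v' (l + l0)%N - u_ k = u_ (M (l + l0)%N) - u_ k %[ae mu]).
      by move: (vv' (l + l0)%N); apply: filterS => x h t /=; rewrite !fctE -(h t).
    rewrite (ae_eq_ip Lw.1 Lw'.1 Lw.1 ww) ipC (ae_eq_ip Lw.1 Lw'.1 Lw'.1 ww).
    by [].
exists u.
  have [n hn] := cu 1 ltr01.
  have [Lun _] := key 1 n ltr01 hn n (leqnn n).
  by rewrite -(subrK (u_ n) u); exact: L2D.
move=> e e_0; have [n hn] := cu e e_0; exists n => k nk.
exact: (key e n e_0 hn k nk).2.
Qed.

Lemma L2_le u v : measurable_fun setT u -> L2 v -> (forall x, `|u x| <= `|v x|) -> L2 u.
Proof.
move=> mu_ [mv iv] uv; split=> //.
apply: (le_integrable measurableT _ _ iv).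
  by apply/measurable_EFinP; exact: measurable_funX.
by move=> x _ /=; rewrite lee_fin !normrX lerXn2r// nnegrE.
Qed.

Lemma normr_ip_le u v : L2 u -> L2 v -> `|ip u v| <= (ip u u + ip v v) / 2.
Proof.
move=> Lu Lv; have := ip_young Lu Lv ltr01; have := ip_young Lu (L2N Lv) ltr01.
rewrite !ipNr//; last exact: L2N.
rewrite ipNl// opprK invr1 !mul1r => h1 h2; rewrite ler_norml; lra.
Qed.

Lemma integrable_Rsum (I : Type) (s : seq I) (F : I -> T -> R) :
  (forall i, mu.-integrable setT (EFin \o F i)) ->
  mu.-integrable setT (EFin \o (fun x => \sum_(i <- s) F i x)).
Proof.
move=> iF; elim: s => [|i s IH].
  rewrite (_ : (fun x => _) = cst 0); last by apply/funext => x; rewrite big_nil.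
  exact: integrable0.
rewrite (_ : EFin \o _ = (EFin \o F i) \+ (EFin \o (fun x => \sum_(i <- s) F i x))).
  exact: integrableD.
by apply/funext => x /=; rewrite big_cons.
Qed.

Lemma Rintegral_sum (I : Type) (s : seq I) (F : I -> T -> R) :
  (forall i, mu.-integrable setT (EFin \o F i)) ->
  \int[mu]_x (\sum_(i <- s) F i x) = \sum_(i <- s) \int[mu]_x F i x.
Proof.
move=> iF; elim: s => [|i s IH].
  rewrite big_nil (_ : (fun x => _) = cst 0); last by apply/funext => x; rewrite big_nil.
  by rewrite Rintegral_cst ?mul0r.
rewrite big_cons -IH -RintegralD//; last exact: integrable_Rsum.
by apply: eq_Rintegral => x _; rewrite big_cons.
Qed.

End L2.

(** * Lebesgue measure on R^n *)

Section lebesgue_rV_theory.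
Context {R : realType} (n : nat).
Local Notation V := 'rV[R]_n.
Local Notation mu := (@lebesgue_rV R n).
Implicit Types (a b : 'I_n -> R) (x y v : V).

Definition obox a b : set V := [set v | forall i, a i < v ord0 i < b i].

Lemma oboxE a b : obox a b = [set v | forall i, `]a i, b i[%classic (v ord0 i)].
Proof. by apply/seteqP; split=> v /= h i; have := h i; rewrite in_itv. Qed.

Lemma measurable_obox a b : measurable (obox a b).
Proof.
rewrite (_ : obox a b = \bigcap_(i in [set: 'I_n])
    ((fun v : V => v ord0 i) @^-1` `]a i, b i[%classic)).
  apply: fin_bigcap_measurable => // i _; rewrite -[X in measurable X]setTI.
  exact: (@measurable_coord R n i measurableT).
by rewrite oboxE; apply/seteqP; split=> v /= h i => [_|]; exact: h.
Qed.

Lemma lebesgue_obox a b :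
  mu (obox a b) = (\prod_(i < n) (if a i < b i then b i - a i else 0)%:E)%E.
Proof.
rewrite oboxE (@lebesgue_rV_box R n (fun i => `]a i, b i[%classic)); last first.
  by move=> i; exact: measurable_itv.
apply: eq_bigr => i _; rewrite lebesgue_measure_itv/= lte_fin.
by case: ifP.
Qed.

Lemma oboxI a b a' b' : obox a b `&` obox a' b' =
  obox (fun i => Num.max (a i) (a' i)) (fun i => Num.min (b i) (b' i)).
Proof.
apply/seteqP; split=> v /=.
  by move=> [h h'] i; rewrite gt_max lt_min; have /andP[-> ->] := h i; have /andP[-> ->] := h' i.
move=> h; split=> i; have := h i; rewrite gt_max lt_min.
  by move=> /andP[/andP[-> _] /andP[-> _]].
by move=> /andP[/andP[_ ->] /andP[_ ->]].
Qed.

Definition oboxes : set (set V) := [set obox ab.1 ab.2 | ab in setT].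

Lemma obox_in a b : oboxes (obox a b).
Proof. by exists (a, b). Qed.

Lemma oboxes_setI : setI_closed oboxes.
Proof. by move=> _ _ [[a b] _ <-] [[c e] _ <-]; rewrite oboxI; exact: obox_in. Qed.

Definition cube (m : R) := obox (fun=> - m) (fun=> m).

Lemma cube_cover : \bigcup_k cube k%:R = setT.
Proof.
rewrite -subTset => v _; pose M := \sum_i `|v ord0 i|.
exists (Num.truncn M).+1 => //= i.
have /andP[_ h] := truncn_itv (sumr_ge0 _ (fun i _ => normr_ge0 (v ord0 i)) : 0 <= M).
rewrite -ltr_norml; apply: le_lt_trans h.
by rewrite /M (bigD1 i)//= lerDl sumr_ge0.
Qed.

Lemma measurable_rVE : @measurable _ V = <<s oboxes >>.
Proof.
apply/seteqP; split=> A.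
  move=> mA.
  have mid : @measurable_fun _ _ (g_sigma_algebraType oboxes) V setT id.
    apply: (@measurable_fun_rV R n _ (g_sigma_algebraType oboxes) id) => i.
    apply: (measurability _ (RGenOpens.measurableE R)).
    move=> _ [_ [c [e ->]] <-]; rewrite setTI.
    rewrite (_ : _ @^-1` _ = \bigcup_k
      obox (fun j => if j == i then c else - k%:R) (fun j => if j == i then e else k%:R)).
      by apply: bigcupT_measurable => k; apply: sub_sigma_algebra; exact: obox_in.
    apply/seteqP; split=> v /=.
      rewrite in_itv/= => h.
      have [k _ hk] : (\bigcup_k cube k%:R) v by rewrite cube_cover.
      by exists k => // j; case: eqP => [->//|_]; exact: hk.
    by move=> [k _ /(_ i)]; rewrite eqxx in_itv.
  by have := mid measurableT A mA; rewrite setTI preimage_id.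
by apply: smallest_sub; [exact: sigma_algebra_measurable|move=> _ [[a b] _ <-]; exact: measurable_obox].
Qed.

(** The open boxes are stable under intersection and generate the Borel sets. *)
Lemma rV_measure_unique (m1 m2 : {measure set V -> \bar R}) :
  (forall a b, m1 (obox a b) = m2 (obox a b)) ->
  (forall k, m1 (cube k%:R) < +oo)%E ->
  forall A, measurable A -> m1 A = m2 A.
Proof.
move=> m12 m1oo A mA.
apply: (measure_unique oboxes (fun k => cube k%:R)) => //.
- exact: measurable_rVE.
- exact: oboxes_setI.
- by move=> k; exact: obox_in.
- exact: cube_cover.
- by move=> _ [[a b] _ <-].
Qed.

Lemma lebesgue_obox_lty a b : (mu (obox a b) < +oo)%E.
Proof. by rewrite lebesgue_obox prodEFin ltry. Qed.

Lemma nbhs_rat_obox (A : set V) v : nbhs v A ->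
  exists ab : {ffun 'I_n -> rat} * {ffun 'I_n -> rat},
    obox (fun i => ratr (ab.1 i)) (fun i => ratr (ab.2 i)) v /\
    [set w : V | forall i, ratr (ab.1 i) <= w ord0 i <= ratr (ab.2 i)] `<=` A.
Proof.
move=> /nbhs_ballP[e /= e0 he].
have hp i : exists q : rat, v ord0 i - e < ratr q < v ord0 i.
  have [q] := @rat_in_itvoo R (v ord0 i - e) (v ord0 i) ltac:(by rewrite ltrBlDr ltrDl).
  by rewrite in_itv/=; exists q.
have hq i : exists q : rat, v ord0 i < ratr q < v ord0 i + e.
  have [q] := @rat_in_itvoo R (v ord0 i) (v ord0 i + e) ltac:(by rewrite ltrDl).
  by rewrite in_itv/=; exists q.
have [p pP] := choice hp; have [q qP] := choice hq.
exists ([ffun i => p i], [ffun i => q i]); split.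
  by move=> i /=; rewrite !ffunE; have /andP[_ ->] := pP i; have /andP[-> _] := qP i.
move=> w Fw; apply: he; split=> // i0 j; rewrite (ord1 i0).
have := Fw j; have := pP j; have := qP j; rewrite /= !ffunE /ball/= ltr_norml.
move=> /andP[? ?] /andP[? ?] /andP[? ?]; apply/andP; split; lra.
Qed.

(** An open set is the union of the boxes with rational vertices that it
    contains. *)
Lemma open_rV_measurable (A : set V) : open A -> measurable A.
Proof.
move=> oA.
pose F (ab : {ffun 'I_n -> rat} * {ffun 'I_n -> rat}) :=
  obox (fun i => ratr (ab.1 i)) (fun i => ratr (ab.2 i)).
rewrite (_ : A = \bigcup_(ab in [set: _]) (if `[< F ab `<=` A >] then F ab else set0)).
  apply: countable_bigcupT_measurable; first exact: countableP.
  by move=> ab; case: ifP => // _; exact: measurable_obox.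
apply/seteqP; split=> v; last first.
  by move=> [ab _]; case: ifP => // /asboolP; exact.
move=> Av; have [ab [vab abA]] := nbhs_rat_obox (open_nbhs_nbhs (conj oA Av)).
exists ab => //; rewrite asboolT// => w Fw; apply: abA => i.
by have /andP[/ltW -> /ltW ->] := Fw i.
Qed.

Lemma continuous_rV_measurable (f : V -> R) : continuous f -> measurable_fun setT f.
Proof.
move=> /continuousP cf; apply: (measurability _ (RGenOpens.measurableE R)).
move=> _ [_ [a [b ->] <-]]; rewrite setTI; apply: open_rV_measurable.
exact/cf/interval_open.
Qed.

Definition affine (c : R) (t : V) (v : V) : V := c *: v + t.

Lemma measurable_affine c t : measurable_fun setT (affine c t).
Proof.
apply: measurable_fun_rV => i.
rewrite (_ : (fun _ => _) = (fun v : V => c * v ord0 i + t ord0 i)); last first.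
  by apply/funext => v; rewrite /affine !mxE.
apply: measurable_funD => //; apply: measurable_funM => //.
exact: measurable_coord.
Qed.

Lemma affine_obox c t a b : 0 < c -> affine c t @^-1` obox a b =
  obox (fun i => c^-1 * (a i - t ord0 i)) (fun i => c^-1 * (b i - t ord0 i)).
Proof.
move=> c0; apply/seteqP; split=> v /= h i; have := h i; rewrite !mxE.
  by rewrite !ltr_pdivrMl// ltr_pdivlMl// ltrBlDr ltrBrDr.
by rewrite !ltr_pdivrMl// ltr_pdivlMl// ltrBlDr ltrBrDr.
Qed.

(** Both sides are measures, finite on cubes, that agree on boxes by the
    product formula; the factor is the inverse of the Jacobian of a homothety. *)
Lemma lebesgue_affine c t A : 0 < c -> measurable A ->
  pushforward mu (affine c t) A = ((c^-1 ^+ n)%:E * mu A)%E.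
Proof.
move=> c0 mA.
have k0 : 0 <= c^-1 ^+ n by rewrite exprn_ge0// invr_ge0 ltW.
have mf := measurable_affine c t.
have eqb a b : pushforward mu (affine c t) (obox a b) = mscale (NngNum k0) mu (obox a b).
  rewrite /pushforward affine_obox// lebesgue_obox /=.
  change (mscale (NngNum k0) mu (obox a b)) with ((c^-1 ^+ n)%:E * mu (obox a b))%E.
  rewrite lebesgue_obox !prodEFin -EFinM; congr EFin.
  have -> : c^-1 ^+ n = \prod_(i < n) c^-1 by rewrite prodr_const card_ord.
  rewrite -big_split/=; apply: eq_bigr => i _.
  rewrite ltr_pM2l ?invr_gt0// ltrD2r; case: ifP => _; last by rewrite mulr0.
  by ring.
apply: (@rV_measure_unique (pushforward mu (affine c t)) (mscale (NngNum k0) mu)) => //.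
move=> k; change (mu (affine c t @^-1` obox (fun=> - k%:R)%R (fun=> k%:R)%R) < +oo)%E.
by rewrite affine_obox//; exact: lebesgue_obox_lty.
Qed.

Lemma ge0_integral_affine c t (f : V -> \bar R) : 0 < c ->
  measurable_fun setT f -> (forall x, 0 <= f x)%E ->
  (\int[mu]_x f (affine c t x) = (c^-1 ^+ n)%:E * \int[mu]_x f x)%E.
Proof.
move=> c0 mf f0.
have k0 : 0 <= c^-1 ^+ n by rewrite exprn_ge0// invr_ge0 ltW.
have := @ge0_integral_pushforward _ _ _ _ R _ (measurable_affine c t) mu setT f measurableT mf (fun x _ => f0 x).
rewrite preimage_setT => <-.
transitivity (\int[mscale (NngNum k0) mu]_x f x)%E; last by rewrite ge0_integral_mscale.
apply: eq_measure_integral; first exact: measurable_affine.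
by move=> mf' A mA _; exact: lebesgue_affine.
Qed.

Lemma integral_affine c t (f : V -> R) : 0 < c ->
  mu.-integrable setT (EFin \o f) ->
  mu.-integrable setT (EFin \o (f \o affine c t)) /\
  \int[mu]_x f (affine c t x) = c^-1 ^+ n * \int[mu]_x f x.
Proof.
move=> c0 intf; have [/measurable_EFinP mf fi] := integrableP _ _ _ intf; split.
  apply/integrableP; split.
    by apply/measurable_EFinP; apply: measurableT_comp => //; exact: measurable_affine.
  rewrite (ge0_integral_affine t (f := fun x => `|(f x)%:E|%E) c0)//.
    by rewrite lte_mul_pinfty// lee_fin exprn_ge0// invr_ge0 ltW.
  by apply: measurableT_comp => //; exact/measurable_EFinP.
have mfE : measurable_fun setT (EFin \o f) by apply/measurable_EFinP.
rewrite /Rintegral integralE [in RHS]integralE.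
rewrite (_ : (fun x => (f (affine c t x))%:E) ^\+%E = (EFin \o f)^\+%E \o affine c t); last by apply/funext => x; rewrite /= ?(funeposE, funenegE).
rewrite (_ : (fun x => (f (affine c t x))%:E) ^\-%E = (EFin \o f)^\-%E \o affine c t); last by apply/funext => x; rewrite /= ?(funeposE, funenegE).
rewrite !ge0_integral_affine//; last 2 first.
- exact: measurable_funeneg.
- exact: measurable_funepos.
have p := integrable_pos_fin_num measurableT intf.
have q := integrable_neg_fin_num measurableT intf.
rewrite -muleBr ?fineM//; last 2 first.
- by rewrite fin_numB p q.
- by rewrite fin_num_adde_defl// fin_numN.
Qed.

Lemma L2_affine c t (u : V -> R) : 0 < c -> L2 mu u -> L2 mu (u \o affine c t).
Proof.
move=> c0 [mu_ iu]; split.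
  by apply: measurableT_comp => //; exact: measurable_affine.
exact: (integral_affine t c0 iu).1.
Qed.

Lemma ip_affine c t (u v : V -> R) : 0 < c -> L2 mu u -> L2 mu v ->
  ip mu (u \o affine c t) (v \o affine c t) = c^-1 ^+ n * ip mu u v.
Proof.
by move=> c0 Lu Lv; exact: (integral_affine t c0 (integrable_ip Lu Lv)).2.
Qed.

Lemma lebesgue_shift t (A : set V) : measurable A ->
  mu ((fun v => v + t) @^-1` A) = mu A.
Proof.
move=> mA; have := lebesgue_affine t ltr01 mA.
rewrite invr1 expr1n mul1e => <-.
rewrite /pushforward (_ : affine 1 t = fun v => v + t)//.
by apply/funext => v; rewrite /affine scale1r.
Qed.

Lemma integral_shift t (f : V -> R) : mu.-integrable setT (EFin \o f) ->
  \int[mu]_x f (x + t) = \int[mu]_x f x.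
Proof.
move=> /(integral_affine t ltr01)[_]; rewrite invr1 expr1n mul1r => <-.
by apply: eq_Rintegral => x _; rewrite /affine scale1r.
Qed.

Lemma bounded_cube_L2 m C (u : V -> R) : measurable_fun setT u ->
  {ae mu, forall x, `|u x| <= C} -> (forall x, ~ cube m x -> u x = 0) ->
  L2 mu u.
Proof.
move=> mu_ uC u0; split=> //.
have mu2 : measurable_fun setT (EFin \o (fun x => u x ^+ 2)).
  by apply/measurable_EFinP; exact: measurable_funX.
apply/integrableP; split=> //.
have mc : measurable (cube m) by exact: measurable_obox.
rewrite (_ : (\int[mu]_x `|(EFin \o (fun x => (u x ^+ 2)%R)) x| =
   \int[mu]_(x in cube m) `|(EFin \o (fun x => (u x ^+ 2)%R)) x|)%E); last first.
  rewrite [RHS]integral_mkcond; apply: eq_integral => x _.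
  rewrite patchE; case: ifPn => // /negP; rewrite inE => /u0 /= ->.
  by rewrite expr0n normr0.
apply: le_lt_trans (_ : (\int[mu]_(x in cube m) (C ^+ 2)%:E < +oo)%E).
  apply: ae_ge0_le_integral => //.
  - by apply: measurable_funTS; apply: measurableT_comp.
  - by move=> x _; rewrite lee_fin sqr_ge0.
  - move: uC; apply: filterS => x h _ /=.
    by rewrite lee_fin normrX lerXn2r ?nnegrE// (le_trans _ h).
rewrite integral_cst// lte_mul_pinfty ?lee_fin ?sqr_ge0//.
exact: lebesgue_obox_lty.
Qed.

End lebesgue_rV_theory.

(** * Directional derivatives *)

Section directional.
Context {R : realType} {V : normedModType R}.
Implicit Types (f g : V -> R) (v w x y : V).

Lemma line_is_derive f v x (s : R) : derivable f (s *: v + x) v ->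
  is_derive s 1 (fun h : R => f (h *: v + x)) ('D_v f (s *: v + x)).
Proof.
move=> df.
have E : (fun h : R => h^-1 *: (((fun h0 => f (h0 *: v + x)) \o shift s) (h *: 1) - f (s *: v + x)))
   = (fun h : R => h^-1 *: ((f \o shift (s *: v + x)) (h *: v) - f (s *: v + x))).
  by apply/funext => h /=; rewrite [h *: 1]mulr1 scalerDl addrA.
split.
  by rewrite /derivable E.
by rewrite /derive E.
Qed.

(** The mean value theorem on the line through x with direction v, needing
    only the derivative in that direction. *)
Lemma line_MVT f v x (s : R) : (forall y, derivable f y v) ->
  exists2 xi : R, `|xi| <= `|s| & f (s *: v + x) - f x = s * 'D_v f (xi *: v + x).
Proof.
move=> df.
have dl (t : R) : is_derive t 1 (fun h : R => f (h *: v + x)) ('D_v f (t *: v + x)).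
  exact: line_is_derive.
have cl : continuous (fun h : R => f (h *: v + x)).
  by move=> t; apply/differentiable_continuous/derivable1_diffP; case: (dl t).
have [s0|s0] := leP 0 s.
  have [xi] := @MVT_segment R _ _ 0 s s0 (fun t _ => dl t) (continuous_subspaceT cl).
  rewrite in_itv/= => /andP[x0 xs].
  rewrite scale0r add0r subr0 mulrC => ->; exists xi => //.
  by rewrite !ger0_norm.
have [xi] := @MVT_segment R _ _ s 0 (ltW s0) (fun t _ => dl t) (continuous_subspaceT cl).
rewrite in_itv/= => /andP[sx x0].
rewrite scale0r add0r sub0r => h; exists xi; last by rewrite -opprB h; ring.
by rewrite !ler0_norm ?lerN2// ltW.
Qed.

Definition C1dir f v := (forall x, derivable f x v) /\ continuous ('D_v f).

Lemma nbhs_plane (P : V -> Prop) v w x : nbhs x P ->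
  exists2 d : R, 0 < d & forall s t : R, `|s| <= d -> `|t| <= d -> P (s *: v + t *: w + x).
Proof.
move=> /nbhs_ballP[r /= r0 rP].
pose N := `|v| + `|w| + 1.
have N0 : 0 < N by rewrite ltr_wpDl// addr_ge0.
exists (r / 2 / N); first by rewrite !divr_gt0.
move=> s t hs ht; apply: rP; rewrite -ball_normE /ball_/=.
rewrite opprD addrCA subrr addr0 normrN.
apply: le_lt_trans (ler_normD _ _) _; rewrite !normrZ.
apply: (@le_lt_trans _ _ (r / 2 / N * `|v| + r / 2 / N * `|w|)).
  by rewrite lerD// ler_wpM2r.
rewrite -mulrDr; apply: (@le_lt_trans _ _ (r / 2 / N * N)).
  by apply: ler_wpM2l; [rewrite !divr_ge0// ltW|rewrite /N lerDl].
by rewrite divfK ?gt_eqF//; lra.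
Qed.

(** The increment of f along h v + h w is split into one step along v and one
    along w; the mean value theorem evaluates each step at a point near x,
    where continuity of the two derivatives applies. *)
Lemma C1dirD_derive f v w : C1dir f v -> C1dir f w ->
  forall x, is_derive x (v + w) f ('D_v f x + 'D_w f x).
Proof.
move=> [dv cv] [dw cw] x.
suff H : h^-1 *: ((f \o shift x) (h *: (v + w)) - f x) @[h --> (0:R)^'] -->
   'D_v f x + 'D_w f x.
  by split; [apply/cvg_ex; exists ('D_v f x + 'D_w f x)|exact/cvg_lim].
apply/cvgrPdist_le => e e0.
have e2 : 0 < e / 2 by rewrite divr_gt0.
have /(@nbhs_plane _ v w)[d1 d10 h1] : nbhs x (fun y => `|'D_v f x - 'D_v f y| <= e / 2).
  by move/cvgrPdist_le : (cv x) => /(_ _ e2).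
have /(@nbhs_plane _ v w)[d2 d20 h2] : nbhs x (fun y => `|'D_w f x - 'D_w f y| <= e / 2).
  by move/cvgrPdist_le : (cw x) => /(_ _ e2).
near=> h.
have h0 : h != 0 by near: h; exact: nbhs_dnbhs_neq.
have hd : `|h| <= Num.min d1 d2.
  near: h; apply: dnbhs0_le; by rewrite lt_min d10.
have := hd; rewrite le_min => /andP[hd1 hd2].
have [xi xih Exi] := line_MVT x h dv.
have [et eth Eet] := line_MVT (h *: v + x) h dw.
have -> : (f \o shift x) (h *: (v + w)) - f x =
   h * 'D_w f (et *: w + (h *: v + x)) + h * 'D_v f (xi *: v + x).
  by rewrite -Exi -Eet /= scalerDr; rewrite addrA subrK addrA (addrC (h *: w)).
rewrite -mulrDr scalerA mulVf// scale1r.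
have A1 := h1 xi 0 (le_trans xih hd1); rewrite normr0 scale0r addr0 in A1.
have {}A1 := A1 (ltW d10).
have A2 := h2 h et hd2 (le_trans eth hd2).
rewrite -addrA addrCA in A2.
rewrite [X in _ + _ - X]addrC opprD addrACA (splitr e).
apply: le_trans (ler_normD _ _) _; apply: lerD; [exact: A1|exact: A2].
Unshelve. all: by end_near. Qed.

Lemma C1dirD f v w : C1dir f v -> C1dir f w -> C1dir f (v + w).
Proof.
move=> cv cw; have H := C1dirD_derive cv cw; split=> [x|]; first by case: (H x).
rewrite (_ : 'D_(v + w) f = 'D_v f + 'D_w f); last first.
  by apply/funext => x; have [_ ->] := H x.
by move=> x; apply: cvgD; [exact: cv.2|exact: cw.2].
Qed.

Lemma C1dir0_derive f x : is_derive x 0 f 0.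
Proof.
have E : (fun h : R => h^-1 *: ((f \o shift x) (h *: 0) - f x)) = fun=> 0.
  by apply/funext => h /=; rewrite scaler0 add0r subrr scaler0.
have H : (h^-1 *: ((f \o shift x) (h *: 0) - f x)) @[h --> (0:R)^'] --> (0:R).
  by rewrite E; exact: cvg_cst.
split; first by apply/cvg_ex; exists 0.
exact/cvg_lim.
Qed.

Lemma deriveZdir f v x (c : R) : derivable f x v ->
  is_derive x (c *: v) f (c * 'D_v f x).
Proof.
move=> df.
have L : is_derive (0:R) 1 (fun h : R => f (h *: v + x)) ('D_v f x).
  by have := @line_is_derive f v x 0; rewrite !scale0r !add0r; apply.
have L2 : is_derive (0:R) 1 ((fun h : R => f (h *: v + x)) \o ( *%R c)) ('D_v f x * c).
  apply: is_derive1_comp; first by rewrite mulr0; exact: L.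
  rewrite -[X in is_derive _ _ _ X]mulr1; exact: is_deriveZ.
have E : (fun h : R => h^-1 *: ((((fun h : R => f (h *: v + x)) \o ( *%R c)) \o shift 0) (h *: 1)
     - ((fun h : R => f (h *: v + x)) \o ( *%R c)) 0)) =
   (fun h : R => h^-1 *: ((f \o shift x) (h *: (c *: v)) - f x)).
  apply/funext => h /=; rewrite addr0 mulr0 scale0r add0r [h *: 1]mulr1 scalerA.
  by rewrite (mulrC c).
case: L2 => d2 e2; split; first by move: d2; rewrite /derivable E.
by rewrite mulrC -e2 /derive E.
Qed.

Lemma C1dirZ f v (c : R) : C1dir f v -> C1dir f (c *: v).
Proof.
move=> [dv cv]; have H x := deriveZdir c (dv x); split=> [x|]; first by case: (H x).
rewrite (_ : 'D_(c *: v) f = fun x => c * 'D_v f x); last first.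
  by apply/funext => x; have [_ ->] := H x.
by move=> x; apply: cvgM; [exact: cvg_cst|exact: cv].
Qed.

(** Differentiability along the coordinate axes is all that smoothness
    provides; continuity of these derivatives makes the derivative linear in
    the direction. *)
Lemma C1dir_sum (I : Type) (s : seq I) f (v : I -> V) (c : I -> R) :
  (forall i, C1dir f (v i)) ->
  C1dir f (\sum_(i <- s) c i *: v i) /\
  forall x, is_derive x (\sum_(i <- s) c i *: v i) f (\sum_(i <- s) c i * 'D_(v i) f x).
Proof.
move=> cv; elim: s => [|i s [IH1 IH2]].
  have H x : is_derive x (\sum_(i <- [::]) c i *: v i) f (\sum_(i <- [::]) c i * 'D_(v i) f x).
    by rewrite !big_nil; exact: C1dir0_derive.
  split=> //; split=> [x|]; first by case: (H x).
  rewrite big_nil (_ : 'D_0 f = fun=> 0); first by move=> x; exact: cvg_cst.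
  by apply/funext => x; have [_ ->] := C1dir0_derive f x.
have H x : is_derive x (\sum_(i <- i :: s) c i *: v i) f
    (\sum_(i <- i :: s) c i * 'D_(v i) f x).
  rewrite !big_cons; have := C1dirD_derive (C1dirZ (c i) (cv i)) IH1 x.
  have [_ ->] := IH2 x; have [_ ->] := deriveZdir (c i) ((cv i).1 x).
  exact.
split; last exact: H.
by rewrite big_cons; apply: C1dirD IH1; exact: C1dirZ.
Qed.

(** Schwarz's theorem.  The second difference of f along h v and h w is
    symmetric in v and w, and two applications of the mean value theorem show
    it to be h^2 times either mixed derivative at a point near x. *)
Lemma derive_swap f v w x :
  (forall y, derivable f y v) -> (forall y, derivable f y w) ->
  C1dir ('D_v f) w -> C1dir ('D_w f) v ->
  'D_w ('D_v f) x = 'D_v ('D_w f) x.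
Proof.
move=> dv dw [dvw cvw] [dwv cwv].
apply/eqP; rewrite -subr_eq0 -normr_le0; apply/ler_addgt0Pl => e e0; rewrite addr0.
have e2 : 0 < e / 2 by rewrite divr_gt0.
have /(@nbhs_plane _ v w)[d1 d10 h1] :
    nbhs x (fun y => `|'D_w ('D_v f) x - 'D_w ('D_v f) y| <= e / 2).
  by move/cvgrPdist_le : (cvw x) => /(_ _ e2).
have /(@nbhs_plane _ w v)[d2 d20 h2] :
    nbhs x (fun y => `|'D_v ('D_w f) x - 'D_v ('D_w f) y| <= e / 2).
  by move/cvgrPdist_le : (cwv x) => /(_ _ e2).
pose h := Num.min d1 d2.
have h0 : 0 < h by rewrite lt_min d10.
have hd1 : `|h| <= d1 by rewrite gtr0_norm// /h ge_min lexx.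
have hd2 : `|h| <= d2 by rewrite gtr0_norm// /h ge_min lexx orbT.
(* The second difference of f at x along a and b. *)
pose D2 a b := f (a + b + x) - f (a + x) - (f (b + x) - f x).
have D2C a b : D2 a b = D2 b a.
  have swap (p q r' t : R) : p - q - (r' - t) = p - r' - (q - t).
    by ring.
  by rewrite /D2 swap (addrC a b).
have key a b : (forall y, derivable f y a) -> (forall y, derivable ('D_a f) y b) ->
  exists xi et : R, [/\ `|xi| <= `|h|, `|et| <= `|h| &
    D2 (h *: a) (h *: b) =
    h * (h * 'D_b ('D_a f) (xi *: a + et *: b + x))].
  move=> da dab.
  pose g y := f (h *: b + y) - f y.
  have dg y : is_derive y a g ('D_a f (h *: b + y) - 'D_a f y).
    have E : is_derive y a (f \o shift (h *: b)) ('D_a f (h *: b + y)).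
      have E' : (fun k : R => k^-1 *: (((f \o shift (h *: b)) \o shift y) (k *: a) - (f \o shift (h *: b)) y))
       = (fun k : R => k^-1 *: ((f \o shift (h *: b + y)) (k *: a) - f (h *: b + y))).
        apply/funext => k /=; congr (_ *: (f _ - f _)); last by rewrite addrC.
        by rewrite -addrA (addrC y).
      have D := da (h *: b + y).
      split; first by rewrite /derivable E'.
      by rewrite /derive E'.
    rewrite (_ : g = (f \o shift (h *: b)) - f); last first.
      by apply/funext => z; rewrite /g fctE /= (addrC z).
    apply: is_deriveB; split; [exact: da|by []].
  have [xi xih] := @line_MVT g a x h (fun y => @ex_derive _ _ _ _ _ _ _ (dg y)).
  have [_ ->] := dg (xi *: a + x).
  have [et eth ->] := line_MVT (xi *: a + x) h dab.
  move=> Eg; exists xi, et; split; [exact: xih|exact: eth|].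
  have -> : xi *: a + et *: b + x = et *: b + (xi *: a + x).
    by rewrite addrA (addrC (xi *: a)).
  rewrite /D2; have -> : h *: a + h *: b + x = h *: b + (h *: a + x).
    by rewrite addrA (addrC (h *: a)).
  exact: Eg.
have [xi [et [xih eth E1]]] := key v w dv dvw.
have [xi' [et' [xih' eth' E2]]] := key w v dw dwv.
have E : 'D_w ('D_v f) (xi *: v + et *: w + x) = 'D_v ('D_w f) (xi' *: w + et' *: v + x).
  apply: (mulfI (lt0r_neq0 h0)); apply: (mulfI (lt0r_neq0 h0)).
  exact: etrans (esym E1) (etrans (D2C _ _) E2).
have A1 := h1 xi et (le_trans xih hd1) (le_trans eth hd1).
have A2 := h2 xi' et' (le_trans xih' hd2) (le_trans eth' hd2).
rewrite E in A1; rewrite (splitr e).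
apply: le_trans (ler_distD ('D_v ('D_w f) (xi' *: w + et' *: v + x)) _ _) _.
by apply: lerD; [exact: A1|rewrite distrC; exact: A2].
Qed.

End directional.

(** * Smooth functions *)

Section smooth_theory.
Context {R : realType} {n : nat}.
Local Notation V := 'rV[R]_n.
Implicit Types (f g phi psi : V -> R) (i j : 'I_n) (s : seq 'I_n).

Definition ev i : V := delta_mx ord0 i.

Lemma rV_sum_ev (v : V) : v = \sum_i v ord0 i *: ev i.
Proof. exact: row_sum_delta. Qed.

Lemma C_kS k f : C_k k.+1 f -> C_k k f.
Proof.
elim: k f => [|k IH] f; first by case.
by move=> [cf df pf]; split=> // i; apply: IH; exact: pf.
Qed.

Lemma C_k_cst k (c : R) : C_k k (fun _ : V => c).
Proof.
elim: k c => [|k IH] c /=; first exact: cst_continuous.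
split; first exact: cst_continuous.
  by move=> i x; have [] := is_derive_cst c x (ev i).
move=> i; rewrite (_ : partial i _ = fun=> 0); first exact: IH.
by apply/funext => x; have [_] := is_derive_cst c x (ev i).
Qed.

Lemma C_kD k f g : C_k k f -> C_k k g -> C_k k (f + g).
Proof.
elim: k f g => [|k IH] f g /=; first by move=> cf cg x; exact: (cvgD (cf x) (cg x)).
move=> [cf df pf] [cg dg pg]; split.
- by move=> x; exact: (cvgD (cf x) (cg x)).
- by move=> i x; apply: derivableD; [exact: df|exact: dg].
- move=> i; rewrite (_ : partial i (f + g) = partial i f + partial i g); first exact: IH.
  by apply/funext => x; rewrite /partial deriveD; [|exact: df|exact: dg].
Qed.

Lemma C_kM k f g : C_k k f -> C_k k g -> C_k k (f * g).
Proof.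
elim: k f g => [|k IH] f g.
  by move=> cf cg x; exact: (cvgM (cf x) (cg x)).
move=> Cf Cg; have [cf df pf] := Cf; have [cg dg pg] := Cg; split.
- by move=> x; exact: (cvgM (cf x) (cg x)).
- by move=> i x; apply: derivableM; [exact: df|exact: dg].
- move=> i; rewrite (_ : partial i (f * g) = f * partial i g + g * partial i f).
    by apply: C_kD; apply: IH; [exact: C_kS|exact: pg|exact: C_kS|exact: pf].
  by apply/funext => x; rewrite /partial deriveM; [|exact: df|exact: dg].
Qed.

Lemma C_kZ k (c : R) f : C_k k f -> C_k k (c *: f).
Proof. by move=> Cf; exact: (C_kM (C_k_cst k c) Cf). Qed.

Lemma is_derive_affine_comp f (c : R) (t : V) i (x : V) :
  derivable f (affine c t x) (ev i) ->
  is_derive x (ev i) (f \o affine c t) (c * 'D_(ev i) f (affine c t x)).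
Proof.
move=> df; have [d1 e1] := deriveZdir c df.
have E : (fun h : R => h^-1 *: (((f \o affine c t) \o shift x) (h *: ev i) - (f \o affine c t) x))
  = (fun h : R => h^-1 *: ((f \o shift (affine c t x)) (h *: (c *: ev i)) - f (affine c t x))).
  apply/funext => h /=; congr (_ *: (f _ - _)).
  by rewrite /affine scalerDr addrA !scalerA (mulrC c).
by split; [rewrite /derivable E|rewrite /derive E].
Qed.

Lemma continuous_affine c (t : V) : continuous (affine c t : V -> V).
Proof.
move=> x; have h : (c *: y) @[y --> x] --> c *: x := @scaler_continuous R V c x.
exact: (cvgD h (cvg_cst t)).
Qed.

Lemma C_k_affine k f c t : C_k k f -> C_k k (f \o affine c t).
Proof.
elim: k f => [|k IH] f.
  move=> cf x; apply: (@continuous_comp _ _ _ (affine c t)); first exact: continuous_affine.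
  exact: cf.
move=> [cf df pf]; split.
- move=> x; apply: (@continuous_comp _ _ _ (affine c t)); first exact: continuous_affine.
  exact: cf.
- by move=> i x; have [] := is_derive_affine_comp (df i (affine c t x)).
- move=> i; rewrite (_ : partial i _ = c *: (partial i f \o affine c t)).
    by apply: C_kZ; apply: IH; exact: pf.
  by apply/funext => x; have [_ h] := is_derive_affine_comp (df i (affine c t x)); exact: h.
Qed.

Lemma is_derive_coord i j (x : V) :
  is_derive x (ev j) (fun v : V => v ord0 i) (i == j)%:R.
Proof.
have E : (fun h : R => h^-1 *: (((fun v : V => v ord0 i) \o shift x) (h *: ev j) - x ord0 i))
  = (fun h : R => h^-1 * h * (i == j)%:R).
  apply/funext => h /=; rewrite !mxE addrK eqxx/=.
  by rewrite -[LHS]/(h^-1 * _) mulrA.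
have L : h^-1 * h * (i == j)%:R @[h --> (0:R)^'] --> ((i == j)%:R : R).
  apply: cvg_near_cst; near=> h; rewrite mulVf ?mul1r//.
  by near: h; exact: nbhs_dnbhs_neq.
split; first by apply/cvg_ex; exists (i == j)%:R; rewrite E.
by rewrite /derive E; exact/cvg_lim.
Unshelve. all: by end_near. Qed.

Lemma partial_coord i j : partial j (fun v : V => v ord0 i) = fun=> (i == j)%:R.
Proof. by apply/funext => x; have [_ h] := is_derive_coord i j x; exact: h. Qed.

Lemma C_k_coord k i : C_k k (fun v : V => v ord0 i).
Proof.
case: k => [|k] /=; first exact: coord_continuous.
split; first exact: coord_continuous.
  by move=> j x; have [] := is_derive_coord i j x.
by move=> j; rewrite partial_coord; exact: C_k_cst.
Qed.

Lemma smooth_continuous f : smooth f -> continuous f.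
Proof. by move=> /(_ 0%N). Qed.

Lemma smooth_derivable f i x : smooth f -> derivable f x (ev i).
Proof. by move=> /(_ 1%N)[_ + _]; apply. Qed.

Lemma smooth_partial f i : smooth f -> smooth (partial i f).
Proof. by move=> sf k; have [_ _] := sf k.+1; apply. Qed.

Lemma smooth_partials f s : smooth f -> smooth (partials s f).
Proof. by move=> sf; elim: s => [//|i s IH]; exact: smooth_partial. Qed.

Lemma smooth_C1dir f i : smooth f -> C1dir f (ev i).
Proof.
move=> sf; split; first by move=> x; exact: smooth_derivable.
by apply: smooth_continuous; exact: (@smooth_partial f i).
Qed.

Lemma partialC f i j : smooth f -> partial i (partial j f) = partial j (partial i f).
Proof.
move=> sf; apply/funext => x; apply: derive_swap.
- by move=> y; exact: smooth_derivable.
- by move=> y; exact: smooth_derivable.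
- by apply: smooth_C1dir; exact: (@smooth_partial f j).
- by apply: smooth_C1dir; exact: (@smooth_partial f i).
Qed.

(** The chain rule along an arbitrary vector, used to differentiate a dilated
    function in the ratio of the dilation. *)
Lemma smooth_radial f (v x : V) : smooth f ->
  is_derive x v f (\sum_i v ord0 i * partial i f x).
Proof.
move=> sf; have [_ H] := @C1dir_sum R V _ (index_enum 'I_n) f ev (fun i => v ord0 i)
  (fun i => smooth_C1dir i sf).
by have := H x; rewrite -rV_sum_ev.
Qed.

Lemma partialD f g i : smooth f -> smooth g -> partial i (f + g) = partial i f + partial i g.
Proof.
by move=> sf sg; apply/funext => x; rewrite /partial deriveD; [|exact: smooth_derivable|exact: smooth_derivable].
Qed.

Lemma partialZ c f i : smooth f -> partial i (c *: f) = c *: partial i f.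
Proof.
by move=> sf; apply/funext => x; rewrite /partial [LHS]deriveZ; [|exact: smooth_derivable].
Qed.

Lemma partialM f g i : smooth f -> smooth g ->
  partial i (f * g) = f * partial i g + g * partial i f.
Proof.
by move=> sf sg; apply/funext => x; rewrite /partial deriveM; [|exact: smooth_derivable|exact: smooth_derivable].
Qed.

Lemma smoothD f g : smooth f -> smooth g -> smooth (f + g).
Proof. by move=> sf sg k; exact: C_kD. Qed.

Lemma smoothZ c f : smooth f -> smooth (c *: f).
Proof. by move=> sf k; exact: C_kZ. Qed.

Lemma smoothM f g : smooth f -> smooth g -> smooth (f * g).
Proof. by move=> sf sg k; exact: C_kM. Qed.

Lemma partialsD f g s : smooth f -> smooth g -> partials s (f + g) = partials s f + partials s g.
Proof.
move=> sf sg; elim: s => [//|i s IH]; rewrite /= -!/(partials _ _) IH.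
by rewrite partialD//; exact: smooth_partials.
Qed.

Lemma partialsZ c f s : smooth f -> partials s (c *: f) = c *: partials s f.
Proof.
move=> sf; elim: s => [//|i s IH]; rewrite /= -!/(partials _ _) IH.
by rewrite partialZ//; exact: smooth_partials.
Qed.

Lemma smooth_affine f c t : smooth f -> smooth (f \o affine c t).
Proof. by move=> sf k; exact: C_k_affine. Qed.

Lemma partials_affine c t f s : smooth f ->
  partials s (f \o affine c t) = c ^+ size s *: (partials s f \o affine c t).
Proof.
move=> sf; elim: s => [|i s IH]; first by rewrite expr0 scale1r.
rewrite /= -!/(partials _ _) IH partialZ; last first.
  by apply: smooth_affine; exact: smooth_partials.
apply/funext => x; rewrite !fctE /= /partial.
have df := @smooth_derivable (partials s f) i (affine c t x) (@smooth_partials f s sf).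
have [_ h] := is_derive_affine_comp df.
have -> : 'D_(delta_mx ord0 i) (partials s f \o affine c t) x = c * partial i (partials s f) (affine c t x).
  exact: h.
by rewrite exprSr -[RHS]mulrA.
Qed.

Lemma partialsB f g s : smooth f -> smooth g -> partials s (f - g) = partials s f - partials s g.
Proof.
move=> sf sg; rewrite -(scaleN1r g) -(scaleN1r (partials s g)).
rewrite partialsD; [|exact: sf|exact: smoothZ].
by rewrite partialsZ; [|exact: sg].
Qed.

End smooth_theory.

(** * Test functions *)

Section test_functions.
Context {R : realType} {n : nat}.
Local Notation V := 'rV[R]_n.
Local Notation mu := (@lebesgue_rV R n).
Implicit Types (f g phi psi : V -> R) (i j : 'I_n) (s : seq 'I_n) (Om K : set V).

(** Vanishing off a compact subset of the domain is easier to establish than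
    an inclusion of the closed support. *)
Lemma test_function_intro Om K psi : smooth psi -> compact K -> K `<=` Om ->
  (forall x, ~ K x -> psi x = 0) -> test_function Om psi.
Proof.
move=> sp cK KO pK.
have clK : closed K by apply: compact_closed cK; exact: norm_hausdorff.
have sK : support psi `<=` K.
  rewrite [X in _ `<=` X](closure_id K).1//; apply: closure_subset => x /= /eqP px.
  by apply: contrapT => /pK.
split; [exact: sp| |exact: subset_trans sK KO].
by apply: subclosed_compact cK sK; exact: closed_closure.
Qed.

Lemma test_function_out Om phi x : test_function Om phi -> ~ support phi x -> phi x = 0.
Proof.
by move=> _ nx; apply: contrapT => /eqP px; apply: nx; exact: subset_closure.
Qed.

Lemma test_function_notin Om phi x : test_function Om phi -> ~ Om x -> phi x = 0.
Proof. by move=> tp nx; apply: (test_function_out tp); case: tp => _ _ h /h. Qed.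

Lemma test_functionD Om f g : test_function Om f -> test_function Om g -> test_function Om (f + g).
Proof.
move=> tf tg; have [sf cf fO] := tf; have [sg cg gO] := tg.
apply: (@test_function_intro _ (support f `|` support g)).
- exact: smoothD.
- exact: compactU.
- by move=> x [/fO|/gO].
- move=> x /not_orP[nf ng].
  have -> : (f + g) x = f x + g x by [].
  by rewrite (test_function_out tf nf) (test_function_out tg ng) addr0.
Qed.

Lemma test_functionM Om f g : smooth f -> test_function Om g -> test_function Om (f * g).
Proof.
move=> sf tg; have [sg cg gO] := tg.
apply: (@test_function_intro _ (support g)) => //; first exact: smoothM.
move=> x ng; have -> : (f * g) x = f x * g x by [].
by rewrite (test_function_out tg ng) mulr0.
Qed.

Lemma test_functionZ Om c f : test_function Om f -> test_function Om (c *: f).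
Proof. by move=> tf; apply: (@test_functionM _ (fun=> c)) => // k; exact: C_k_cst. Qed.

Lemma test_functionB Om f g : test_function Om f -> test_function Om g -> test_function Om (f - g).
Proof.
by move=> tf tg; rewrite -(scaleN1r g); apply: test_functionD => //; exact: test_functionZ.
Qed.

Lemma test_function0 Om : test_function Om 0.
Proof.
apply: (@test_function_intro _ set0) => //; last exact: compact0.
by move=> k; exact: C_k_cst.
Qed.

Lemma test_function_partial Om f i : test_function Om f -> test_function Om (partial i f).
Proof.
move=> tf; have [sf cf fO] := tf.
apply: (@test_function_intro _ (support f)) => //; first exact: smooth_partial.
move=> x nx.
have /(@nbhs_plane R V _ (ev i) 0)[d d0 hd] : nbhs x (~` support f).
  by apply: open_nbhs_nbhs; split => //; apply: closed_openC; exact: closed_closure.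
rewrite /partial /derive; apply/cvg_lim => //.
apply: (cvg_trans _ (@cvg_cst R (0 : R) R ((0 : R)^') _)).
apply: near_eq_cvg; near=> h.
rewrite (test_function_out tf nx) subr0.
have hh : `|h| <= d by near: h; exact: dnbhs0_le.
have := hd h 0 hh; rewrite normr0 scaler0 addr0 => /(_ (ltW d0)) /(test_function_out tf) E.
by rewrite (_ : (f \o shift x) _ = 0) ?scaler0//; exact: E.
Unshelve. all: by end_near. Qed.

Lemma test_function_partials Om f s : test_function Om f -> test_function Om (partials s f).
Proof. by move=> tf; elim: s => [//|i s IH]; exact: test_function_partial. Qed.

Lemma test_function_sum Om (I : Type) (r : seq I) (F : I -> V -> R) :
  (forall a, test_function Om (F a)) -> test_function Om (\sum_(a <- r) F a).
Proof.
move=> tF; elim: r => [|a r IH]; first by rewrite big_nil; exact: test_function0.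
by rewrite big_cons; exact: test_functionD.
Qed.

Lemma laplacianE f : laplacian f = \sum_i partials [:: i; i] f.
Proof. by apply/funext => x; rewrite /laplacian fct_sumE. Qed.

Lemma test_function_laplacian Om f : test_function Om f -> test_function Om (laplacian f).
Proof.
by move=> tf; rewrite laplacianE; apply: test_function_sum => i; exact: test_function_partials.
Qed.

Lemma test_function_affine Om Om' f c t : 0 < c -> test_function Om f ->
  (forall x, Om (affine c t x) -> Om' x) -> test_function Om' (f \o affine c t).
Proof.
move=> c0 tf OO; have [sf cf fO] := tf.
pose A' := affine c^-1 (- (c^-1 *: t)) : V -> V.
have AK x : A' (affine c t x) = x.
  by rewrite /A' /affine scalerDr scalerA mulVf ?gt_eqF// scale1r addrK.
have KA x : affine c t (A' x) = x.
  rewrite /A' /affine scalerDr scalerN !scalerA mulfV ?gt_eqF// !scale1r.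
  by rewrite subrK.
apply: (@test_function_intro _ [set A' x | x in support f]).
- exact: smooth_affine.
- apply: continuous_compact => //; apply: continuous_subspaceT.
  exact: continuous_affine.
- by move=> _ [x sx <-]; apply: OO; rewrite KA; exact: fO.
- move=> x nx; apply: (test_function_out tf) => sx; apply: nx.
  by exists (affine c t x).
Qed.

Lemma coord_le_norm (v : V) i : `|v ord0 i| <= `|v|.
Proof.
have /mapP[j Hj ->] : `|v ord0 i| \in [seq `|v x.1 x.2| | x : 'I_1 * 'I_n].
  by apply/mapP; exists (ord0, i) => //=; rewrite mem_enum.
by rewrite [leRHS]/Num.norm /= mx_normrE; apply/bigmax_geP; right => /=; exists j.
Qed.

Lemma compact_sub_cube K : compact K -> exists2 m : R, 0 < m & K `<=` cube m.
Proof.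
move=> /compact_bounded[M [Mr hM]].
exists (`|M| + 2); first by rewrite ltr_wpDl.
move=> x Kx i; rewrite -ltr_norml; apply: le_lt_trans (coord_le_norm x i) _.
apply: (@le_lt_trans _ _ (`|M| + 1)); last by rewrite ltrD2l ltr1n.
by apply: hM Kx; rewrite ltr_pwDr// ler_norm.
Qed.

Lemma test_function_cube Om f : test_function Om f ->
  exists2 m : R, 0 < m & forall x, ~ cube m x -> f x = 0.
Proof.
move=> tf; have [_ /compact_sub_cube[m m0 sm] _] := tf; exists m => // x nx.
by apply: (test_function_out tf) => /sm.
Qed.

Lemma test_function_bounded Om f : test_function Om f ->
  exists2 C : R, 0 <= C & forall x, `|f x| <= C.
Proof.
move=> tf; have [sf cf _] := tf.
have : compact (f @` support f).
  by apply: continuous_compact => //; apply: continuous_subspaceT; exact: smooth_continuous.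
move=> /compact_bounded[M [Mr hM]]; exists (`|M| + 1); first by rewrite addr_ge0.
move=> x; have [sx|nx] := pselect (support f x); last first.
  by rewrite (test_function_out tf nx) normr0 addr_ge0.
by apply: (hM (`|M| + 1)); [rewrite ltr_pwDr// ler_norm|exists x].
Qed.

Lemma test_function_measurable Om f : test_function Om f -> measurable_fun setT f.
Proof. by move=> [sf _ _]; apply: continuous_rV_measurable; exact: smooth_continuous. Qed.

Lemma test_function_L2 Om f : test_function Om f -> L2 mu f.
Proof.
move=> tf; have [C C0 fC] := test_function_bounded tf.
have [m m0 fm] := test_function_cube tf.
apply: (@bounded_cube_L2 R n m C) => //; first exact: test_function_measurable tf.
exact: aeW.
Qed.

Lemma integrable_cube_cst m (C : R) : mu.-integrable setT (EFin \o (cst C \_ (cube m : set V))).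
Proof.
have mc : measurable (cube m : set V) by exact: measurable_obox.
rewrite (_ : EFin \o _ = (EFin \o cst C) \_ (cube m)); last by rewrite restrict_EFin.
apply/(integrable_mkcond _ mc).
apply/integrableP; split; first by apply/measurable_EFinP; exact: measurable_cst.
rewrite (_ : (fun x => _) = cst `|C%:E|%E)// integral_cst// lte_mul_pinfty//.
exact: lebesgue_obox_lty.
Qed.

Lemma L2_cube_cst m (C : R) : L2 mu (cst C \_ (cube m : set V)).
Proof.
have mc : measurable (cube m : set V) by exact: measurable_obox.
apply: (@bounded_cube_L2 R n m `|C|).
- by apply/(measurable_restrictT _ mc); exact: measurable_cst.
- by apply: aeW => x; rewrite patchE; case: ifP => // _; rewrite normr0.
- by move=> x nx; rewrite patchE memNset.
Qed.

End test_functions.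

(** * Integration by parts and the Poincare inequality *)

Section parametric.
Context d {Y : measurableType d} {R : realType} (mu : {measure set Y -> \bar R}).

(** Differentiation under the integral sign, in the form of a derivative
    judgement, as the mean value theorem requires it. *)
Lemma parametric_is_derive (f df : R -> Y -> R) (a u v : R) (G : Y -> R) :
  u < a < v -> (forall x, u < x < v -> mu.-integrable setT (EFin \o f x)) ->
  (forall (x : R) y, is_derive x (1 : R) (f ^~ y : R -> R) (df x y)) ->
  (forall y, 0 <= G y) -> mu.-integrable setT (EFin \o G) ->
  (forall x y, u < x < v -> `|df x y| <= G y) ->
  is_derive a (1 : R) (fun x : R => \int[mu]_y f x y) (\int[mu]_y df a y).
Proof.
move=> auv fi fd G0 Gi Gd.
have Ia : `]u, v[%classic a by rewrite /= in_itv.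
have derf x y : `]u, v[%classic x -> [set: Y] y -> derivable (f ^~ y) x 1.
  by move=> _ _; have [] := fd x y.
have fi' x : `]u, v[%classic x -> mu.-integrable setT (EFin \o f x).
  by rewrite /= in_itv/=; exact: fi.
have dE x y : lebesgue_integral_under.partial1of2 f x y = df x y.
  by rewrite lebesgue_integral_under.partial1of2E; have [_ ->] := fd x y.
have bd x y : `]u, v[%classic x -> [set: Y] y ->
    `|lebesgue_integral_under.partial1of2 f x y| <= G y.
  by rewrite /= in_itv/= => xuv _; rewrite dE; exact: Gd.
split.
  exact: (derivable_under_integral measurableT Ia fi' derf G0 Gi bd).
rewrite -derive1E.
rewrite (differentiation_under_integral measurableT Ia fi' derf G0 Gi bd).
by apply: eq_Rintegral => y _; exact: dE.
Qed.

End parametric.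

Section integration_by_parts.
Context {R : realType} {n : nat}.
Local Notation V := 'rV[R]_n.
Local Notation mu := (@lebesgue_rV R n).
Local Notation ip := (ip mu).
Local Notation L2 := (L2 mu).
Implicit Types (f g phi psi : V -> R) (i j : 'I_n) (s : seq 'I_n) (Om K : set V).

Lemma test_function_integrable Om f : test_function Om f -> mu.-integrable setT (EFin \o f).
Proof.
move=> tf; have [C C0 fC] := test_function_bounded tf.
have [m m0 fm] := test_function_cube tf.
apply: (le_integrable measurableT _ _ (integrable_cube_cst m C)).
  by apply/measurable_EFinP; exact: test_function_measurable tf.
move=> x _ /=; rewrite lee_fin patchE; case: ifPn => [_|/negP].
  by rewrite (ger0_norm C0).
by rewrite inE => /fm ->; rewrite normr0.
Qed.

(** The integral of a translate of f does not depend on the translation, and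
    its derivative in the length of a translation along the i-th axis is the
    integral of the partial derivative. *)
Lemma integral_partial Om f i : test_function Om f -> \int[mu]_x partial i f x = 0.
Proof.
move=> tf; have [sf cf _] := tf.
have tp := test_function_partial i tf.
have [C C0 fC] := test_function_bounded tp.
have [m m0 fm] := test_function_cube tp.
(* The integral of F h is constant in h. *)
pose F (h : R) (x : V) := f (h *: ev i + x).
pose dF (h : R) (x : V) := partial i f (h *: ev i + x).
have := @parametric_is_derive _ V R mu F dF 0 (-1) 1 (cst C \_ (cube (m + 1) : set V)).
rewrite ltrN10 ltr01 => /(_ isT) H.
have /H{H}H x : -1 < x < 1 -> mu.-integrable setT (EFin \o F x).
  move=> _.
  have := (integral_affine (x *: ev i) ltr01 (test_function_integrable tf)).1.
  congr (_.-integrable _ _); apply/funext => y.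
  by rewrite /F /= /affine scale1r addrC.
have /H{H}H (x : R) y : is_derive x (1 : R) (F ^~ y) (dF x y).
  by apply: line_is_derive; exact: smooth_derivable.
have /H{H}H y : 0 <= (cst C \_ (cube (m + 1) : set V)) y by rewrite patchE; case: ifP.
have {}H := H (integrable_cube_cst (m + 1) C).
have K x y : -1 < x < 1 -> `|dF x y| <= (cst C \_ (cube (m + 1) : set V)) y.
  move=> x1; rewrite patchE; case: ifPn => [_|/negP]; first exact: fC.
  rewrite inE => ny; rewrite /dF fm ?normr0// => cy; apply: ny => j.
  have := cy j; rewrite !mxE eqxx/=.
  have : -1 <= x * (j == i)%:R <= 1.
    by case: (j == i); rewrite ?mulr1 ?mulr0; lra.
  move=> /andP[? ?] /andP[? ?]; apply/andP; split; lra.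
have {K}H := H K.
have Fcst : (fun h => \int[mu]_y F h y) = fun=> \int[mu]_y f y.
  apply/funext => h; rewrite -(integral_shift (h *: ev i) (test_function_integrable tf)).
  by apply: eq_Rintegral => y _; rewrite /F addrC.
rewrite Fcst in H; have [_ H0] := H.
transitivity (\int[mu]_y dF 0 y); first by apply: eq_Rintegral => y _; rewrite /dF scale0r add0r.
by rewrite -H0; have [_ ->] := is_derive_cst (\int[mu]_y f y) (0 : R) 1.
Qed.

Lemma ip_partial Om Om' f g i : test_function Om f -> test_function Om' g ->
  ip (partial i f) g = - ip f (partial i g).
Proof.
move=> tf tg; have [sf _ _] := tf; have [sg _ _] := tg.
have Lf := test_function_L2 tf; have Lg := test_function_L2 tg.
have Lpf := test_function_L2 (test_function_partial i tf).
have Lpg := test_function_L2 (test_function_partial i tg).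
have := integral_partial i (test_functionM sf tg).
rewrite partialM; [|exact: sf|exact: sg].
rewrite RintegralD//; [|exact: integrable_ip|exact: integrable_ip].
move/eqP; rewrite addrC addr_eq0 => /eqP h.
by rewrite ipC; exact: h.
Qed.

Lemma partials_rcons f s i : smooth f -> partial i (partials s f) = partials s (partial i f).
Proof.
move=> sf; elim: s => [//|j s IH].
rewrite /= -!/(partials _ _) -IH partialC//; exact: smooth_partials.
Qed.

Lemma ip_partials Om Om' f g s : test_function Om f -> test_function Om' g ->
  ip f (partials s g) = (-1) ^+ size s * ip (partials s f) g.
Proof.
move=> tf tg; elim: s f tf => [|i s IH] f tf; first by rewrite expr0 mul1r.
have tpf := test_function_partial i tf.
have := ip_partial i tf (test_function_partials s tg).
move/(congr1 (fun x => - x)); rewrite opprK => /= <-.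
have [sf _ _] := tf.
by rewrite IH// exprS mulN1r mulNr -partials_rcons.
Qed.

Definition grad_sq f := \sum_i ip (partial i f) (partial i f).
Definition lap_sq f := ip (laplacian f) (laplacian f).

Lemma grad_sq_ge0 f : 0 <= grad_sq f.
Proof. by apply: sumr_ge0 => i _; exact: ip_ge0. Qed.

Lemma lap_sq_ge0 f : 0 <= lap_sq f.
Proof. exact: ip_ge0. Qed.

Lemma term_le_sum (h : 'I_n -> R) i : (forall i, 0 <= h i) -> h i <= \sum_i h i.
Proof. by move=> h0; rewrite (bigD1 i)//= lerDl sumr_ge0. Qed.

Lemma term_le_sum2 (h : 'I_n -> 'I_n -> R) i j : (forall i j, 0 <= h i j) ->
  h i j <= \sum_i \sum_j h i j.
Proof.
move=> h0; apply: le_trans (term_le_sum j (h0 i)) _.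
by apply: (@term_le_sum (fun i => \sum_j h i j)) => k; exact: sumr_ge0.
Qed.

Lemma ip_partial_swap Om a b c i j : test_function Om a -> test_function Om b ->
  test_function Om c -> partial i b = partial j c ->
  ip (partial i a) b = ip c (partial j a).
Proof.
move=> ta tb tc bc.
by rewrite (ip_partial i ta tb) bc [RHS]ipC (ip_partial j ta tc).
Qed.

(** Two integrations by parts exchange one i with one j, turning f_ij f_ij
    into f_ii f_jj under the integral. *)
Lemma hessian_lap Om f : test_function Om f ->
  \sum_i \sum_j ip (partials [:: i; j] f) (partials [:: i; j] f) = lap_sq f.
Proof.
move=> tf; have [sf _ _] := tf.
have L s : L2 (partials s f) by exact: test_function_L2 (test_function_partials s tf).
have LL : L2 (\sum_i partials [:: i; i] f) by exact: L2_sum.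
rewrite /lap_sq laplacianE ip_suml; [|by move=> k; exact: L|exact: LL].
apply: eq_bigr => i _.
rewrite [RHS]ip_sumr; [|by move=> k; exact: L|exact: L].
apply: eq_bigr => j _.
have tj := test_function_partials [:: j] tf.
have tij := test_function_partials [:: i; j] tf.
have tii := test_function_partials [:: i; i] tf.
apply: (ip_partial_swap tj tij tii).
change (partial i (partial i (partial j f)) = partial j (partial i (partial i f))).
rewrite (partialC i j sf); apply: partialC; exact: (@smooth_partial _ _ f i sf).
Qed.

Lemma hessian_le_lap Om f i j : test_function Om f ->
  ip (partials [:: i; j] f) (partials [:: i; j] f) <= lap_sq f.
Proof.
move=> tf; rewrite -(hessian_lap tf).
by apply: (@term_le_sum2 (fun i j => ip (partials [:: i; j] f) (partials [:: i; j] f))) => k l; exact: ip_ge0.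
Qed.

Lemma grad_le_grad_sq f i : ip (partial i f) (partial i f) <= grad_sq f.
Proof.
by apply: (@term_le_sum (fun i => ip (partial i f) (partial i f))) => k; exact: ip_ge0.
Qed.

(** By parts against the coordinate x_i, the integral of f^2 is minus twice
    that of x_i f times the i-th derivative; |x_i| < m where f does not
    vanish, and Young's inequality absorbs f. *)
Lemma poincare Om f i m : test_function Om f -> 0 < m -> Om `<=` cube m ->
  ip f f <= 4 * m ^+ 2 * ip (partial i f) (partial i f).
Proof.
move=> tf m0 Om_m; have [sf _ _] := tf.
pose xi := fun v : V => v ord0 i.
have sx : smooth xi by move=> k; exact: C_k_coord.
have tp := test_function_partial i tf.
have txf := test_functionM sx tf.
have txp := test_functionM sx tp.
have Lf := test_function_L2 tf; have Lp := test_function_L2 tp.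
have Lxf := test_function_L2 txf; have Lxp := test_function_L2 txp.
have := ip_partial i txf tf.
have -> : partial i (xi * f) = xi * partial i f + f.
  rewrite partialM; [|exact: sx|exact: sf]; congr (_ + _).
  by rewrite partial_coord eqxx; apply/funext => x; rewrite [LHS]mulr1.
rewrite ipDl//.
have -> : ip (xi * partial i f) f = ip (xi * f) (partial i f).
  by apply: eq_Rintegral => x _; rewrite !fctE; ring.
have xf : ip (xi * f) (xi * f) <= m ^+ 2 * ip f f.
  rewrite expr2 -mulrA -ipZl// -ipZr//; last exact: L2Z.
  apply: le_ip => //; first exact: L2Z.
  move=> x; rewrite [leLHS]normrM [leRHS]normrM (ger0_norm (ltW m0)).
  have [cx|ncx] := pselect (cube m x).
    by rewrite ler_wpM2r// ltW// ltr_norml; exact: cx.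
  rewrite (test_function_notin tf) ?normr0 ?mulr0// => Ox; exact/ncx/Om_m.
move: xf; set a := ip f f; set b := ip (xi * f) _; set c := ip (xi * f) _ => xf h.
have := ip_young (e := (2 * m ^+ 2)^-1) Lxf (L2N Lp).
rewrite ipNr// ipNl//; last exact: L2N.
rewrite ipNr// opprK invrK -/c -/b => /(_ ltac:(rewrite invr_gt0 mulr_gt0// exprn_gt0//)).
have : (2 * m ^+ 2)^-1 * b <= a / 2.
  rewrite ler_pdivrMl ?mulr_gt0 ?exprn_gt0//; apply: le_trans xf _.
  by rewrite le_eqVlt; apply/orP; left; apply/eqP; field.
lra.
Qed.

End integration_by_parts.

(** * The energy under dilations *)

Section dilation.
Context {R : realType} {n : nat}.
Local Notation V := 'rV[R]_n.
Local Notation mu := (@lebesgue_rV R n).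
Local Notation ip := (ip mu).
Local Notation L2 := (L2 mu).
Implicit Types (f g phi psi F : V -> R) (i j : 'I_n) (Om K : set V).

Lemma laplacian_affine f c t : smooth f ->
  laplacian (f \o affine c t) = c ^+ 2 *: (laplacian f \o affine c t).
Proof.
move=> sf; apply/funext => x; rewrite /laplacian.
transitivity (\sum_i c ^+ 2 * partials [:: i; i] f (affine c t x)).
  by apply: eq_bigr => i _; rewrite partials_affine.
by rewrite -mulr_sumr.
Qed.

Lemma ip_scale_affine (u : V -> R) k c t : 0 < c -> L2 u ->
  ip (k *: (u \o affine c t)) (k *: (u \o affine c t)) = k ^+ 2 * c^-1 ^+ n * ip u u.
Proof.
move=> c0 Lu; have La := L2_affine t c0 Lu.
rewrite ipZl; [|exact: La|exact: L2Z].
rewrite ipZr; [|exact: La|exact: La].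
by rewrite (ip_affine t c0 Lu Lu); ring.
Qed.

Lemma lap_sq_affine Om f c t : 0 < c -> test_function Om f ->
  lap_sq (f \o affine c t) = c ^+ 4 * c^-1 ^+ n * lap_sq f.
Proof.
move=> c0 tf; have [sf _ _] := tf.
have LL := test_function_L2 (test_function_laplacian tf).
rewrite /lap_sq laplacian_affine; [|exact: sf].
by rewrite (ip_scale_affine (c ^+ 2) t c0 LL) -exprM.
Qed.

Lemma grad_sq_affine Om f c t : 0 < c -> test_function Om f ->
  grad_sq (f \o affine c t) = c ^+ 2 * c^-1 ^+ n * grad_sq f.
Proof.
move=> c0 tf; have [sf _ _] := tf.
rewrite /grad_sq mulr_sumr; apply: eq_bigr => i _.
have LL := test_function_L2 (test_function_partial i tf).
have -> : partial i (f \o affine c t) = c *: (partial i f \o affine c t).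
  by have := partials_affine c t [:: i] sf; rewrite expr1; exact.
exact: ip_scale_affine.
Qed.

(** The homothety of ratio c and centre x0; composing with it shrinks a
    function towards x0. *)
Definition dil (c : R) (x0 : V) : V -> V := affine c ((1 - c) *: x0).

Lemma dilE c x0 y : dil c x0 y = c *: (y - x0) + x0.
Proof. by rewrite /dil /affine scalerBl scale1r scalerBr addrA addrAC. Qed.

(** F has no regularity, so the ratio xi of the dilation is varied from 1 to c
    and the derivative in xi falls on f.  On the cube, which contains x0, the
    coordinates of y - x0 are at most 2 m in absolute value, and the
    derivatives of f lose nothing since xi >= 1 only contracts. *)
Lemma ip_dilation Om f F m x0 c : test_function Om f -> L2 F ->
  (forall x, ~ cube m x -> F x = 0) -> 0 < m -> cube m x0 -> 1 <= c <= 2 ->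
  `|ip F (f \o dil c x0) - ip F f| <=
    (c - 1) * (2 * n%:R * m ^+ 2 * ip F F + grad_sq f / 2).
Proof.
move=> tf LF Fm m0 x0m /andP[c1 c2]; have [sf _ _] := tf.
have Lf := test_function_L2 tf.
pose g (xi : R) (y : V) := F y * f (xi *: (y - x0) + x0).
pose D (xi : R) (y : V) := \sum_i (y - x0) ord0 i * partial i f (xi *: (y - x0) + x0).
pose dg (xi : R) (y : V) := F y * D xi y.
have hE xi : ip F (f \o dil xi x0) = \int[mu]_y g xi y.
  by apply: eq_Rintegral => y _; rewrite /g /= dilE.
pose B i := sval (cid2 (test_function_bounded (test_function_partial i tf))).
have B0 i : 0 <= B i by rewrite /B; case: cid2.
have BP i x : `|partial i f x| <= B i by rewrite /B; case: cid2.
pose C := \sum_i (2 * m) * B i.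
have C0 : 0 <= C by apply: sumr_ge0 => i _; rewrite !mulr_ge0// ltW.
have xc y i : cube m y -> `|(y - x0) ord0 i| <= 2 * m.
  move=> ym; rewrite !mxE; have /andP[? ?] := ym i; have /andP[? ?] := x0m i.
  rewrite ler_norml; lra.
have DC xi y : cube m y -> `|D xi y| <= C.
  move=> ym; apply: le_trans (ler_norm_sum _ _ _) _.
  by apply: ler_sum => i _; rewrite normrM ler_pM// xc.
have FC : mu.-integrable setT (EFin \o (fun y => `|F y| * C)).
  have := integrable_ip (L2_cube_cst m C) LF => /integrable_abse.
  congr (_.-integrable _ _); apply/funext => y /=; rewrite patchE; case: ifPn => [_|/negP].
    by rewrite normrM mulrC (ger0_norm C0).
  by rewrite inE => /Fm ->; rewrite mulr0 normr0 mul0r.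
have L2i xi : 0 < xi -> L2 (f \o dil xi x0) by move=> xi0; exact: L2_affine.
have dgi (xi : R) y : is_derive xi (1 : R) (g ^~ y : R -> R) (dg xi y).
  have h := @smooth_radial R n f (y - x0) (xi *: (y - x0) + x0) sf.
  have [dh eh] := h.
  have l := line_is_derive dh.
  have z := is_deriveZ (F y) l.
  by move: z; rewrite eh; exact.
have gi (xi : R) : 0 < xi -> mu.-integrable setT (EFin \o g xi).
  move=> xi0; have := integrable_ip LF (L2i xi xi0).
  by congr (_.-integrable _ _); apply/funext => y; rewrite /g /= dilE.
have Hd (xi : R) : 0 < xi < 3 ->
    is_derive xi (1 : R) (fun xi : R => \int[mu]_y g xi y) (\int[mu]_y dg xi y).
  move=> xi03; apply: (@parametric_is_derive _ V R mu g dg xi 0 3 (fun y => `|F y| * C)) => //.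
  - by move=> x /andP[x0_ _]; exact: gi.
  - by move=> y; rewrite mulr_ge0.
  - move=> x y _; have [ym|ym] := pselect (cube m y).
      by rewrite /dg normrM ler_wpM2l//; exact: DC.
    by rewrite /dg Fm// mul0r normr0 mul0r.
pose P i y := F y * (y - x0) ord0 i.
have LP i : L2 (P i) /\ ip (P i) (P i) <= (2 * m) ^+ 2 * ip F F.
  have mP : measurable_fun setT (P i).
    apply: measurable_funM; first exact: LF.1.
    have -> : (fun y => (y - x0) ord0 i) = (fun y : V => y ord0 i - x0 ord0 i).
      by apply/funext => y; rewrite !mxE.
    by apply: measurable_funB => //; exact: measurable_coord.
  have L2F : L2 ((2 * m) *: F) by exact: L2Z.
  have le x : `|P i x| <= `|((2 * m) *: F) x|.
    rewrite [leRHS]normrM mulrC [leLHS]normrM.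
    have [xm|xm] := pselect (cube m x); last by rewrite Fm// normr0 !mul0r.
    by rewrite ler_wpM2l// (ger0_norm (_ : 0 <= 2 * m)) ?xc// mulr_ge0// ltW.
  have LPi := L2_le mP L2F le; split=> //.
  by apply: le_trans (le_ip LPi L2F le) _; rewrite ipZl// ipZr// mulrA expr2.
have Lp i := test_function_L2 (test_function_partial i tf).
have Lpd xi i : 0 < xi -> L2 (partial i f \o dil xi x0) by move=> xi0; exact: L2_affine.
have dgE (xi : R) : 0 < xi -> \int[mu]_y dg xi y =
    \sum_i ip (P i) (partial i f \o dil xi x0).
  move=> xi0; rewrite -Rintegral_sum; last first.
    by move=> i; apply: integrable_ip; [exact: (LP i).1|exact: Lpd].
  apply: eq_Rintegral => y _; rewrite /dg /D mulr_sumr; apply: eq_bigr => i _.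
  by rewrite /P /= dilE mulrA.
have dgB (xi : R) : 1 <= xi -> `|\int[mu]_y dg xi y| <=
    2 * n%:R * m ^+ 2 * ip F F + grad_sq f / 2.
  move=> xi1; have xi0 : 0 < xi by exact: lt_le_trans xi1.
  rewrite dgE//; apply: le_trans (ler_norm_sum _ _ _) _.
  have -> : 2 * n%:R * m ^+ 2 * ip F F + grad_sq f / 2 =
      \sum_i (2 * m ^+ 2 * ip F F + ip (partial i f) (partial i f) / 2).
    rewrite big_split/= sumr_const card_ord -mulr_suml; congr (_ + _).
    by rewrite -mulr_natl; ring.
  apply: ler_sum => i _; have [LPi Pi] := LP i.
  apply: le_trans (normr_ip_le LPi (Lpd xi i xi0)) _.
  rewrite (ip_affine _ xi0 (Lp i) (Lp i)).
  have : xi^-1 ^+ n * ip (partial i f) (partial i f) <= ip (partial i f) (partial i f).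
    rewrite -[leRHS]mul1r ler_wpM2r ?ip_ge0// exprn_ile1// ?invf_le1//.
    by rewrite invr_ge0 ltW.
  move: Pi; rewrite exprMn; set a := ip F F; set b := ip (P i) (P i); set e := ip _ _.
  lra.
have -> : ip F f = ip F (f \o dil 1 x0).
  by apply: eq_Rintegral => y _ /=; rewrite dilE scale1r subrK.
rewrite !hE.
have cont : {within `[1, c], continuous (fun xi : R => \int[mu]_y g xi y)}.
  apply: derivable_within_continuous => xi; rewrite in_itv/= => /andP[x1 xc_].
  by have [] := Hd xi ltac:(lra).
have Hd' xi : xi \in `]1, c[%R ->
    is_derive xi (1 : R) (fun xi : R => \int[mu]_y g xi y) (\int[mu]_y dg xi y).
  by rewrite in_itv/= => /andP[? ?]; apply: Hd; lra.
have [xi] := MVT_segment c1 Hd' cont.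
rewrite in_itv/= => /andP[x1 _] ->.
rewrite normrM mulrC (ger0_norm (_ : 0 <= c - 1)) ?subr_ge0// ler_wpM2l ?subr_ge0//.
exact: dgB.
Qed.

(** Weak solutions with datum F and parameter gam are its critical points. *)
Definition energy F (gam : R) f := (lap_sq f + gam * grad_sq f) / 2 - ip F f.

(** The admissible ratios depend on F, gam, the cube and the bound B, but
    neither on the domain nor on f: this uniformity allows near minimizers to
    be moved from one domain to another. *)
Lemma energy_dilation F gam m B e : L2 F -> (forall x, ~ cube m x -> F x = 0) ->
  0 < m -> 0 <= B -> 0 < e -> exists2 d, 0 < d & forall c, 1 <= c <= 1 + d ->
  forall Om f x0, test_function Om f -> cube m x0 -> lap_sq f <= B -> grad_sq f <= B ->
    `|energy F gam (f \o dil c x0) - energy F gam f| <= e.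
Proof.
move=> LF Fm m0 B0 e0.
pose K := 2 * n%:R * m ^+ 2 * ip F F + B / 2.
have K0 : 0 <= K by rewrite addr_ge0 ?divr_ge0// !mulr_ge0 ?exprn_ge0 ?ip_ge0// ltW.
(* Bounds the change of the energy, by the scaling of the three terms;
   continuous with w 1 = 0. *)
pose w (c : R) := `|c ^+ 4 * c^-1 ^+ n - 1| * (B / 2) +
  `|gam| * `|c ^+ 2 * c^-1 ^+ n - 1| * (B / 2) + `|c - 1| * K.
have cw : w c @[c --> (1 : R)] --> w 1.
  have ci : c^-1 @[c --> (1 : R)] --> (1 : R)^-1 by apply: cvgV => //; exact: oner_neq0.
  have cX k : (c ^+ k) @[c --> (1 : R)] --> (1 : R) ^+ k by apply: exprn_continuous.
  have cV k : (c^-1 ^+ k) @[c --> (1 : R)] --> (1 : R)^-1 ^+ k.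
    have h : {for (1 : R)^-1, continuous (fun y : R => y ^+ k)} by exact: exprn_continuous.
    exact: (continuous_cvg _ h ci).
  have cN (f : R -> R) (l : R) : f c @[c --> (1 : R)] --> l -> `|f c| @[c --> (1:R)] --> `|l|.
    by move=> h; exact: cvg_norm.
  have c1 (k : nat) : `|c ^+ k * c^-1 ^+ n - 1| @[c --> (1:R)] --> `|(1:R) ^+ k * 1^-1 ^+ n - 1|.
    apply: cN; apply: cvgB; last exact: cvg_cst.
    by apply: cvgM; [exact: cX|exact: cV].
  apply: cvgD; first apply: cvgD.
  - by apply: cvgM; [exact: c1|exact: cvg_cst].
  - by apply: cvgM; [apply: cvgM; [exact: cvg_cst|exact: c1]|exact: cvg_cst].
  - apply: cvgM; last exact: cvg_cst.
    by apply: cN; apply: cvgB; [exact: cvg_id|exact: cvg_cst].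
have w1 : w 1 = 0 by rewrite /w !expr1n invr1 !expr1n mul1r subrr normr0 mulr0 !mul0r !addr0.
have /nbhs_ballP[d /= d0 hd] : nbhs (1:R) (fun c => `|w 1 - w c| <= e).
  by move/cvgrPdist_le : cw; exact.
exists (Num.min 1 (d / 2)); first by rewrite lt_min ltr01 divr_gt0.
move=> c /andP[c1]; rewrite -lerBlDl le_min => /andP[c2 cd] Om f x0 tf x0m AB GB.
have c0 : 0 < c by lra.
have wc : w c <= e.
  have := hd c; rewrite /ball/= distrC ger0_norm ?subr_ge0// => /(_ ltac:(lra)).
  by rewrite w1 sub0r normrN; apply: le_trans; exact: ler_norm.
apply: le_trans wc.
rewrite /energy (lap_sq_affine _ c0 tf) (grad_sq_affine _ c0 tf).
have := ip_dilation tf LF Fm m0 x0m (c := c) ltac:(lra).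
set p := c ^+ 4 * _; set q := c ^+ 2 * _; set A := lap_sq f in AB *; set G := grad_sq f in GB *.
set a := ip F _; set b := ip F f => hab.
have -> : (p * A + gam * (q * G)) / 2 - a - ((A + gam * G) / 2 - b) =
  (p - 1) * (A / 2) + gam * (q - 1) * (G / 2) - (a - b) by field.
have nA : `|A| = A by rewrite ger0_norm// lap_sq_ge0.
have nG : `|G| = G by rewrite ger0_norm// grad_sq_ge0.
have n2 : `|2^-1| = 2^-1 :> R by rewrite ger0_norm// invr_ge0.
apply: le_trans (ler_normB _ _) _; apply: lerD.
  apply: le_trans (ler_normD _ _) _; rewrite !normrM nA nG n2; apply: lerD.
    by rewrite ler_wpM2l// ler_wpM2r// invr_ge0.
  by rewrite ler_wpM2l ?mulr_ge0// ler_wpM2r// invr_ge0.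
apply: le_trans hab _; rewrite ger0_norm ?subr_ge0// ler_wpM2l ?subr_ge0// lerD2l.
by rewrite ler_wpM2r// invr_ge0.
Qed.

End dilation.

(** * The fundamental lemma of the calculus of variations *)

Section bump1.
Context {R : realType}.
Implicit Types (p q : {poly R}) (x y z : R).

(** Induction on the degree, spending half of the exponential rate a on each
    factor of z. *)
Lemma poly_exp_bound p : exists2 C : R, 0 <= C &
  forall z, 0 < z -> `|p.[z]| * expR (- z) <= C.
Proof.
suff H : forall a, 0 < a -> exists2 C : R, 0 <= C &
  forall z, 0 < z -> `|p.[z]| * expR (- (a * z)) <= C.
  by have [C C0 h] := H 1 ltr01; exists C => // z z0; rewrite -[z in - z]mul1r h.
elim/poly_ind: p => [|p c IH] a a0.
  by exists 0 => // z z0; rewrite horner0 normr0 mul0r.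
have a2 : 0 < a / 2 by rewrite divr_gt0.
have [C C0 hC] := IH _ a2.
exists (C * (2 / a) + `|c|).
  by rewrite addr_ge0// mulr_ge0// divr_ge0// ltW.
move=> z z0; rewrite hornerMXaddC.
apply: (@le_trans _ _ ((`|p.[z]| * z + `|c|) * expR (- (a * z)))).
  rewrite ler_wpM2r ?expR_ge0//; apply: le_trans (ler_normD _ _) _.
  by rewrite normrM (gtr0_norm z0).
have e1 : expR (- (a * z)) <= 1 by rewrite -expR0 ler_expR oppr_le0 mulr_ge0 ?ltW.
rewrite mulrDl lerD//; last by rewrite -[leRHS]mulr1 ler_wpM2l.
have -> : - (a * z) = - (a / 2 * z) + - (a / 2 * z) by field.
rewrite expRD mulrACA; apply: ler_pM.
- by rewrite mulr_ge0// expR_ge0.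
- by rewrite mulr_ge0 ?expR_ge0// ltW.
- exact: hC.
rewrite expRN ler_pdivrMr ?expR_gt0//.
apply: (@le_trans _ _ (2 / a * (1 + a / 2 * z))); last first.
  by rewrite ler_wpM2l ?expR_ge1Dx// divr_ge0// ltW.
have -> : 2 / a * (1 + a / 2 * z) = 2 / a + z by field; rewrite gt_eqF.
by rewrite lerDr divr_ge0// ltW.
Qed.

(** The extensions by 0 of p(1/y) exp(-1/y) form a class closed under
    differentiation, so that their smoothness follows by induction. *)
Definition pexp p y : R := if 0 < y then p.[y^-1] * expR (- y^-1) else 0.

Definition pexp_deriv p : {poly R} := 'X^2 * (p - p^`()).

Lemma is_derive_horner p x : is_derive x (1 : R) (fun x : R => p.[x]) (p^`().[x]).
Proof.
elim/poly_ind: p => [|p c IH].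
  rewrite deriv0 (_ : (fun x : R => _) = cst 0) ?horner0; first exact: is_derive_cst.
  by apply/funext => z; rewrite horner0.
rewrite (_ : (fun x : R => _) = (fun x : R => p.[x]) * id + cst c); last first.
  by apply/funext => z; rewrite hornerMXaddC.
apply: is_derive_eq; rewrite derivD derivM derivX derivC addr0 !hornerE.
by rewrite /= scaler1 -[_ *: _]/(_ * _); ring.
Qed.

Lemma is_derive_pexp p y : is_derive y (1 : R) (pexp p) (pexp (pexp_deriv p) y).
Proof.
have [y0|y0|y0] := ltgtP 0 y.
- rewrite {2}/pexp y0.
  apply: (@near_eq_is_derive _ _ _ (fun y : R => p.[y^-1] * expR (- y^-1))).
    near=> z; rewrite /pexp ifT//; near: z.
    exact: lt_nbhsr.
  have yn : y != 0 by rewrite gt_eqF.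
  have dV : is_derive y (1 : R) (fun z : R => z^-1) (- y ^- 2).
    have := @is_deriveV R id y 1 1 yn (is_derive_id y 1).
    by rewrite /= -[_ *: _]/(_ * _) mulr1.
  have dp : is_derive y (1 : R) ((fun z : R => p.[z]) \o (fun z : R => z^-1)) (p^`().[y^-1] * (- y ^- 2)).
    by apply: is_derive1_comp; exact: is_derive_horner.
  have dN : is_derive y (1 : R) (fun z : R => - z^-1) (- (- y ^- 2)) by exact: is_deriveN.
  have de : is_derive y (1 : R) (expR \o (fun z : R => - z^-1)) (expR (- y^-1) * (- (- y ^- 2))).
    by apply: is_derive1_comp; exact: is_derive_expR.
  have := is_deriveM dp de.
  congr (is_derive _ _ _ _); rewrite /pexp_deriv !hornerE /=.
  rewrite -![_ *: _]/(_ * _) exprVn; ring.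
- rewrite {2}/pexp ltNge (ltW y0)/=.
  apply: (@near_eq_is_derive _ _ _ (cst 0)).
  near=> z; rewrite /pexp ifF//; apply/negbTE; rewrite -leNgt ltW//; near: z.
  exact: lt_nbhsl.
- rewrite -y0 {2}/pexp ltxx.
  have [C C0 hC] := poly_exp_bound ('X^2 * p).
  have bd z : `|pexp p z| <= C * z ^+ 2.
    rewrite /pexp; case: ifPn => [z0|_]; last by rewrite normr0 mulr_ge0// sqr_ge0.
    have zi : 0 < z^-1 by rewrite invr_gt0.
    have nz : `|z^-1 ^+ 2| = (z ^+ 2)^-1 by rewrite exprVn gtr0_norm// invr_gt0 exprn_gt0.
    have := hC _ zi; rewrite hornerM hornerXn normrM nz -mulrA => h; rewrite normrM (gtr0_norm (expR_gt0 _)).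
    by rewrite -ler_pdivrMr ?exprn_gt0// mulrC.
  have L : h^-1 *: ((pexp p \o shift 0) (h *: (1 : R)) - pexp p 0) @[h --> (0:R)^'] --> (0 : R).
    apply/cvgrPdist_le => e e0; near=> h.
    have h0 : h != 0 by near: h; exact: nbhs_dnbhs_neq.
    have hh : `|h| <= e / (C + 1) by near: h; apply: dnbhs0_le; rewrite divr_gt0// ltr_wpDl.
    rewrite sub0r normrN /= addr0 [h *: _]mulr1 {2}/pexp ltxx subr0.
    rewrite -[_ *: _]/(_ * _) normrM normfV ler_pdivrMl ?normr_gt0//.
    apply: le_trans (bd h) _; rewrite -real_normK ?num_real// expr2 mulrA mulrC.
    rewrite ler_wpM2l//; apply: (@le_trans _ _ ((C + 1) * `|h|)).
      by rewrite ler_wpM2r// lerDl.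
    by rewrite mulrC -ler_pdivlMr// ltr_wpDl.
  split; first by apply/cvg_ex; exists 0.
  exact/cvg_lim.
Unshelve. all: by end_near. Qed.

Lemma continuous_pexp p : continuous (pexp p).
Proof.
move=> y; apply/differentiable_continuous/derivable1_diffP.
by have [] := is_derive_pexp p y.
Qed.

End bump1.

Section density_measure.
Context d (T : measurableType d) (R : realType) (mu : {measure set T -> \bar R}).
Variables (f : T -> \bar R) (mf : measurable_fun setT f) (f0 : forall x, (0 <= f x)%E).

(** The let-bindings make the definition depend on the two hypotheses, so that
    the measure structure below can be inferred for it. *)
Definition density_measure (A : set T) : \bar R :=
  let _ := mf in let _ := f0 in (\int[mu]_(x in A) f x)%E.

Let density0 : density_measure set0 = 0%E.
Proof. by rewrite /density_measure integral_set0. Qed.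

Let density_ge0 A : (0 <= density_measure A)%E.
Proof. by apply: integral_ge0 => x _; exact: f0. Qed.

Let density_sigma_additive : semi_sigma_additive density_measure.
Proof. exact: semi_sigma_additive_nng_induced. Qed.

HB.instance Definition _ := isMeasure.Build _ _ _ density_measure
  density0 density_ge0 density_sigma_additive.

End density_measure.

Section fundamental_lemma.
Context {R : realType} {n : nat}.
Local Notation V := 'rV[R]_n.
Local Notation mu := (@lebesgue_rV R n).
Implicit Types (f g phi psi : V -> R) (i j : 'I_n) (Om K : set V) (a b : 'I_n -> R).

Definition coord_pexp (p : {poly R}) i (c e : R) (x : V) : R := pexp p (c * x ord0 i + e).

Lemma is_derive_coord_pexp p i j c e (x : V) :
  is_derive x (ev j) (coord_pexp p i c e) (c * (i == j)%:R * coord_pexp (pexp_deriv p) i c e x).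
Proof.
pose G : R -> R := pexp p \o (fun h : R => c * (i == j)%:R * h + (c * x ord0 i + e)).
have dG : is_derive (0:R) (1 : R) G (pexp (pexp_deriv p) (c * x ord0 i + e) * (c * (i == j)%:R)).
  apply: is_derive1_comp.
    by rewrite mulr0 add0r; exact: is_derive_pexp.
  by apply: is_derive_eq; rewrite addr0 -[_ *: _]/(_ * _) mulr1.
have E : (fun h : R => h^-1 *: ((coord_pexp p i c e \o shift x) (h *: ev j) - coord_pexp p i c e x))
   = (fun h : R => h^-1 *: ((G \o shift 0) (h *: (1:R)) - G 0)).
  apply/funext => h; rewrite /G /coord_pexp /= !mxE eqxx/= mulr0 add0r addr0.
  congr (_ *: (pexp p _ - _)); rewrite [h *: 1]mulr1.
  by ring.
have [d1 e1] := dG.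
split; first by rewrite /derivable E.
by rewrite /derive E mulrC; exact: e1.
Qed.

Lemma smooth_coord_pexp p i c e : smooth (coord_pexp p i c e).
Proof.
have cc q : continuous (coord_pexp q i c e).
  move=> x; have h : (c * x ord0 i + e) @[x --> x] --> c * x ord0 i + e.
    exact: (cvgD (cvgM (cvg_cst c) (@coord_continuous R 1 n ord0 i x)) (cvg_cst e)).
  apply: (@continuous_comp _ _ _ (fun x : V => c * x ord0 i + e) (pexp q)); first exact: h.
  exact: continuous_pexp.
move=> k; elim: k p => [|k IH] p; first exact: cc.
split; first exact: cc.
  by move=> j x; have [] := is_derive_coord_pexp p i j c e x.
move=> j; rewrite (_ : partial j _ = (c * (i == j)%:R) *: coord_pexp (pexp_deriv p) i c e).
  by apply: C_kZ; exact: IH.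
by apply/funext => x; have [_ h] := is_derive_coord_pexp p i j c e x; exact: h.
Qed.

Definition side a b (k : R) i : V -> R :=
  coord_pexp 1 i k (- (k * a i)) * coord_pexp 1 i (- k) (k * b i).

(** For k tending to infinity these functions increase to the indicator of the
    open box, each side contributing exp(-1/(k t)) with t the distance to that
    side. *)
Definition bump a b (k : R) (x : V) : R := \prod_i side a b k i x.

Lemma smooth_prod (I : Type) (s : seq I) (F : I -> V -> R) :
  (forall t, smooth (F t)) -> smooth (fun x => \prod_(t <- s) F t x).
Proof.
move=> sF; elim: s => [|t s IH].
  rewrite (_ : (fun x => _) = fun=> 1); first by move=> k; exact: C_k_cst.
  by apply/funext => x; rewrite big_nil.
rewrite (_ : (fun x => _) = F t * (fun x => \prod_(t <- s) F t x)); last first.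
  by apply/funext => x; rewrite big_cons.
exact: smoothM.
Qed.

Lemma smooth_bump a b k : smooth (bump a b k).
Proof. by apply: smooth_prod => i; apply: smoothM; exact: smooth_coord_pexp. Qed.

Lemma pexp1_01 (y : R) : 0 <= pexp 1 y <= 1.
Proof.
rewrite /pexp; case: ifPn => [y0|_]; last by rewrite lexx ler01.
rewrite hornerC mul1r expR_ge0/= -expR0 ler_expR oppr_le0 invr_ge0 ltW//.
Qed.

Lemma sideE a b k i x : side a b k i x = pexp 1 (k * (x ord0 i - a i)) * pexp 1 (k * (b i - x ord0 i)).
Proof.
rewrite /side /coord_pexp -[LHS]/(_ * _); congr (pexp 1 _ * pexp 1 _); ring.
Qed.

Lemma bump_01 a b k x : 0 <= bump a b k x <= 1.
Proof.
rewrite /bump; apply/andP; split.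
  apply: prodr_ge0 => i _; rewrite sideE; apply: mulr_ge0; exact: (andP (pexp1_01 _)).1.
apply: prodr_ile1 => i _; rewrite sideE.
have /andP[h1 h2] := pexp1_01 (k * (x ord0 i - a i)).
have /andP[h3 h4] := pexp1_01 (k * (b i - x ord0 i)).
by rewrite mulr_ge0//= mulr_ile1.
Qed.

Lemma bump_out a b k x : 0 < k -> ~ obox a b x -> bump a b k x = 0.
Proof.
move=> k0 nx; have [i hi] : exists i, ~~ (a i < x ord0 i < b i).
  apply: contrapT => h; apply: nx => i; apply: contrapT => hi; apply: h.
  by exists i; apply/negP.
rewrite /bump (bigD1 i)//= sideE.
suff -> : pexp 1 (k * (x ord0 i - a i)) * pexp 1 (k * (b i - x ord0 i)) = 0 by rewrite mul0r.
move: hi; rewrite negb_and -!leNgt => /orP[h|h].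
  by rewrite {1}/pexp ifF ?mul0r//; apply/negbTE; rewrite -leNgt pmulr_rle0// subr_le0.
by rewrite {2}/pexp ifF ?mulr0//; apply/negbTE; rewrite -leNgt pmulr_rle0// subr_le0.
Qed.

Lemma test_function_bump a b k Om : 0 < k ->
  [set x : V | forall i, a i <= x ord0 i <= b i] `<=` Om -> test_function Om (bump a b k).
Proof.
move=> k0 hO.
apply: (@test_function_intro _ _ _ [set x : V | forall i, a i <= x ord0 i <= b i]) => //.
- exact: smooth_bump.
- have := @rV_compact R n (fun i => `[a i, b i]%classic) (fun i => @segment_compact R (a i) (b i)).
  congr compact; apply/seteqP; split=> x /= h i; have := h i; by rewrite in_itv.
- move=> x nx; apply: bump_out => // ox; apply: nx => i.
  by have /andP[/ltW -> /ltW ->] := ox i.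
Qed.

Lemma pexp1_cvg (y : R) : 0 < y -> pexp 1 (k.+1%:R * y) @[k --> \oo] --> (1 : R).
Proof.
move=> y0.
have -> : (fun k : nat => pexp 1 (k.+1%:R * y)) = expR \o (fun k : nat => - (y^-1 * (harmonic k))).
  apply/funext => k; rewrite /pexp ifT ?mulr_gt0//= hornerC mul1r invfM mulrC.
  by rewrite mulrC.
rewrite -expR0; apply: continuous_cvg; first exact: continuous_expR.
rewrite -oppr0; apply: cvgN; rewrite -[X in _ --> X](mulr0 y^-1).
by apply: cvgM; [exact: cvg_cst|exact: cvg_harmonic].
Qed.

Lemma cvg_prod1 (I : Type) (s : seq I) (F : I -> nat -> R) :
  (forall t, F t k @[k --> \oo] --> (1 : R)) -> \prod_(t <- s) F t k @[k --> \oo] --> (1 : R).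
Proof.
move=> cF; elim: s => [|t s IH].
  by under eq_cvg do rewrite big_nil; exact: cvg_cst.
under eq_cvg do rewrite big_cons.
by have := cvgM (cF t) IH; rewrite mulr1; apply.
Qed.

Lemma bump_cvg a b x : obox a b x -> bump a b k.+1%:R x @[k --> \oo] --> (1 : R).
Proof.
move=> ox; rewrite /bump; apply: cvg_prod1 => i.
under eq_cvg do rewrite sideE.
have /andP[xa xb] := ox i.
have h1 : 0 < x ord0 i - a i by rewrite subr_gt0.
have h2 : 0 < b i - x ord0 i by rewrite subr_gt0.
by have := cvgM (pexp1_cvg h1) (pexp1_cvg h2); rewrite mulr1; apply.
Qed.

(** Dominated convergence along the bump functions of the box. *)
Lemma integral_obox0 Om g a b : mu.-integrable setT (EFin \o g) ->
  [set x : V | forall i, a i <= x ord0 i <= b i] `<=` Om ->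
  (forall phi, test_function Om phi -> \int[mu]_x (g x * phi x) = 0) ->
  (\int[mu]_(x in obox a b) (g x)%:E = 0)%E.
Proof.
move=> ig hO g0.
have [/measurable_EFinP mg _] := integrableP _ _ _ ig.
have mb : measurable (obox a b : set V) by exact: measurable_obox.
have tb k := test_function_bump (ltr0Sn R k) hO.
have mbump k : measurable_fun setT (bump a b k.+1%:R) by exact: test_function_measurable (tb k).
have h1 k : measurable_fun setT (fun x => (g x * bump a b k.+1%:R x)%:E).
  by apply/measurable_EFinP; exact: measurable_funM.
have h2 : measurable_fun setT ((EFin \o g) \_ (obox a b)).
  apply/(measurable_restrictT _ mb); apply: measurable_funTS.
  exact/measurable_EFinP.
have h3 : {ae mu, forall x, [set: V] x ->
    (fun k => (g x * bump a b k.+1%:R x)%:E) @ \oo --> ((EFin \o g) \_ (obox a b)) x}.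
  apply: aeW => x _; rewrite patchE; case: ifPn => [|/negP]; rewrite inE => ox.
    apply: cvg_EFin; first exact: nearW.
    by have := cvgM (cvg_cst (g x)) (bump_cvg ox); rewrite mulr1; apply.
  rewrite (_ : (fun k => _) = fun=> 0%E); first exact: cvg_cst.
  by apply/funext => k; rewrite bump_out// mulr0.
have h4 : mu.-integrable setT (abse \o (EFin \o g)) by exact: integrable_abse.
have h5 : {ae mu, forall x k, [set: V] x ->
    (`|(g x * bump a b k.+1%:R x)%:E| <= (abse \o (EFin \o g)) x)%E}.
  apply: aeW => x k _ /=; rewrite lee_fin normrM ler_piMr//.
  by have /andP[p0 p1] := bump_01 a b k.+1%:R x; rewrite ger0_norm.
have [_ _] := dominated_convergence measurableT h1 h2 h3 h4 h5.
rewrite -integral_mkcond => H.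
have E k : (\int[mu]_x (g x * bump a b k.+1%:R x)%:E = 0)%E.
  have ib : mu.-integrable setT (EFin \o (fun x => g x * bump a b k.+1%:R x)).
    apply: (le_integrable measurableT _ _ ig).
      exact: h1.
    move=> x _ /=; rewrite lee_fin normrM ler_piMr//.
    by have /andP[p0 p1] := bump_01 a b k.+1%:R x; rewrite ger0_norm.
  rewrite -[LHS]fineK; last exact: (integrable_fin_num measurableT ib).
  by congr EFin; exact: (g0 _ (tb k)).
move: H; rewrite /= (_ : (fun k => _) = cst 0%E); last by apply/funext => k; exact: E.
by move=> /(cvg_lim (@ereal_hausdorff R)) <-; rewrite lim_cst.
Qed.

(** The positive and the negative part of g on the box are densities of two
    measures which agree on all boxes, hence on all Borel sets. *)
Lemma obox_ae0 Om g a b : mu.-integrable setT (EFin \o g) ->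
  [set x : V | forall i, a i <= x ord0 i <= b i] `<=` Om ->
  (forall phi, test_function Om phi -> \int[mu]_x (g x * phi x) = 0) ->
  {ae mu, forall x, obox a b x -> g x = 0}.
Proof.
move=> ig hO g0.
have [mgE _] := integrableP _ _ _ ig.
have mb : measurable (obox a b : set V) by exact: measurable_obox.
pose G := (EFin \o g) \_ (obox a b).
have iG : mu.-integrable setT G.
  by apply/(integrable_mkcond _ mb).1; exact: integrableS ig.
have GB c e : (\int[mu]_(x in obox c e) G x = 0)%E.
  rewrite /G -integral_mkcondr oboxI; apply: (@integral_obox0 Om) => // x h.
  apply: hO => i; have := h i; rewrite ge_max le_min => /andP[/andP[_ ->] /andP[_ ->]] //.
have [mG _] := integrableP _ _ _ iG.
have mGp := measurable_funepos mG; have mGn := measurable_funeneg mG.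
have Gp0 x : (0 <= G^\+ x)%E by exact: funepos_ge0.
have Gn0 x : (0 <= G^\- x)%E by exact: funeneg_ge0.
have fin (E : set V) (h : V -> \bar R) : measurable E -> mu.-integrable setT h ->
    (\int[mu]_(x in E) h x)%E \is a fin_num.
  by move=> mE ih; apply: integrable_fin_num => //; exact: integrableS ih.
have iGp := integrable_funepos measurableT iG.
have iGn := integrable_funeneg measurableT iG.
have pn E : measurable E ->
    (\int[mu]_(x in E) G x = 0 <-> \int[mu]_(x in E) G^\+ x = \int[mu]_(x in E) G^\- x)%E.
  move=> mE; rewrite integralE; split=> [|->]; last by rewrite subee// fin.
  by move/eqP; rewrite sube_eq ?fin ?fin_num_adde_defl ?fin_numN ?fin// add0e => /eqP.
have GE E : measurable E -> (\int[mu]_(x in E) G x = 0)%E.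
  move=> mE; apply/(pn E mE).
  apply: (@rV_measure_unique R n (density_measure mu mGp Gp0) (density_measure mu mGn Gn0)) => //.
    move=> c e; apply/(pn (obox c e) _); last exact: GB.
    exact: measurable_obox.
  move=> k; change (\int[mu]_(x in cube k%:R%R) G^\+ x < +oo)%E.
  by rewrite ltey_eq fin//; exact: measurable_obox.
have G0 : ae_eq mu setT G (cst 0%E).
  apply: integral_ae_eq => // E _ mE; rewrite GE//.
  by rewrite integral0.
move: G0; apply: filterS => x /(_ I) /=; rewrite /G patchE => h ox.
by move: h; rewrite mem_set// => -[].
Qed.

(** Om is covered by countably many boxes with rational vertices whose
    closures it contains, and g vanishes almost everywhere on each of them. *)
Lemma fundamental_lemma Om g m : open Om -> Om `<=` cube m -> L2 mu g ->
  (forall x, ~ Om x -> g x = 0) ->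
  (forall phi, test_function Om phi -> ip mu g phi = 0) ->
  g = 0 %[ae mu].
Proof.
move=> oO Om_m Lg gO g0.
have ig : mu.-integrable setT (EFin \o g).
  have := integrable_ip (L2_cube_cst m 1) Lg.
  congr (_.-integrable _ _); apply/funext => x /=; rewrite patchE.
  case: ifPn => [_|/negP]; first by rewrite mul1r.
  rewrite inE => nx; rewrite mul0r gO// => Ox; exact/nx/Om_m.
pose F (ab : {ffun 'I_n -> rat} * {ffun 'I_n -> rat}) :=
  [set x : V | forall i, ratr (ab.1 i) <= x ord0 i <= ratr (ab.2 i)] `<=` Om.
pose Q (ab : {ffun 'I_n -> rat} * {ffun 'I_n -> rat}) : set V :=
  obox (fun i => ratr (ab.1 i)) (fun i => ratr (ab.2 i)).
have H : {ae mu, forall x, forall k ab, unpickle k = Some ab -> F ab -> Q ab x -> g x = 0}.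
  apply: ae_foralln => k; case: (unpickle k) => [ab|]; last exact: aeW.
  have [Fab|nF] := pselect (F ab); last by apply: aeW => x ? [<-].
  have := obox_ae0 ig Fab g0; apply: filterS => x h ? [<-] _; exact: h.
move: H; apply: filterS => x h _.
have [Ox|] := pselect (Om x); last exact: gO.
have [ab [xab abO]] := nbhs_rat_obox (open_nbhs_nbhs (conj oO Ox)).
exact: (h _ ab (pickleK _) abO xab).
Qed.

End fundamental_lemma.

(** * Weak derivatives and approximation by test functions *)

Section weak_derivatives.
Context {R : realType} {n : nat}.
Local Notation V := 'rV[R]_n.
Local Notation mu := (@lebesgue_rV R n).
Local Notation ip := (ip mu).
Local Notation L2 := (L2 mu).
Implicit Types (f g u v phi psi : V -> R) (i j : 'I_n) (s : seq 'I_n).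
Variables (Om : set V) (m : R).
Hypotheses (oO : open Om) (Om_m : Om `<=` cube m).

Definition sqdist u v := ip (u - v) (u - v).

Lemma cut_out u x : ~ Om x -> (u \_ Om) x = 0.
Proof. by move=> nx; rewrite patchE memNset. Qed.

Lemma cut_in u x : Om x -> (u \_ Om) x = u x.
Proof. by move=> nx; rewrite patchE mem_set. Qed.

Lemma cut_id u : (forall x, ~ Om x -> u x = 0) -> u \_ Om = u.
Proof.
move=> u0; apply/funext => x; have [Ox|nx] := pselect (Om x); first exact: cut_in.
by rewrite cut_out// u0.
Qed.

Lemma cut_test phi : test_function Om phi -> phi \_ Om = phi.
Proof. by move=> tp; apply: cut_id => x; exact: test_function_notin. Qed.

Lemma cutB u v : (u \- v) \_ Om = (u \_ Om) - (v \_ Om).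
Proof.
apply/funext => x; rewrite [RHS](_ : _ = (u \_ Om) x - (v \_ Om) x)//.
have [Ox|nx] := pselect (Om x); first by rewrite !cut_in.
by rewrite !cut_out// subrr.
Qed.

Lemma cut_sum (F : 'I_n -> V -> R) :
  (fun x => \sum_i F i x) \_ Om = \sum_i (F i \_ Om).
Proof.
apply/funext => x; rewrite fct_sumE.
have [Ox|nx] := pselect (Om x).
  by rewrite cut_in//; apply: eq_bigr => i _; rewrite cut_in.
by rewrite cut_out// big1// => i _; rewrite cut_out.
Qed.

Lemma Lp2E u : Lp Om 2%:E u <-> L2 (u \_ Om).
Proof. exact: L2_Lfun. Qed.

Lemma integral_cut u v : \int[mu]_(x in Om) (u x * v x) = ip (u \_ Om) v.
Proof.
rewrite Rintegral_mkcond; apply: eq_Rintegral => x _.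
have [Ox|nx] := pselect (Om x); first by rewrite !cut_in.
by rewrite !cut_out// mul0r.
Qed.

Lemma integral_cut2 u : \int[mu]_(x in Om) (u x ^+ 2) = ip (u \_ Om) (u \_ Om).
Proof.
rewrite Rintegral_mkcond; apply: eq_Rintegral => x _.
have [Ox|nx] := pselect (Om x); first by rewrite !cut_in.
by rewrite !cut_out// mul0r.
Qed.

Lemma is_weak_partialE s u g : is_weak_partial Om s u g <->
  L2 (g \_ Om) /\ forall phi, test_function Om phi ->
    ip (u \_ Om) (partials s phi) = (-1) ^+ size s * ip (g \_ Om) phi.
Proof.
split=> -[Lg h]; split; try exact/Lp2E.
  by move=> phi tp; have := h phi tp; rewrite !integral_cut.
by move=> phi tp; rewrite !integral_cut; exact: h.
Qed.

Lemma weak_partial_unique s u g g' : is_weak_partial Om s u g -> is_weak_partial Om s u g' ->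
  g \_ Om = g' \_ Om %[ae mu].
Proof.
move=> /is_weak_partialE[Lg h] /is_weak_partialE[Lg' h'].
have : (g \_ Om - g' \_ Om) = 0 %[ae mu].
  apply: (@fundamental_lemma R n Om _ m) => //.
  - exact: L2B.
  - by move=> x nx; rewrite [LHS](_ : _ = (g \_ Om) x - (g' \_ Om) x)// !cut_out// subrr.
  - move=> phi tp; rewrite ipBl//; last exact: test_function_L2 tp.
    have := h phi tp; rewrite h'// => /(mulrI _) ->; last by rewrite unitrX ?unitrN1.
    by rewrite subrr.
apply: filterS => x /(_ I) H _; apply/eqP; rewrite -subr_eq0; apply/eqP.
exact: H.
Qed.

(** The representative selected by [weak_partial] is meaningful as soon as
    some weak derivative exists. *)
Lemma weak_partialP s u g : is_weak_partial Om s u g ->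
  is_weak_partial Om s u (weak_partial Om s u) /\
  (weak_partial Om s u) \_ Om = g \_ Om %[ae mu].
Proof.
move=> wg.
have H : is_weak_partial Om s u (weak_partial Om s u).
  by rewrite /weak_partial; case: xgetP => [y -> //|/(_ g)]; exact.
by split=> //; exact: weak_partial_unique H wg.
Qed.

Lemma test_weak_partial s phi : test_function Om phi ->
  is_weak_partial Om s phi (partials s phi).
Proof.
move=> tp; apply/is_weak_partialE; have tsp := test_function_partials s tp.
rewrite (cut_test tp) (cut_test tsp); split; first exact: test_function_L2 tsp.
by move=> psi tpsi; exact: ip_partials tp tpsi.
Qed.

Lemma weak_partialB s u g phi : L2 (u \_ Om) -> is_weak_partial Om s u g -> test_function Om phi ->
  is_weak_partial Om s (u \- phi) (g \- partials s phi).
Proof.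
move=> Lu /is_weak_partialE[Lg h] tp; have tsp := test_function_partials s tp.
apply/is_weak_partialE; rewrite !cutB (cut_test tp) (cut_test tsp).
have Lsp := test_function_L2 tsp; have Lp := test_function_L2 tp.
split; first exact: L2B.
move=> psi tpsi; have Lpsi := test_function_L2 tpsi.
have Lspsi := test_function_L2 (test_function_partials s tpsi).
rewrite (ipBl Lu Lp Lspsi) (ipBl Lg Lsp Lpsi) (h psi tpsi) (ip_partials s tp tpsi).
by rewrite mulrBr.
Qed.

Lemma weak_partial_test_ae s u g phi : L2 (u \_ Om) -> is_weak_partial Om s u g ->
  test_function Om phi ->
  ip ((weak_partial Om s (u \- phi)) \_ Om) ((weak_partial Om s (u \- phi)) \_ Om) =
  sqdist (g \_ Om) (partials s phi).
Proof.
move=> Lu wg tp; have tsp := test_function_partials s tp.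
have [w1 w2] := weak_partialP (weak_partialB Lu wg tp).
have [Lw _] := (is_weak_partialE _ _ _).1 w1.
move: w2; rewrite cutB (cut_test tsp) => w2.
have [Lg _] := (is_weak_partialE _ _ _).1 wg.
have Ld := L2B Lg (test_function_L2 tsp).
by rewrite (ae_eq_ip Lw.1 Ld.1 Lw.1 w2) ipC (ae_eq_ip Lw.1 Ld.1 Ld.1 w2).
Qed.

Lemma sqdist_ge0 u v : 0 <= sqdist u v.
Proof. exact: ip_ge0. Qed.

Lemma W22_norm_sq u phi : W22 Om u -> test_function Om phi ->
  W22_norm Om (u \- phi) ^+ 2 = sqdist (u \_ Om) phi
    + \sum_i sqdist ((weak_partial Om [:: i] u) \_ Om) (partials [:: i] phi)
    + \sum_i \sum_j sqdist ((weak_partial Om [:: i; j] u) \_ Om) (partials [:: i; j] phi).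
Proof.
move=> [/Lp2E Lu hw] tp.
have W s : (0 < size s <= 2)%N -> is_weak_partial Om s u (weak_partial Om s u).
  by move=> /hw[g wg]; exact: (weak_partialP wg).1.
rewrite /W22_norm sqr_sqrtr.
  congr (_ + _ + _).
  - by rewrite integral_cut2 cutB (cut_test tp).
  - by apply: eq_bigr => i _; rewrite integral_cut2 (weak_partial_test_ae Lu (W [:: i] _) tp).
  - apply: eq_bigr => i _; apply: eq_bigr => j _.
    by rewrite integral_cut2 (weak_partial_test_ae Lu (W [:: i; j] _) tp).
rewrite !addr_ge0//.
- by rewrite integral_cut2 ip_ge0.
- by apply: sumr_ge0 => i _; rewrite integral_cut2 ip_ge0.
- by apply: sumr_ge0 => i _; apply: sumr_ge0 => j _; rewrite integral_cut2 ip_ge0.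
Qed.

Lemma size12P s : (0 < size s <= 2)%N -> (exists i, s = [:: i]) \/ (exists i j, s = [:: i; j]).
Proof.
by case: s => [|i [|j [|k s]]]//= _; [left; exists i|right; exists i, j].
Qed.

Lemma sum3_le (A : R) (F : 'I_n -> R) (G : 'I_n -> 'I_n -> R) e : 0 <= A ->
  (forall i, 0 <= F i) -> (forall i j, 0 <= G i j) ->
  A + \sum_i F i + \sum_i \sum_j G i j <= e ->
  A <= e /\ (forall i, F i <= e) /\ (forall i j, G i j <= e).
Proof.
move=> A0 F0 G0 h.
have SF0 : 0 <= \sum_i F i by exact: sumr_ge0.
have SG0 : 0 <= \sum_i \sum_j G i j by apply: sumr_ge0 => i _; exact: sumr_ge0.
split; first by lra.
split=> [i|i j]; first by apply: le_trans (term_le_sum i F0) _; lra.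
by apply: le_trans (term_le_sum2 i j G0) _; lra.
Qed.

Lemma sqdist_ae u v w : L2 u -> L2 v -> L2 w -> u = v %[ae mu] -> sqdist u w = sqdist v w.
Proof.
move=> Lu Lv Lw uv; have L1 := L2B Lu Lw; have L2' := L2B Lv Lw.
have e : u - w = v - w %[ae mu].
  by move: uv; apply: filterS => x h t; rewrite /= [LHS](_ : _ = u x - w x)// (h t).
by rewrite /sqdist (ae_eq_ip L1.1 L2'.1 L1.1 e) ipC (ae_eq_ip L1.1 L2'.1 L2'.1 e).
Qed.

(** The norm in the definition of [W022] involves the weak derivatives of u -
    phi; up to null sets they are the differences of those of u and of phi. *)
Lemma W022_approx u : W022 Om u -> forall e, 0 < e -> exists phi, [/\ test_function Om phi,
  sqdist (u \_ Om) phi <= e &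
  forall s, (0 < size s <= 2)%N -> sqdist ((weak_partial Om s u) \_ Om) (partials s phi) <= e].
Proof.
move=> [Wu hu] e e0; have se0 : 0 < Num.sqrt e by rewrite sqrtr_gt0.
have [phi tp lt] := hu _ se0; exists phi.
have : W22_norm Om (u \- phi) ^+ 2 <= e.
  rewrite -(sqr_sqrtr (ltW e0)) lerXn2r// ?nnegrE ?sqrtr_ge0//; exact: ltW.
pose A := sqdist (u \_ Om) phi.
pose F i := sqdist ((weak_partial Om [:: i] u) \_ Om) (partials [:: i] phi).
pose G i j := sqdist ((weak_partial Om [:: i; j] u) \_ Om) (partials [:: i; j] phi).
rewrite (W22_norm_sq Wu tp) => h.
have {}h : A + \sum_i F i + \sum_i \sum_j G i j <= e by exact: h.
have [hA [hF hG]] := sum3_le (sqdist_ge0 _ _ : 0 <= A) (fun i => sqdist_ge0 _ _ : 0 <= F i)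
  (fun i j => sqdist_ge0 _ _ : 0 <= G i j) h.
split; [exact: tp|exact: hA|].
by move=> s /size12P[[i ->]|[i [j ->]]]; [exact: hF|exact: hG].
Qed.

Lemma ip_sum_le (F : 'I_n -> V -> R) e : (forall i, L2 (F i)) -> (forall i, ip (F i) (F i) <= e) ->
  ip (\sum_i F i) (\sum_i F i) <= 2 ^+ n * n%:R * e.
Proof.
move=> LF Fe.
have key (r : seq 'I_n) : ip (\sum_(i <- r) F i) (\sum_(i <- r) F i) <=
    2 ^+ size r * \sum_(i <- r) ip (F i) (F i).
  elim: r => [|i r IH]; first by rewrite !big_nil ip0l mulr0.
  rewrite !big_cons; apply: le_trans (ip_sqD_le _ _) _ => //; first exact: L2_sum.
  rewrite /= exprS -mulrA -mulrDr ler_wpM2l// mulrDr; apply: lerD => //.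
  by rewrite -[leLHS]mul1r ler_wpM2r ?ip_ge0// exprn_ege1// ler1n.
apply: le_trans (key _) _.
have -> : size (index_enum 'I_n) = n by rewrite -[RHS](card_ord n) cardT enumT.
rewrite -mulrA ler_wpM2l ?exprn_ge0//.
apply: (@le_trans _ _ (\sum_(i < n) e)); first by apply: ler_sum => i _.
by rewrite sumr_const card_ord mulr_natl.
Qed.

Lemma weak_laplacian_dist u phi e : W22 Om u -> test_function Om phi ->
  (forall s, (0 < size s <= 2)%N -> sqdist ((weak_partial Om s u) \_ Om) (partials s phi) <= e) ->
  L2 ((weak_laplacian Om u) \_ Om) /\
  sqdist ((weak_laplacian Om u) \_ Om) (laplacian phi) <= 2 ^+ n * n%:R * e.
Proof.
move=> [/Lp2E Lu hw] tp he.
have LW s : (0 < size s <= 2)%N -> L2 ((weak_partial Om s u) \_ Om).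
  by move=> /hw[g wg]; have [/is_weak_partialE[]] := weak_partialP wg.
have Lp s : L2 (partials s phi) by exact: test_function_L2 (test_function_partials s tp).
have E : (weak_laplacian Om u) \_ Om = \sum_i ((weak_partial Om [:: i; i] u) \_ Om).
  exact: cut_sum.
split; first by rewrite E; apply: L2_sum => i _; exact: LW.
have -> : sqdist ((weak_laplacian Om u) \_ Om) (laplacian phi) =
   ip (\sum_i ((weak_partial Om [:: i; i] u) \_ Om - partials [:: i; i] phi))
     (\sum_i ((weak_partial Om [:: i; i] u) \_ Om - partials [:: i; i] phi)).
  by rewrite /sqdist E laplacianE sumrB.
apply: ip_sum_le => i; first by apply: L2B; [exact: LW|exact: Lp].
exact: he.
Qed.

(** Weak differentiation is closed: when the derivatives of test functions
    converge in L2, their limits g s are the weak derivatives of the limit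
    function. *)
Lemma W022_intro u (g : seq 'I_n -> V -> R) : (forall s, L2 (g s)) ->
  (forall s x, ~ Om x -> g s x = 0) -> g [::] = u \_ Om ->
  (forall e, 0 < e -> exists2 phi, test_function Om phi &
     forall s, (size s <= 2)%N -> sqdist (g s) (partials s phi) <= e) ->
  W022 Om u /\ forall s, (0 < size s <= 2)%N -> is_weak_partial Om s u (g s).
Proof.
move=> Lg gO gu hg.
have wg s : (0 < size s <= 2)%N -> is_weak_partial Om s u (g s).
  move=> /andP[s0 s2]; apply/is_weak_partialE; rewrite (cut_id (gO s)); split=> // psi tpsi.
  have Lpsi := test_function_L2 tpsi.
  have Lspsi := test_function_L2 (test_function_partials s tpsi).
  rewrite -gu; apply/eqP; rewrite -subr_eq0; apply/eqP.
  set X := _ - _; pose B := ip (partials s psi) (partials s psi) + ip psi psi.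
  have B0 : 0 <= B by rewrite addr_ge0 ?ip_ge0.
  have XB e : 0 < e -> X ^+ 2 <= 2 * B * e.
    move=> e0; have [phi tp hp] := hg e e0.
    have Lp := test_function_L2 tp.
    have Lsp := test_function_L2 (test_function_partials s tp).
    pose a := ip (g [::] - phi) (partials s psi).
    pose b := ip (g s - partials s phi) psi.
    have a2 : a ^+ 2 <= e * ip (partials s psi) (partials s psi).
      apply: le_trans (ip_CS _ Lspsi) _; first exact: L2B.
      by rewrite ler_wpM2r ?ip_ge0//; exact: (hp [::]).
    have b2 : b ^+ 2 <= e * ip psi psi.
      apply: le_trans (ip_CS _ Lpsi) _; first exact: L2B.
      by rewrite ler_wpM2r ?ip_ge0//; exact: (hp s).
    have -> : X = a - (-1) ^+ size s * b.
      rewrite /X /a /b (ipBl (Lg [::]) Lp Lspsi) (ipBl (Lg s) Lsp Lpsi).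
      by rewrite (ip_partials s tp tpsi); ring.
    have : (a - (-1) ^+ size s * b) ^+ 2 <= 2 * (a ^+ 2 + b ^+ 2).
      have -> : (a - (-1) ^+ size s * b) ^+ 2 = 2 * (a ^+ 2 + ((-1) ^+ size s * b) ^+ 2)
         - (a + (-1) ^+ size s * b) ^+ 2 by ring.
      by rewrite exprMn sqrr_sign mul1r lerBlDr lerDl sqr_ge0.
    rewrite /B; move: a2 b2; lra.
  apply/eqP; rewrite -sqrf_eq0 eq_le sqr_ge0 andbT.
  apply/ler_addgt0Pl => e e0; rewrite addr0.
  have B1 : 0 < 2 * B + 1 by lra.
  have := XB (e / (2 * B + 1)) (divr_gt0 e0 B1).
  move=> /le_trans; apply; rewrite mulrA ler_pdivrMr// mulrC ler_wpM2l ?ltW//; lra.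
have Lu : L2 (u \_ Om) by rewrite -gu.
have Wu : W22 Om u.
  by split; [exact/Lp2E|move=> s hs; exists (g s); exact: wg].
split=> //; split=> // e e0; pose N : R := 1 + n%:R + n%:R * n%:R.
have N0 : 0 < N by rewrite /N !ltr_wpDr ?ler0n// mulr_ge0.
have e1 : 0 < e ^+ 2 / (2 * N) by rewrite divr_gt0 ?exprn_gt0// mulr_gt0.
have [phi tp hp] := hg _ e1; exists phi => //.
have dE s : (0 < size s <= 2)%N ->
    sqdist ((weak_partial Om s u) \_ Om) (partials s phi) = sqdist (g s) (partials s phi).
  move=> hs; have [w1 w2] := weak_partialP (wg s hs).
  have [Lw _] := (is_weak_partialE _ _ _).1 w1.
  apply: sqdist_ae => //; first exact: test_function_L2 (test_function_partials s tp).
  by rewrite -(cut_id (gO s)).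
have : W22_norm Om (u \- phi) ^+ 2 < e ^+ 2; last first.
  by rewrite ltr_pXn2r// nnegrE ?sqrtr_ge0 ?(ltW e0).
rewrite (W22_norm_sq Wu tp).
apply: (@le_lt_trans _ _ (N * (e ^+ 2 / (2 * N)))); last first.
  rewrite mulrA ltr_pdivrMr ?mulr_gt0//.
  have e2 : 0 < e ^+ 2 by rewrite exprn_gt0.
  by rewrite mulrC [ltRHS]mulrA ltr_pM2r//; lra.
move: (e ^+ 2 / (2 * N)) hp => E hp; rewrite /N !mulrDl mul1r; apply: lerD; first apply: lerD.
- by rewrite -gu; exact: (hp [::]).
- rewrite mulr_natl -[X in _ *+ X](card_ord n) -sumr_const; apply: ler_sum => i _.
  by rewrite (dE [:: i])//; exact: hp.
- rewrite -mulrA mulr_natl -[X in _ *+ X](card_ord n) -sumr_const; apply: ler_sum => i _.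
  rewrite mulr_natl -[X in _ *+ X](card_ord n) -sumr_const; apply: ler_sum => j _.
  by rewrite (dE [:: i; j])//; exact: hp.
Qed.

End weak_derivatives.

(** * Nonnegative weak solutions in terms of near minimizers *)

Section variational.
Context {R : realType} {n : nat}.
Local Notation V := 'rV[R]_n.
Local Notation mu := (@lebesgue_rV R n).
Local Notation ip := (ip mu).
Local Notation L2 := (L2 mu).
Implicit Types (f g u v phi psi eta : V -> R) (i j : 'I_n) (s : seq 'I_n).
Variables (Om : set V) (m : R).
Hypotheses (m0 : 0 < m) (oO : open Om) (Om_m : Om `<=` cube m).
Local Notation T := (test_function Om).

Definition neg_part u : V -> R := fun x => Num.max (- u x) 0.

Definition grad_ip phi psi := \sum_i ip (partial i phi) (partial i psi).

Lemma TL2 s phi : T phi -> L2 (partials s phi).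
Proof. by move=> tp; exact: test_function_L2 (test_function_partials s tp). Qed.

Lemma TL2lap phi : T phi -> L2 (laplacian phi).
Proof. by move=> tp; exact: test_function_L2 (test_function_laplacian tp). Qed.

Lemma laplacianD phi psi : T phi -> T psi -> laplacian (phi + psi) = laplacian phi + laplacian psi.
Proof.
move=> [sf _ _] [sg _ _]; apply/funext => x; rewrite /laplacian.
transitivity (\sum_i (partials [:: i; i] phi x + partials [:: i; i] psi x)).
  by apply: eq_bigr => i _; rewrite partialsD.
by rewrite big_split.
Qed.

Lemma laplacianZ c phi : T phi -> laplacian (c *: phi) = c *: laplacian phi.
Proof.
move=> [sf _ _]; apply/funext => x; rewrite /laplacian.
transitivity (\sum_i c * partials [:: i; i] phi x).
  by apply: eq_bigr => i _; rewrite partialsZ.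
by rewrite -mulr_sumr.
Qed.

Lemma lap_sqD phi psi : T phi -> T psi ->
  lap_sq (phi + psi) = lap_sq phi + 2 * ip (laplacian phi) (laplacian psi) + lap_sq psi.
Proof.
by move=> tf tg; rewrite /lap_sq laplacianD// ip_sqD//; exact: TL2lap.
Qed.

Lemma grad_sqD phi psi : T phi -> T psi ->
  grad_sq (phi + psi) = grad_sq phi + 2 * grad_ip phi psi + grad_sq psi.
Proof.
move=> tf tg; have [sf _ _] := tf; have [sg _ _] := tg.
rewrite /grad_sq /grad_ip mulr_sumr -!big_split/=; apply: eq_bigr => i _.
rewrite (partialD i sf sg).
by rewrite (ip_sqD (TL2 [:: i] tf) (TL2 [:: i] tg)).
Qed.

Lemma lap_sqZ c phi : T phi -> lap_sq (c *: phi) = c ^+ 2 * lap_sq phi.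
Proof.
move=> tf; have L := TL2lap tf.
by rewrite /lap_sq laplacianZ// (ipZl _ L (L2Z _ L)) (ipZr _ L L) mulrA expr2.
Qed.

Lemma grad_sqZ c phi : T phi -> grad_sq (c *: phi) = c ^+ 2 * grad_sq phi.
Proof.
move=> tf; have [sf _ _] := tf; rewrite /grad_sq mulr_sumr; apply: eq_bigr => i _.
have L := TL2 [:: i] tf.
by rewrite (partialZ c i sf) (ipZl _ L (L2Z _ L)) (ipZr _ L L) mulrA expr2.
Qed.

(** The Poincare inequality for the first derivatives, whose derivatives are
    controlled by the Laplacian through [hessian_lap]. *)
Lemma grad_le_lap phi : T phi -> grad_sq phi <= 4 * m ^+ 2 * lap_sq phi.
Proof.
move=> tp; rewrite -(hessian_lap tp) mulr_sumr; apply: ler_sum => j _.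
have tj := test_function_partial j tp.
apply: le_trans (poincare j tj m0 Om_m) _; apply: ler_wpM2l.
  by rewrite mulr_ge0// sqr_ge0.
apply: (@term_le_sum R n (fun k => ip (partials [:: j; k] phi) (partials [:: j; k] phi))) => k.
exact: ip_ge0.
Qed.

Lemma ip_le_lap (i0 : 'I_n) phi : T phi -> ip phi phi <= (4 * m ^+ 2) ^+ 2 * lap_sq phi.
Proof.
move=> tp; apply: le_trans (poincare i0 tp m0 Om_m) _; rewrite [(4 * _) ^+ 2]expr2 -[leRHS]mulrA.
have C0 : 0 <= 4 * m ^+ 2 by rewrite mulr_ge0// sqr_ge0.
apply: (ler_wpM2l C0).
exact: le_trans (grad_le_grad_sq phi i0) (grad_le_lap tp).
Qed.

Definition poincare_cst : R := 1 + 4 * m ^+ 2 + (4 * m ^+ 2) ^+ 2.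

Lemma poincare_cst_gt0 : 0 < poincare_cst.
Proof. by rewrite /poincare_cst -addrA ltr_pwDl// addr_ge0 ?sqr_ge0// mulr_ge0// sqr_ge0. Qed.

Lemma partials_le_lap (i0 : 'I_n) phi s : T phi -> (size s <= 2)%N ->
  ip (partials s phi) (partials s phi) <= poincare_cst * lap_sq phi.
Proof.
move=> tp s2; have L0 := lap_sq_ge0 phi.
have C0 : 0 <= 4 * m ^+ 2 by rewrite mulr_ge0// sqr_ge0.
have C1 : 0 <= (4 * m ^+ 2) ^+ 2 by rewrite sqr_ge0.
have KE : poincare_cst * lap_sq phi = lap_sq phi + 4 * m ^+ 2 * lap_sq phi + (4 * m ^+ 2) ^+ 2 * lap_sq phi.
  by rewrite /poincare_cst !mulrDl mul1r.
have H1 : 0 <= 4 * m ^+ 2 * lap_sq phi by exact: mulr_ge0.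
have H2 : 0 <= (4 * m ^+ 2) ^+ 2 * lap_sq phi by exact: mulr_ge0.
rewrite KE; case: s s2 => [|i [|j [|k s]]]//= _.
- apply: le_trans (ip_le_lap i0 tp) _; lra.
- apply: le_trans (grad_le_grad_sq phi i) _; apply: le_trans (grad_le_lap tp) _; lra.
- apply: le_trans (hessian_le_lap i j tp) _; lra.
Qed.

Lemma small_ip (a b : V -> R) t : L2 a -> L2 b -> 0 < t -> ip a a <= t ^+ 2 ->
  `|ip a b| <= t * (1 + ip b b).
Proof.
move=> La Lb t0 at2.
have t1 : 0 < t^-1 by rewrite invr_gt0.
have h1 := ip_young La Lb t1; have h2 := ip_young La (L2N Lb) t1.
rewrite (ipNr Lb La) (ipNl Lb (L2N Lb)) (ipNr Lb Lb) opprK in h2; rewrite invrK in h1 h2.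
have : t^-1 * ip a a <= t by rewrite ler_pdivrMl// -expr2.
have b0 := ip_ge0 mu b; have tb : 0 <= t * ip b b by rewrite mulr_ge0// ltW.
rewrite ler_norml mulrDr mulr1; lra.
Qed.

Lemma L2_neg_part u : L2 u -> L2 (neg_part u).
Proof.
move=> Lu; apply: (L2_le _ Lu).
  by apply: measurable_maxr; [apply: measurableT_comp => //; exact: Lu.1|exact: measurable_cst].
move=> x; rewrite /neg_part; case: (leP 0 (u x)) => [h|h].
  by rewrite max_r ?normr0// oppr_le0.
by rewrite max_l ?normrN// oppr_ge0 ltW.
Qed.

(** Pointwise, the negative part of phi is at most the distance of phi to any
    nonnegative value. *)
Lemma neg_part_le u phi : L2 u -> L2 phi -> {ae mu, forall x, 0 <= u x} ->
  ip (neg_part phi) (neg_part phi) <= sqdist u phi.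
Proof.
move=> Lu Lp u0; pose v : V -> R := fun x => Num.max (u x) 0.
have mv : measurable_fun setT v.
  by apply: measurable_maxr; [exact: Lu.1|exact: measurable_cst].
have uv : u = v %[ae mu].
  by move: u0; apply: filterS => x h _; rewrite /v max_l.
have Lv := L2_ae_eq Lu mv uv.
rewrite (sqdist_ae Lu Lv Lp uv) /sqdist; apply: le_ip.
- exact: L2_neg_part.
- exact: L2B.
move=> x; rewrite [(v - phi) x](_ : _ = v x - phi x)// /neg_part /v.
case: (leP 0 (phi x)) => h.
  by rewrite max_r ?oppr_le0// normr0.
rewrite max_l ?oppr_ge0 ?(ltW h)// gtr0_norm ?oppr_gt0//.
by apply: le_trans (ler_norm _); rewrite lerDr le_max lexx orbT.
Qed.

Lemma neg_part_le2 u phi : L2 u -> L2 phi ->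
  ip (neg_part u) (neg_part u) <= 2 * sqdist u phi + 2 * ip (neg_part phi) (neg_part phi).
Proof.
move=> Lu Lp; have Ld := L2B Lu Lp; have Ln := L2_neg_part Lp.
pose a : V -> R := fun x => `|(u - phi) x|.
have La : L2 a.
  apply: (L2_le _ Ld); last by move=> x; rewrite /a normr_id.
  by apply: measurableT_comp => //; exact: Ld.1.
have aE : ip a a <= sqdist u phi by apply: le_ip => // x; rewrite /a normr_id.
apply: (@le_trans _ _ (ip (a + neg_part phi) (a + neg_part phi))).
  apply: le_ip; [exact: L2_neg_part|exact: L2D|] => x.
  rewrite [(a + _) x](_ : _ = `|u x - phi x| + neg_part phi x)//.
  have n0 w : 0 <= neg_part w x by rewrite /neg_part le_max lexx orbT.
  rewrite (ger0_norm (n0 u)) (ger0_norm (addr_ge0 (normr_ge0 _) (n0 phi))).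
  have h1 : - phi x <= neg_part phi x by rewrite /neg_part le_max lexx.
  have h2 := n0 phi; have h3 : phi x - u x <= `|u x - phi x| by rewrite distrC ler_norm.
  have h4 := normr_ge0 (u x - phi x).
  move: h1 h2; move: (neg_part phi x) => np h1 h2.
  rewrite /neg_part ge_max; apply/andP; split; last exact: addr_ge0.
  by have -> : - u x = (phi x - u x) + - phi x; [rewrite addrAC subrr add0r|exact: lerD].
by apply: le_trans (ip_sqD_le La Ln) _; rewrite lerD2r ler_wpM2l.
Qed.

Definition wcut s u := (weak_partial Om s u) \_ Om.
Definition wlap u := (weak_laplacian Om u) \_ Om.

Lemma L2_wcut u s : W22 Om u -> (0 < size s <= 2)%N -> L2 (wcut s u).
Proof.
move=> [_ hw] hs; have [g wg] := hw s hs.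
by have [/is_weak_partialE[]] := weak_partialP oO Om_m wg.
Qed.

Lemma L2_wlap u : W22 Om u -> L2 (wlap u).
Proof.
move=> Wu; have -> : wlap u = \sum_i wcut [:: i; i] u by exact: cut_sum.
by apply: L2_sum => i _; exact: L2_wcut.
Qed.

Section with_data.
Variables (F : V -> R) (gam : R).
Hypothesis LF : L2 F.
Local Notation E := (energy F gam).

(** The derivative of the energy at phi in the direction psi. *)
Definition first_var phi psi :=
  ip (laplacian phi) (laplacian psi) + gam * grad_ip phi psi - ip F psi.

Definition quad phi := lap_sq phi + gam * grad_sq phi.

Lemma energyD phi psi : T phi -> T psi -> E (phi + psi) = E phi + first_var phi psi + quad psi / 2.
Proof.
move=> tf tg; rewrite /energy /first_var /quad lap_sqD// grad_sqD//.
rewrite (ipDr (test_function_L2 tf) (test_function_L2 tg) LF).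
have arith (A X A' G Y G' a b : R) : (A + 2 * X + A' + gam * (G + 2 * Y + G')) / 2 - (a + b) =
    (A + gam * G) / 2 - a + (X + gam * Y - b) + (A' + gam * G') / 2 by field.
exact: arith.
Qed.

Lemma first_varZ c phi psi : T phi -> T psi -> first_var phi (c *: psi) = c * first_var phi psi.
Proof.
move=> tf tg; have [sg _ _] := tg.
rewrite /first_var laplacianZ// (ipZr _ (TL2lap tg) (TL2lap tf)) (ipZr _ (test_function_L2 tg) LF).
suff -> : grad_ip phi (c *: psi) = c * grad_ip phi psi.
  by rewrite mulrBr mulrDr (mulrCA c gam).
rewrite /grad_ip mulr_sumr; apply: eq_bigr => i _.
by rewrite (partialZ c i sg) (ipZr _ (TL2 [:: i] tg) (TL2 [:: i] tf)).
Qed.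

Lemma quadZ c phi : T phi -> quad (c *: phi) = c ^+ 2 * quad phi.
Proof. by move=> tf; rewrite /quad lap_sqZ// grad_sqZ// mulrDr (mulrCA gam). Qed.

Definition near_min e phi := T phi /\ forall psi, T psi -> E phi <= E psi + e.

Definition coercive c := 0 < c /\ forall phi, T phi -> c * lap_sq phi <= quad phi.

(** Compares phi with phi - t L psi, where L is the first variation and t is
    the inverse of quad psi + 1, a step for which the quadratic term takes
    back at most half of the gain. *)
Lemma near_min_first_var c e phi psi : coercive c -> near_min e phi -> T psi -> 0 <= e ->
  first_var phi psi ^+ 2 <= 2 * (quad psi + 1) * e.
Proof.
move=> [c0 hc] [tp hp] tq e0.
have Q0 : 0 <= quad psi by apply: le_trans (hc _ tq); rewrite mulr_ge0 ?lap_sq_ge0// ltW.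
pose t := (quad psi + 1)^-1; pose L := first_var phi psi.
have t0 : 0 < t by rewrite invr_gt0; lra.
have := hp _ (test_functionD tp (test_functionZ (- (t * L)) tq)).
rewrite (energyD tp (test_functionZ _ tq)) first_varZ// quadZ// -/L => h.
have tQ : t * (quad psi + 1) = 1 by rewrite mulVf// gt_eqF//; lra.
have h2 : L ^+ 2 * t <= 2 * e.
  have : L ^+ 2 * t * (t * (quad psi)) <= L ^+ 2 * t.
    apply: ler_piMr; first by rewrite mulr_ge0 ?sqr_ge0// ltW.
    by rewrite -[leRHS]tQ; apply: ler_wpM2l; [exact: ltW|lra].
  have -> : L ^+ 2 * t * (t * quad psi) = (- (t * L)) ^+ 2 * quad psi by ring.
  have E1 : - (t * L) * L = - (L ^+ 2 * t) by ring.
  rewrite E1 in h; lra.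
have : L ^+ 2 = L ^+ 2 * t * (quad psi + 1) by rewrite -mulrA tQ mulr1.
move=> ->; rewrite [leRHS]mulrAC ler_wpM2r//; lra.
Qed.

(** The parallelogram identity: the energy of the midpoint is smaller than the
    mean of the two energies by an eighth of the quadratic form of the
    difference. *)
Lemma near_min_dist c e phi psi : coercive c -> near_min e phi -> near_min e psi ->
  lap_sq (psi - phi) <= 8 / c * e.
Proof.
move=> [c0 hc] [tp hp] [tq hq].
have td := test_functionB tq tp.
have tm := test_functionD tp (test_functionZ (2^-1) td).
have h1 := hp _ tm; have h2 := hq _ tm.
have E2 := energyD tp td; rewrite addrC subrK in E2.
rewrite (energyD tp (test_functionZ _ td)) first_varZ// quadZ// in h1 h2.
have := hc _ td; move: h1 h2 E2; move: (E phi) (E psi) (first_var _ _) (quad _) (lap_sq _) => a b L Q l.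
move=> h1 h2 E2 hl.
have : Q <= 8 * e by lra.
by move=> hQ; rewrite mulrAC ler_pdivlMr// mulrC; lra.
Qed.

(** The extension of [first_var] from test functions to a function u of the
    Sobolev space. *)
Definition weak_form u psi :=
  ip (wlap u) (laplacian psi) + gam * (\sum_i ip (wcut [:: i] u) (partial i psi)) - ip F psi.

Lemma integral_weak_form f u psi : (forall x, Om x -> F x = f x) -> W22 Om u -> T psi ->
  \int[mu]_(x in Om)
      (weak_laplacian Om u x * laplacian psi x
       + gam * (\sum_i weak_partial Om [:: i] u x * partial i psi x)
       - f x * psi x) = weak_form u psi.
Proof.
move=> Ff Wu tp; rewrite Rintegral_mkcond.
have L1 := integrable_ip (L2_wlap Wu) (TL2lap tp).
have L2i i := integrable_ip (L2_wcut (s := [:: i]) Wu isT) (TL2 [:: i] tp).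
have L3 := integrable_ip LF (TL2 [::] tp).
have Ls := integrable_Rsum (index_enum 'I_n) L2i.
have Li : mu.-integrable setT (EFin \o (fun x => gam * (\sum_i wcut [:: i] u x * partial i psi x))).
  pose S x := \sum_i (wcut [:: i] u x * partial i psi x).
  rewrite (_ : EFin \o _ = (fun x => gam%:E * (EFin \o S) x)%E).
    exact: integrableZl.
  by apply/funext => x /=; rewrite EFinM.
have L12 : mu.-integrable setT (EFin \o (fun x => wlap u x * laplacian psi x +
    gam * (\sum_i wcut [:: i] u x * partial i psi x))).
  rewrite (_ : EFin \o _ = (EFin \o (fun x => wlap u x * laplacian psi x)) \+
    (EFin \o (fun x => gam * (\sum_i wcut [:: i] u x * partial i psi x)))).
    exact: integrableD.
  by apply/funext => x.
transitivity (\int[mu]_x ((wlap u x * laplacian psi x +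
    gam * (\sum_i wcut [:: i] u x * partial i psi x)) - F x * psi x)).
  apply: eq_Rintegral => x _; have [Ox|nx] := pselect (Om x).
    rewrite cut_in// /wlap cut_in// Ff//; congr (_ + _ * _ - _).
    by apply: eq_bigr => i _; rewrite /wcut cut_in.
  rewrite cut_out// /wlap cut_out// (test_function_notin tp nx) mul0r mulr0 subr0.
  by rewrite big1 ?mulr0 ?addr0// => i _; rewrite /wcut cut_out// mul0r.
rewrite (RintegralB measurableT L12 L3) (RintegralD measurableT L1 Li).
by rewrite (RintegralZl gam measurableT Ls) (Rintegral_sum _ L2i).
Qed.

(** The test function phi approximates u with all its derivatives of order one
    and two; the denominator in the precision compensates for the n second
    derivatives summed up in the Laplacian. *)
Lemma close_first_var u phi psi t : W22 Om u -> T phi -> T psi -> 0 < t ->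
  (forall s, (0 < size s <= 2)%N ->
     sqdist (wcut s u) (partials s phi) <= t ^+ 2 / (2 ^+ n * n%:R + 1)) ->
  `|weak_form u psi - first_var phi psi| <=
    t * ((1 + lap_sq psi) + `|gam| * (n%:R + grad_sq psi)).
Proof.
move=> Wu tp tq t0 hd.
have N1 : 0 < 2 ^+ n * n%:R + 1 :> R by rewrite ltr_wpDl// mulr_ge0.
have t2 : 0 <= t ^+ 2 by rewrite sqr_ge0.
have [Lw dl] := weak_laplacian_dist oO Om_m Wu tp hd.
have Lwi i : L2 (wcut [:: i] u) by exact: L2_wcut.
have Lp := TL2lap tp; have Lq := TL2lap tq.
have Lpi i := TL2 [:: i] tp; have Lqi i := TL2 [:: i] tq.
have dl' : ip (wlap u - laplacian phi) (wlap u - laplacian phi) <= t ^+ 2.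
  apply: le_trans dl _; rewrite mulrA ler_pdivrMr// mulrC ler_wpM2l//; lra.
have di i : ip (wcut [:: i] u - partial i phi) (wcut [:: i] u - partial i phi) <= t ^+ 2.
  apply: le_trans (hd [:: i] isT) _; rewrite ler_pdivrMr// ler_peMr//.
  by rewrite lerDr mulr_ge0.
have h1 := small_ip (L2B Lw Lp) Lq t0 dl'.
have h2 i := small_ip (L2B (Lwi i) (Lpi i)) (Lqi i) t0 (di i).
have -> : weak_form u psi - first_var phi psi =
  ip (wlap u - laplacian phi) (laplacian psi) +
  gam * \sum_i ip (wcut [:: i] u - partial i phi) (partial i psi).
  rewrite /weak_form /first_var /grad_ip (ipBl Lw Lp Lq).
  have -> : \sum_i ip (wcut [:: i] u - partial i phi) (partial i psi) =
    \sum_i ip (wcut [:: i] u) (partial i psi) - \sum_i ip (partial i phi) (partial i psi).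
    by rewrite -sumrB; apply: eq_bigr => i _; exact: (ipBl (Lwi i) (Lpi i) (Lqi i)).
  have arith (a b c d e : R) : a + gam * b - c - (d + gam * e - c) = a - d + gam * (b - e) by ring.
  exact: arith.
rewrite mulrDr; apply: le_trans (ler_normD _ _) _; apply: lerD; first exact: h1.
rewrite normrM mulrCA; apply: ler_wpM2l => //.
apply: le_trans (ler_norm_sum _ _ _) _.
apply: le_trans (ler_sum _ (fun i _ => h2 i)) _.
by rewrite -mulr_sumr big_split/= sumr_const card_ord.
Qed.

(** A test function phi near the solution has an almost vanishing first
    variation, so that passing from phi to psi changes the energy by half the
    quadratic form of psi - phi up to a small error, which coercivity absorbs. *)
Lemma weak_solution_near_min (i0 : 'I_n) f u c e : (forall x, Om x -> F x = f x) ->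
  coercive c -> weak_solution Om f gam u ->
  {ae mu, forall x, Om x -> 0 <= u x} -> 0 < e ->
  exists phi, near_min e phi /\ ip (neg_part phi) (neg_part phi) <= e.
Proof.
move=> Ff [c0 hc] [Wu0 hu] u0 e0; have [Wu _] := Wu0.
pose A := 1 + `|gam| * n%:R; pose B := 1 + `|gam| * (4 * m ^+ 2).
have C0 : 0 <= 4 * m ^+ 2 by rewrite mulr_ge0// sqr_ge0.
have A0 : 0 < A by rewrite ltr_pwDl// mulr_ge0.
have B0 : 0 < B by rewrite ltr_pwDl// mulr_ge0.
(* For this precision the error bound t * A + t * B * lap_sq below is at most
   e + c / 2 * lap_sq. *)
pose t := Num.min (e / A) (Num.min (c / 2 / B) (Num.min 1 e)).
have t0 : 0 < t by rewrite !lt_min !divr_gt0//= ltr01.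
have [tA [tB [t1 te]]] : t <= e / A /\ t <= c / 2 / B /\ t <= 1 /\ t <= e.
  by rewrite /t !ge_min !lexx !orbT.
pose N : R := 2 ^+ n * n%:R + 1.
have N1 : 1 <= N by rewrite lerDr mulr_ge0.
have N0 : 0 < N by exact: lt_le_trans N1.
have d0 : 0 < t ^+ 2 / N by rewrite divr_gt0// exprn_gt0.
have [phi [tp dp hd]] := W022_approx oO Om_m Wu0 d0.
exists phi; split; last first.
  apply: le_trans (_ : sqdist (u \_ Om) phi <= _); last first.
    apply: le_trans dp _; rewrite ler_pdivrMr//.
    apply: (@le_trans _ _ (t * 1)); first by rewrite expr2 ler_wpM2l// ltW.
    by rewrite mulr1; apply: le_trans te _; rewrite ler_peMr// ltW.
  have [/Lp2E Lu _] := Wu.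
  apply: neg_part_le => //; first exact: test_function_L2 tp.
  move: u0; apply: filterS => x h; have [Ox|nx] := pselect (Om x).
    by rewrite cut_in// h.
  by rewrite cut_out.
split=> // psi tq.
have th := test_functionB tq tp.
have E2 := energyD tp th; rewrite addrC subrK in E2.
have L0 := lap_sq_ge0 (psi - phi).
have G := grad_le_lap th.
have w0 : weak_form u (psi - phi) = 0 by rewrite -(integral_weak_form Ff Wu th) hu.
have := close_first_var Wu tp th t0 hd; rewrite w0 sub0r normrN => cl.
have cl2 : `|first_var phi (psi - phi)| <= t * A + t * B * lap_sq (psi - phi).
  apply: le_trans cl _; rewrite -mulrA -mulrDr; apply: (ler_wpM2l (ltW t0)).
  have : `|gam| * grad_sq (psi - phi) <= `|gam| * (4 * m ^+ 2 * lap_sq (psi - phi)).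
    exact: ler_wpM2l.
  by rewrite /A /B; lra.
have hq := hc _ th.
have tA' : t * A <= e by rewrite -ler_pdivlMr.
have tB' : t * B <= c / 2 by rewrite -ler_pdivlMr.
have tBl : t * B * lap_sq (psi - phi) <= c / 2 * lap_sq (psi - phi) by exact: ler_wpM2r.
have low := lerNnormlW cl2.
have arith (a b L Q x l y : R) : a = b + L + Q / 2 -> c * l <= Q -> y <= e ->
    x <= c / 2 * l -> - (y + x) <= L -> b <= a + e by lra.
exact: (arith _ _ _ _ _ _ _ E2 hq tA' tBl low).
Qed.

(** Near minimizers of increasing precision are a Cauchy sequence for all
    derivatives of order at most two, by [near_min_dist]; the first variation
    and the negative part of their limit vanish. *)
Lemma near_min_weak_solution (i0 : 'I_n) f c : (forall x, Om x -> F x = f x) ->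
  coercive c ->
  (forall e, 0 < e -> exists phi, near_min e phi /\ ip (neg_part phi) (neg_part phi) <= e) ->
  nonneg_solution Om f gam.
Proof.
move=> Ff Hc hP; have [c0 hc] := Hc; have K0 := poincare_cst_gt0.
have ek k : 0 < k.+1%:R^-1 :> R by rewrite invr_gt0.
pose phi k := sval (cid (hP _ (ek k))).
have phiP k : near_min k.+1%:R^-1 (phi k) /\
  ip (neg_part (phi k)) (neg_part (phi k)) <= k.+1%:R^-1 := svalP (cid (hP _ (ek k))).
have Tphi k : T (phi k) by have [[]] := phiP k.
have small e : 0 < e -> exists N, forall k, (N <= k)%N -> near_min e (phi k) /\
    ip (neg_part (phi k)) (neg_part (phi k)) <= e.
  move=> e0; exists (Num.truncn e^-1) => k Nk.
  have ke : k.+1%:R^-1 <= e.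
    rewrite invf_ple ?posrE//; apply: ltW.
    have e1 : 0 <= e^-1 by rewrite invr_ge0 ltW.
    have /andP[_ h] := truncn_itv e1.
    by apply: lt_le_trans h _; rewrite ler_nat.
  have [[tp hp] hn] := phiP k; split; last exact: le_trans hn ke.
  by split=> // psi tq; apply: le_trans (hp _ tq) _; rewrite lerD2l.
have cauchy e : 0 < e -> exists N, forall k l, (N <= k)%N -> (N <= l)%N ->
    forall s, (size s <= 2)%N -> sqdist (partials s (phi k)) (partials s (phi l)) <= e.
  move=> e0; have d0 : 0 < e / (poincare_cst * (8 / c)) by rewrite divr_gt0// mulr_gt0// divr_gt0.
  have [N hN] := small _ d0; exists N => k l Nk Nl s s2.
  have [hk _] := hN k Nk; have [hl _] := hN l Nl.
  have td := test_functionB (Tphi k) (Tphi l).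
  have [sk _ _] := Tphi k; have [sl _ _] := Tphi l.
  rewrite /sqdist -(@partialsB R n (phi k) (phi l) s sk sl).
  apply: le_trans (partials_le_lap i0 td s2) _.
  apply: le_trans (ler_wpM2l (ltW K0) (near_min_dist Hc hl hk)) _.
  by rewrite mulrA mulrC divfK// mulf_neq0 ?gt_eqF// divr_gt0.
have exg s : exists h : V -> R, [/\ L2 h, forall x, ~ Om x -> h x = 0 & (size s <= 2)%N ->
    forall e, 0 < e -> exists N, forall k, (N <= k)%N -> sqdist h (partials s (phi k)) <= e].
  have [s2|s2] := leqP (size s) 2; last by exists 0; split=> //; exact: L20.
  have [|h0 Lh0 hh0] := @L2_complete _ _ _ mu (fun k => partials s (phi k))
     (fun k => TL2 s (Tphi k)).
    by move=> e /cauchy[N hN]; exists N => k l Nk Nl; exact: hN.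
  have mO : measurable Om by exact: open_rV_measurable.
  have Lh : L2 (h0 \_ Om).
    apply: (L2_le _ Lh0).
      by apply/(measurable_restrictT _ mO); apply: measurable_funTS; exact: Lh0.1.
    by move=> x; rewrite patchE; case: ifP => // _; rewrite normr0.
  exists (h0 \_ Om); split=> //; first by move=> x; exact: cut_out.
  move=> _ e e0; have [N hN] := hh0 e e0; exists N => k Nk.
  apply: le_trans (hN k Nk); apply: le_ip.
  - by apply: L2B => //; exact: TL2.
  - by apply: L2B => //; exact: TL2.
  move=> x; rewrite [(h0 \_ Om - _) x](_ : _ = (h0 \_ Om) x - partials s (phi k) x)//.
  rewrite [(h0 - _) x](_ : _ = h0 x - partials s (phi k) x)//.
  have [Ox|nx] := pselect (Om x); first by rewrite cut_in.
  rewrite cut_out// (test_function_notin (test_function_partials s (Tphi k)) nx).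
  by rewrite subrr normr0.
have [g hg] := choice exg.
have Lg s : L2 (g s) by have [] := hg s.
have gO s : forall x, ~ Om x -> g s x = 0 by have [] := hg s.
have unif e : 0 < e -> exists N, forall k, (N <= k)%N -> forall s, (size s <= 2)%N ->
    sqdist (g s) (partials s (phi k)) <= e.
  move=> e0; have e4 : 0 < e / 4 by rewrite divr_gt0.
  have [N hN] := cauchy _ e4; exists N => k Nk s s2.
  have [_ _ /(_ s2 _ e4)[M hM]] := hg s.
  have h1 := hM (maxn N M) (leq_maxr _ _).
  have h2 := hN (maxn N M) k (leq_maxl _ _) Nk s s2.
  have E3 : g s - partials s (phi k) =
     (g s - partials s (phi (maxn N M))) + (partials s (phi (maxn N M)) - partials s (phi k)).
    by rewrite addrA subrK.
  rewrite /sqdist E3.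
  have L1 := L2B (Lg s) (TL2 s (Tphi (maxn N M))).
  have L2' := L2B (TL2 s (Tphi (maxn N M))) (TL2 s (Tphi k)).
  apply: le_trans (ip_sqD_le L1 L2') _.
  have arith (a b : R) : a <= e / 4 -> b <= e / 4 -> 2 * a + 2 * b <= e by lra.
  exact: arith.
pose u := g [::].
have uE : u \_ Om = u by exact: cut_id (gO _).
have happ : forall e, 0 < e -> exists2 psi, T psi &
     forall s, (size s <= 2)%N -> sqdist (g s) (partials s psi) <= e.
  by move=> e /unif[N hN]; exists (phi N) => //; exact: hN.
have [W0 wg] := @W022_intro R n Om m oO Om_m u g Lg gO (esym uE) happ.
have [Wu _] := W0.
have dE s psi : (0 < size s <= 2)%N -> L2 psi -> sqdist (wcut s u) psi = sqdist (g s) psi.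
  move=> hs Lpsi; have [w1 w2] := weak_partialP oO Om_m (wg s hs).
  apply: sqdist_ae => //; first exact: L2_wcut.
  by rewrite -(cut_id (gO s)).
exists u; last first.
  have nu0 : ip (neg_part u) (neg_part u) = 0.
    apply/eqP; rewrite eq_le ip_ge0 andbT; apply/ler_addgt0Pl => e e0; rewrite addr0.
    have e4 : 0 < e / 4 by rewrite divr_gt0.
    have [N hN] := unif _ e4; have [M hM] := small _ e4.
    have h1 := hN (maxn N M) (leq_maxl _ _) [::] isT.
    have [_ h2] := hM (maxn N M) (leq_maxr _ _).
    apply: le_trans (neg_part_le2 (Lg [::]) (TL2 [::] (Tphi (maxn N M)))) _.
    have arith (a b : R) : a <= e / 4 -> b <= e / 4 -> 2 * a + 2 * b <= e by lra.
    exact: arith.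
  have := ip_eq0_ae (L2_neg_part (Lg [::])) nu0.
  apply: filterS => x /(_ I) h _.
  have h0 : neg_part u x = 0 by exact: h.
  have h1 : - u x <= neg_part u x by rewrite /neg_part le_max lexx.
  by rewrite -oppr_le0 -h0.
split=> // psi tq; rewrite (integral_weak_form Ff Wu tq).
pose Q := (1 + lap_sq psi) + `|gam| * (n%:R + grad_sq psi).
pose P := 2 * (quad psi + 1).
have quad0 : 0 <= quad psi by apply: le_trans (hc _ tq); rewrite mulr_ge0 ?lap_sq_ge0// ltW.
have P1 : 1 <= P by rewrite /P; lra.
have Q0 : 0 < Q.
  by rewrite ltr_pwDl ?ltr_pwDl ?lap_sq_ge0// mulr_ge0// addr_ge0// grad_sq_ge0.
have bound t : 0 < t -> `|weak_form u psi| <= t * (Q + P).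
  move=> t0; have t2 : 0 < t ^+ 2 by rewrite exprn_gt0.
  have N1 : 0 < 2 ^+ n * n%:R + 1 :> R by rewrite ltr_wpDl// mulr_ge0.
  have [N hN] := unif _ (divr_gt0 t2 N1); have [M hM] := small _ t2.
  pose k := maxn N M.
  have [hk _] := hM k (leq_maxr _ _).
  have cl := close_first_var Wu (Tphi k) tq t0 (phi := phi k).
  have {}cl := cl (fun s hs => ltac:(rewrite dE//; [apply: hN => //; [exact: leq_maxl|by case/andP: hs]|exact: TL2])).
  have fv := near_min_first_var Hc hk tq (ltW t2).
  have fv' : `|first_var (phi k) psi| <= t * P.
    have tP : 0 <= t * P by rewrite mulr_ge0 ?ltW//; lra.
    rewrite -(@ler_pXn2r _ 2)// ?nnegrE// real_normK ?num_real//.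
    apply: le_trans fv _; rewrite -/P exprMn [leLHS]mulrC; apply: ler_wpM2l; first exact: ltW.
    by rewrite expr2; apply: ler_peMr => //; lra.
  rewrite mulrDr -[weak_form u psi](subrK (first_var (phi k) psi)).
  by apply: le_trans (ler_normD _ _) _; apply: lerD.
apply/eqP; rewrite -normr_le0; apply/ler_addgt0Pl => e e0; rewrite addr0.
have QP : 0 < Q + P by lra.
by apply: le_trans (bound _ (divr_gt0 e0 QP)) _; rewrite divfK// gt_eqF.
Qed.

End with_data.
End variational.

(** * The buckling load in terms of test functions *)

Section buckling.
Context {R : realType} {n : nat}.
Local Notation V := 'rV[R]_n.
Local Notation mu := (@lebesgue_rV R n).
Local Notation ip := (ip mu).
Local Notation L2 := (L2 mu).
Implicit Types (f g u v phi psi : V -> R) (i j : 'I_n) (s : seq 'I_n).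

Lemma le_of_forall_small (X Y K : R) :
  (forall t, 0 < t -> t <= 1 -> X <= Y + t * K) -> X <= Y.
Proof.
move=> h; apply/ler_addgt0Pl => e e0; rewrite addrC.
pose t := Num.min 1 (e / (`|K| + 1)).
have K1 : 0 < `|K| + 1 by rewrite ltr_wpDl.
have t0 : 0 < t by rewrite lt_min ltr01 divr_gt0.
apply: le_trans (h t t0 _) _; first by rewrite ge_min lexx.
rewrite lerD2l; apply: (@le_trans _ _ (t * (`|K| + 1))).
  by apply: (ler_wpM2l (ltW t0)); apply: le_trans (ler_norm K) _; rewrite lerDl.
by rewrite -ler_pdivlMr// ge_min lexx orbT.
Qed.

(** A bound with factor and summand close to 1 and 0, convenient because it
    can be applied to u and phi in both orders. *)
Lemma ip_close (a b : V -> R) t : L2 a -> L2 b -> 0 < t -> t <= 1 ->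
  sqdist a b <= t ^+ 2 -> ip a a <= (1 + t) * ip b b + 2 * t.
Proof.
move=> La Lb t0 t1; rewrite /sqdist => h; have Ld := L2B La Lb.
have -> : ip a a = ip (a - b + b) (a - b + b) by rewrite subrK.
rewrite (ip_sqD Ld Lb).
have := ip_young (e := t^-1) Ld Lb; rewrite invr_gt0 => /(_ t0); rewrite invrK.
have h2 : t^-1 * ip (a - b) (a - b) <= t by rewrite ler_pdivrMl// -expr2.
have h3 : t ^+ 2 <= t by rewrite expr2 ler_piMr// ltW.
move: h h2; move: (ip (a - b) (a - b)) (ip (a - b) b) (ip b b) => x y z h h2.
rewrite mulrDl mul1r; lra.
Qed.

Lemma sqdistC (a b : V -> R) : sqdist a b = sqdist b a.
Proof.
apply: eq_Rintegral => x _.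
rewrite [(a - b) x](_ : _ = a x - b x)// [(b - a) x](_ : _ = b x - a x)//; ring.
Qed.

Variables (Om : set V) (m : R).
Hypotheses (m0 : 0 < m) (oO : open Om) (Om_m : Om `<=` cube m).
Local Notation T := (test_function Om).

(** The lower bound lam for the buckling load, tested on test functions only. *)
Definition rayleigh_ge (lam : R) := forall phi, T phi -> lam * grad_sq phi <= lap_sq phi.

Lemma wcut_test s phi psi : (0 < size s <= 2)%N -> T phi -> L2 psi ->
  ip (wcut Om s phi) psi = ip (partials s phi) psi.
Proof.
move=> hs tp Lpsi.
have tsp := test_function_partials s tp.
have wp := test_weak_partial s tp.
have [w1 w2] := weak_partialP oO Om_m wp.
have [Lw _] := (is_weak_partialE _ _ _ _).1 w1.
rewrite (cut_test tsp) in w2.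
by rewrite (ae_eq_ip Lw.1 (test_function_L2 tsp).1 Lpsi.1 w2).
Qed.

Lemma test_W022 phi : T phi -> W022 Om phi.
Proof.
move=> tp.
have := @W022_intro R n Om m oO Om_m phi (fun s => partials s phi)
  (fun s => TL2 s tp) (fun s x => test_function_notin (test_function_partials s tp))
  (esym (cut_test tp)).
case=> // e e0; exists phi => // s _.
by rewrite /sqdist subrr ip0l ltW.
Qed.

Definition wgrad_sq u := \sum_i ip (wcut Om [:: i] u) (wcut Om [:: i] u).

Lemma buckling_quotientE u : W22 Om u ->
  buckling_quotient Om u = ip (wlap Om u) (wlap Om u) / wgrad_sq u.
Proof.
move=> Wu; rewrite /buckling_quotient integral_cut2; congr (_ / _).
rewrite Rintegral_mkcond /wgrad_sq.
have Li i := integrable_ip (L2_wcut oO Om_m (s := [:: i]) Wu isT) (L2_wcut oO Om_m (s := [:: i]) Wu isT).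
rewrite -(Rintegral_sum _ Li); apply: eq_Rintegral => x _.
have [Ox|nx] := pselect (Om x).
  by rewrite cut_in//; apply: eq_bigr => i _; rewrite /wcut cut_in.
by rewrite cut_out// big1// => i _; rewrite /wcut cut_out// mul0r.
Qed.

Lemma test_quotient phi : T phi -> buckling_quotient Om phi = lap_sq phi / grad_sq phi.
Proof.
move=> tp; have [Wp _] := test_W022 tp; rewrite buckling_quotientE//.
have Lw s : (0 < size s <= 2)%N -> L2 (wcut Om s phi).
  by move=> hs; exact: (L2_wcut oO Om_m Wp hs).
have Lp s := TL2 s tp.
congr (_ / _).
  have E : wlap Om phi = \sum_i wcut Om [:: i; i] phi by exact: cut_sum.
  have LE : L2 (wlap Om phi) by exact: (L2_wlap oO Om_m Wp).
  have aux psi : L2 psi -> ip (wlap Om phi) psi = ip (laplacian phi) psi.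
    move=> Lq; rewrite E laplacianE (ip_suml _ (fun i => Lw [:: i; i] isT) Lq).
    rewrite (ip_suml _ (fun i => Lp [:: i; i]) Lq); apply: eq_bigr => i _.
    exact: wcut_test.
  by rewrite (aux _ LE) ipC (aux _ (TL2lap tp)).
apply: eq_bigr => i _.
by rewrite (@wcut_test [:: i] phi _ isT tp (Lw [:: i] isT)) ipC (@wcut_test [:: i] phi _ isT tp (Lp [:: i])).
Qed.

(** Excludes the test functions that [buckling_load] leaves out because they
    vanish almost everywhere. *)
Lemma test_ae0_grad phi : T phi -> {ae mu, forall x, Om x -> phi x = 0} -> grad_sq phi = 0.
Proof.
move=> tp p0; apply: big1 => i _.
have Lp := test_function_L2 tp.
have pae : phi = 0 %[ae mu].
  move: p0; apply: filterS => x h _; have [/h //|nx] := pselect (Om x).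
  exact: test_function_notin nx.
have w0 : is_weak_partial Om [:: i] phi 0.
  apply/is_weak_partialE; rewrite (cut_test tp).
  have -> : (0 : V -> R) \_ Om = 0 by apply/funext => x; rewrite patchE; case: ifP.
  split; first exact: L20.
  move=> psi tq; rewrite ip0l mulr0.
  exact: ae_eq0_ip Lp (TL2 [:: i] tq) pae.
have := weak_partial_unique oO Om_m (test_weak_partial [:: i] tp) w0.
rewrite (cut_test (test_function_partials [:: i] tp)).
have -> : (0 : V -> R) \_ Om = 0 by apply/funext => x; rewrite patchE; case: ifP.
by move=> h; exact: (ae_eq0_ip (TL2 [:: i] tp) (TL2 [:: i] tp) h).
Qed.

Lemma buckling_rayleigh gam : (- buckling_load Om < gam%:E)%E -> rayleigh_ge (- gam).
Proof.
move=> hb phi tp; have G0 := grad_sq_ge0 phi; have L0 := lap_sq_ge0 phi.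
have [g0|g0] := eqVneq (grad_sq phi) 0; first by rewrite g0 mulr0.
have Gp : 0 < grad_sq phi by rewrite lt_neqAle eq_sym g0.
have : (buckling_load Om <= (buckling_quotient Om phi)%:E)%E.
  apply: ereal_inf_lbound; exists phi => //; split; first exact: test_W022.
  by move=> /(test_ae0_grad tp) h; rewrite h eqxx in g0.
move: hb; rewrite lteNl -EFinN => h1 h2.
have := lt_le_trans h1 h2; rewrite lte_fin test_quotient// ltr_pdivlMr//.
exact: ltW.
Qed.

(** An element u of the Sobolev space is approximated by test functions; its
    gradient cannot vanish unless u does, by the Poincare inequality. *)
Lemma rayleigh_buckling (i0 : 'I_n) lam : rayleigh_ge lam -> (lam%:E <= buckling_load Om)%E.
Proof.
move=> hl; apply: le_ereal_inf_tmp => _ [u [W0 nu0] <-]; rewrite lee_fin.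
have [Wu _] := W0; have [/Lp2E Lu _] := Wu.
rewrite buckling_quotientE//; set A := ip (wlap Om u) _; set G := wgrad_sq u.
have A0 : 0 <= A by exact: ip_ge0.
have G0 : 0 <= G by apply: sumr_ge0 => i _; exact: ip_ge0.
have [lam0|lam0] := leP lam 0.
  by apply: le_trans lam0 _; rewrite divr_ge0.
have Lw s hs : L2 (wcut Om s u) := L2_wcut oO Om_m Wu hs.
have N1 : 0 < 2 ^+ n * n%:R + 1 :> R by rewrite ltr_wpDl// mulr_ge0.
(* Test functions close to u: squared norms differ at most by a factor 1 + t
   and a summand 2 * t, whichever of the two functions comes first. *)
have appr t : 0 < t -> t <= 1 -> exists phi, [/\ T phi,
    ip (u \_ Om) (u \_ Om) <= (1 + t) * ip phi phi + 2 * t,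
    lap_sq phi <= (1 + t) * A + 2 * t,
    forall i, ip (wcut Om [:: i] u) (wcut Om [:: i] u) <= (1 + t) * ip (partial i phi) (partial i phi) + 2 * t &
    forall i, ip (partial i phi) (partial i phi) <= (1 + t) * ip (wcut Om [:: i] u) (wcut Om [:: i] u) + 2 * t].
  move=> t0 t1; have t2 : 0 < t ^+ 2 by rewrite exprn_gt0.
  have [phi [tp dp hd]] := W022_approx oO Om_m W0 (divr_gt0 t2 N1).
  have le1 : t ^+ 2 / (2 ^+ n * n%:R + 1) <= t ^+ 2.
    rewrite ler_pdivrMr//; apply: ler_peMr; first exact: ltW.
    by rewrite lerDr mulr_ge0.
  have [Lwl dl] := weak_laplacian_dist oO Om_m Wu tp hd.
  have dl' : sqdist (wlap Om u) (laplacian phi) <= t ^+ 2.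
    apply: le_trans dl _; rewrite mulrA ler_pdivrMr// mulrC; apply: ler_wpM2l; first exact: ltW.
    by rewrite lerDl.
  exists phi; split=> //.
  - exact: (ip_close Lu (test_function_L2 tp) t0 t1 (le_trans dp le1)).
  - by apply: (ip_close (TL2lap tp) Lwl t0 t1); rewrite sqdistC.
  - move=> i; apply: (ip_close (Lw [:: i] isT) (TL2 [:: i] tp) t0 t1).
    exact: le_trans (hd [:: i] isT) le1.
  - move=> i; apply: (ip_close (TL2 [:: i] tp) (Lw [:: i] isT) t0 t1).
    by rewrite sqdistC; exact: le_trans (hd [:: i] isT) le1.
(* The quotient of u is not a division by 0. *)
have Gp : 0 < G.
  rewrite lt_neqAle G0 andbT; apply/eqP => G0'; apply: nu0.
  have wi0 : ip (wcut Om [:: i0] u) (wcut Om [:: i0] u) <= 0.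
    rewrite G0'; apply: (@term_le_sum R n (fun i => ip (wcut Om [:: i] u) (wcut Om [:: i] u))) => i.
    exact: ip_ge0.
  pose C := 4 * m ^+ 2; have C0 : 0 <= C by rewrite mulr_ge0// sqr_ge0.
  have U0 : ip (u \_ Om) (u \_ Om) <= 0.
    apply: (@le_of_forall_small _ _ (4 * C + 2)) => t t0 t1.
    have [phi [tp h1 _ _ h4]] := appr t t0 t1.
    have t1' : 0 <= 1 + t by lra.
    have p1 : ip phi phi <= C * (2 * t).
      apply: le_trans (poincare i0 tp m0 Om_m) _; apply: (ler_wpM2l C0).
      apply: le_trans (h4 i0) _; rewrite gerDr; exact: mulr_ge0_le0.
    apply: le_trans h1 _.
    have : (1 + t) * ip phi phi <= 2 * (C * (2 * t)).
      apply: le_trans (ler_wpM2l t1' p1) _; apply: ler_wpM2r; last by lra.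
      by rewrite mulr_ge0// mulr_ge0// ltW.
    by lra.
  have Uae := ip_eq0_ae Lu (le_anti (introT andP (conj U0 (ip_ge0 _ _)))).
  move: Uae; apply: filterS => x /(_ I) h Ox.
  by rewrite -(cut_in u Ox); exact: h.
rewrite ler_pdivlMr//.
apply: (@le_of_forall_small _ _ (3 * A + 4 + 2 * lam * n%:R)) => t t0 t1.
have [phi [tp _ h2 h3 _]] := appr t t0 t1.
have h4 : G <= (1 + t) * grad_sq phi + n%:R * (2 * t).
  apply: le_trans (ler_sum _ (fun i _ => h3 i)) _.
  by rewrite big_split/= -mulr_sumr sumr_const card_ord (mulr_natl (2 * t)).
have h5 := hl _ tp.
have t1' : 0 <= 1 + t by lra.
have s1 : lam * G <= lam * ((1 + t) * grad_sq phi + n%:R * (2 * t)) by exact: ler_wpM2l (ltW lam0) _ _ h4.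
have s2 : (1 + t) * (lam * grad_sq phi) <= (1 + t) * ((1 + t) * A + 2 * t).
  exact: ler_wpM2l t1' _ _ (le_trans h5 h2).
have tt : t * t <= t by apply: ler_piMr => //; exact: ltW.
have ttA : t * t * A <= t * A by exact: ler_wpM2r.
apply: le_trans s1 _.
have -> : lam * ((1 + t) * grad_sq phi + n%:R * (2 * t)) =
  (1 + t) * (lam * grad_sq phi) + 2 * lam * n%:R * t by ring.
apply: (@le_trans _ _ ((1 + t) * ((1 + t) * A + 2 * t) + 2 * lam * n%:R * t)).
  by rewrite lerD2r.
have -> : (1 + t) * ((1 + t) * A + 2 * t) = A + 2 * (t * A) + t * t * A + 2 * t + 2 * (t * t) by ring.
have -> : A + t * (3 * A + 4 + 2 * lam * n%:R) = A + 3 * (t * A) + 4 * t + 2 * lam * n%:R * t by ring.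
by lra.
Qed.

(** Independent of the domain, as the passage to the limit of domains
    requires. *)
Definition coercivity (gam gam' : R) : R := Num.min 1 ((gam' - gam) / (`|gam| + 1)).

(** The form at gam' is the form at gam, which is nonnegative, plus a multiple
    of the squared gradient; a small part of the former is traded for the
    Laplacian. *)
Lemma coercive_of_rayleigh gam gam' : gam < gam' -> rayleigh_ge (- gam) ->
  coercive Om gam' (coercivity gam gam').
Proof.
move=> gg hr; have g1 : 0 < `|gam| + 1 by rewrite ltr_wpDl.
set c := coercivity _ _.
have c0 : 0 < c by rewrite lt_min ltr01 divr_gt0// subr_gt0.
have c1 : c <= 1 by rewrite ge_min lexx.
split=> // phi tp; have G0 := grad_sq_ge0 phi.
have h1 : 0 <= (1 - c) * (lap_sq phi + gam * grad_sq phi).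
  by rewrite mulr_ge0 ?subr_ge0//; have := hr _ tp; lra.
have h2 : 0 <= (gam' - gam + c * gam) * grad_sq phi.
  apply: mulr_ge0 => //.
  have : c * (`|gam| + 1) <= gam' - gam by rewrite -ler_pdivlMr// ge_min lexx orbT.
  have : - (c * `|gam|) <= c * gam by rewrite -mulrN; apply: (ler_wpM2l (ltW c0)); exact: lerNnormlW.
  by rewrite mulrDr mulr1; lra.
rewrite /quad; have -> : lap_sq phi + gam' * grad_sq phi = c * lap_sq phi +
  ((1 - c) * (lap_sq phi + gam * grad_sq phi) + (gam' - gam + c * gam) * grad_sq phi) by ring.
by rewrite lerDl addr_ge0.
Qed.

End buckling.

(** * Boundary layers of convex sets *)

Section convex_geometry.
Context {R : realType} {n : nat}.
Local Notation V := 'rV[R]_n.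
Local Notation mu := (@lebesgue_rV R n).
Implicit Types (K A : set V) (x y z w s : V) (i j : 'I_n) (sg : {ffun 'I_n -> bool}).

(** Convexity with a real weight, bound by inequalities instead of a subtype. *)
Definition cvx K := forall x y t, 0 <= t -> t <= 1 -> K x -> K y -> K (t *: x + (1 - t) *: y).

Lemma convex_setE K : convex_set (K : set (convex_lmodType V)) <-> cvx K.
Proof.
split=> [cK x y t t0 t1 Kx Ky|cK x y t]; last first.
  rewrite !inE => Kx Ky.
  have t0 : 0 <= t%:num by exact: ge0.
  have t1 : t%:num <= 1 by exact: le1.
  exact: (cK x y t%:num t0 t1 Kx Ky).
have := cK x y (Itv01 t0 t1); rewrite !inE; exact.
Qed.

(** The coordinates of a point of K are made equal to those of x one after the
    other: two points of K lying on opposite sides of x in direction k, and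
    agreeing otherwise, have a convex combination with the k-th coordinate of
    x. *)
Lemma cvx_orthants K x : cvx K ->
  (forall sg, exists2 w, K w & forall i, if sg i then x ord0 i < w ord0 i else w ord0 i < x ord0 i) ->
  K x.
Proof.
move=> cK hK.
have H (k : nat) : (k <= n)%N -> forall sg, exists2 w, K w & forall i,
    if (i < k)%N then w ord0 i = x ord0 i
    else if sg i then x ord0 i < w ord0 i else w ord0 i < x ord0 i.
  elim: k => [|k IH] kn sg.
    by have [w Kw hw] := hK sg; exists w => // i; rewrite ltn0; exact: hw.
  pose j := Ordinal kn.
  have [wp Kp hp] := IH (ltnW kn) [ffun i => if i == j then true else sg i].
  have [wm Km hm] := IH (ltnW kn) [ffun i => if i == j then false else sg i].
  have pj : x ord0 j < wp ord0 j by have := hp j; rewrite ltnn ffunE eqxx.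
  have mj : wm ord0 j < x ord0 j by have := hm j; rewrite ltnn ffunE eqxx.
  have d0 : 0 < wp ord0 j - wm ord0 j by lra.
  pose t := (x ord0 j - wm ord0 j) / (wp ord0 j - wm ord0 j).
  have t0 : 0 < t by rewrite divr_gt0//; lra.
  have t1 : t < 1 by rewrite ltr_pdivrMr//; lra.
  exists (t *: wp + (1 - t) *: wm); first exact: cK (ltW t0) (ltW t1) Kp Km.
  move=> i; rewrite !mxE ltnS leq_eqVlt.
  have [ij|ij] := eqVneq (val i) k.
    have -> : i = j by exact: val_inj.
    rewrite /=; have -> : t * wp ord0 j + (1 - t) * wm ord0 j =
       t * (wp ord0 j - wm ord0 j) + wm ord0 j by ring.
    by rewrite /t divfK ?gt_eqF// subrK.
  have nij : (i == j) = false by apply/eqP => e; move: ij; rewrite e eqxx.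
  have := hp i; have := hm i; rewrite !ffunE nij /=.
  case: ifP => _; first by move=> -> ->; rewrite -mulrDl addrC subrK mul1r.
  have ct : 0 < 1 - t by rewrite subr_gt0.
  case: (sg i) => h1 h2.
    have : t * x ord0 i < t * wp ord0 i by rewrite ltr_pM2l.
    have : (1 - t) * x ord0 i < (1 - t) * wm ord0 i by rewrite ltr_pM2l.
    by rewrite mulrBl mul1r; lra.
  have : t * wp ord0 i < t * x ord0 i by rewrite ltr_pM2l.
  have : (1 - t) * wm ord0 i < (1 - t) * x ord0 i by rewrite ltr_pM2l.
  by rewrite !(mulrBl _ 1 t) !mul1r; lra.
have [w Kw hw] := H n (leqnn n) [ffun => true].
have -> : x = w by apply/rowP => i; have := hw i; rewrite ltn_ord.
by [].
Qed.

Definition cbox (d : R) x : set V := [set y | forall i, `|y ord0 i - x ord0 i| <= d].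

Definition inner K d : set V := [set x | cbox d x `<=` K].

Definition sign_vec sg : V := \row_i (if sg i then 1 else -1).

(** If all the shifted points x + 2 d s, for the sign vectors s, were in K,
    each point of the box of radius d around x would have a point of K in
    every orthant. *)
Lemma not_inner K d x : cvx K -> 0 < d -> ~ inner K d x ->
  exists sg, ~ K (x + (2 * d) *: sign_vec sg).
Proof.
move=> cK d0 nx; apply: contrapT => h; apply: nx => y yx.
apply: (cvx_orthants cK) => sg; exists (x + (2 * d) *: sign_vec sg).
  by apply: contrapT => nK; apply: h; exists sg.
move=> i; have := yx i; rewrite ler_norml !mxE => /andP[h1 h2].
case: (sg i); rewrite ?mulr1 ?mulrN1; lra.
Qed.

Definition rind K s : set V := K `&` ~` [set x | K (x + s)].

Lemma measurable_shift K s : measurable K -> measurable [set x | K (x + s)].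
Proof.
move=> mK; have := measurable_affine 1 s measurableT mK; rewrite setTI.
congr measurable; apply/seteqP; split=> x /=; by rewrite /affine scale1r.
Qed.

Lemma measurable_rind K s : measurable K -> measurable (rind K s).
Proof. by move=> mK; apply: measurableI => //; apply: measurableC; exact: measurable_shift. Qed.

(** A ray leaves a convex set only once, so the translates of the rind by
    multiples of s are disjoint. *)
Lemma rind_disjoint K s (p q : nat) x : cvx K -> (p < q)%N ->
  rind K s (x - p%:R *: s) -> ~ rind K s (x - q%:R *: s).
Proof.
move=> cK pq [Kp _] [Kq nq]; apply: nq => /=.
have d0 : 0 < (q%:R - p%:R : R) by rewrite subr_gt0 ltr_nat.
have d1 : 1 <= (q%:R - p%:R : R) by rewrite -natrB ?ler1n ?subn_gt0// ltnW.
pose t : R := (q%:R - p%:R)^-1.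
have t0 : 0 <= t by rewrite invr_ge0 ltW.
have t1 : t <= 1 by rewrite invf_le1.
have := cK _ _ t t0 t1 Kp Kq; congr K.
apply/rowP => i; rewrite !mxE.
have -> : t * (x ord0 i - p%:R * s ord0 i) + (1 - t) * (x ord0 i - q%:R * s ord0 i) =
  x ord0 i - q%:R * s ord0 i + t * (q%:R - p%:R) * s ord0 i by ring.
by rewrite mulVf ?gt_eqF// mul1r.
Qed.

(** N disjoint translates of the rind fit into a cube of twice the size. *)
Lemma rind_measure K s (N : nat) M : cvx K -> measurable K -> K `<=` cube M ->
  (forall i, N%:R * `|s ord0 i| <= M) ->
  (N%:R%:E * mu (rind K s) <= mu (cube (2 * M) : set V))%E.
Proof.
move=> cK mK KM sM.
pose D (p : 'I_N) : set V := [set x | rind K s (x - p%:R *: s)].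
have mr := measurable_rind s mK.
have mD p : measurable (D p) by rewrite /D -scaleN1r; exact: measurable_shift.
have muD p : mu (D p) = mu (rind K s).
  by rewrite -(lebesgue_shift (- (p%:R *: s)) mr).
have tD : trivIset setT D.
  apply/trivIsetP => p q _ _ pq; apply/seteqP; split=> // x [Dp Dq].
  have [h|h|h] := ltngtP (p : nat) q.
  - exact: (rind_disjoint cK h Dp Dq).
  - exact: (rind_disjoint cK h Dq Dp).
  - by move: pq; rewrite (val_inj h) eqxx.
have -> : (N%:R%:E * mu (rind K s) = \sum_(p < N | true) mu (D p))%E.
  under eq_bigr do rewrite muD.
  have fin : mu (rind K s) \is a fin_num.
    rewrite ge0_fin_numE ?measure_ge0//.
    apply: le_lt_trans (lebesgue_obox_lty (fun=> - M) (fun=> M)).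
    apply: le_measure; rewrite ?inE//; first exact: measurable_obox.
    by move=> x [/KM].
  by rewrite -(fineK fin) sumEFin sumr_const card_ord -EFinM mulr_natl.
rewrite -(measure_bigsetU_ord mu _ mD tD); apply: le_measure; rewrite ?inE.
- by apply: bigsetU_measurable => p _; exact: mD.
- exact: measurable_obox.
- move=> x; rewrite -bigcup_seq => -[p _] [/KM Kx _] i.
  have := Kx i; rewrite !mxE => /andP[h1 h2].
  have : `|p%:R * s ord0 i| <= M.
    rewrite normrM ger0_norm//; apply: le_trans (sM i); apply: ler_wpM2r => //.
    by rewrite ler_nat ltnW.
  rewrite ler_norml => /andP[h3 h4]; apply/andP; split; lra.
Qed.

(** The points of K outside of [inner K d] lie in one of the 2^n rinds for the
    vectors 2 d s.  Their measure is of order d with a constant that depends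
    on the cube only, hence d is the same for all K. *)
Lemma thin_rind M e : 0 < M -> 0 < e -> exists2 d, 0 < d &
  forall K A, cvx K -> measurable K -> K `<=` cube M -> measurable A ->
    inner K d `<=` A -> (mu K <= mu A + e%:E)%E.
Proof.
move=> M0 e0.
have cfin : mu (cube (2 * M) : set V) \is a fin_num.
  by rewrite ge0_fin_numE ?measure_ge0//; exact: lebesgue_obox_lty.
pose c := fine (mu (cube (2 * M) : set V)).
have c0 : 0 <= c by rewrite fine_ge0.
pose P : R := #|{ffun 'I_n -> bool}|%:R.
have P0 : 0 <= P by [].
(* N translates of each rind fit into the cube, of measure c; P is the number
   of sign vectors. *)
pose N := (Num.truncn (P * c / e)).+1.
have N0 : 0 < N%:R :> R by rewrite ltr0n.
have hN : P * c <= N%:R * e.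
  have h0 : 0 <= P * c / e by rewrite divr_ge0 ?mulr_ge0// ltW.
  have /andP[_ h] := truncn_itv h0.
  by rewrite -ler_pdivrMr// ltW.
pose d := M / (2 * N%:R).
have d0 : 0 < d by rewrite divr_gt0// mulr_gt0.
exists d => // K A cK mK KM mA KA.
pose S sg := rind K ((2 * d) *: sign_vec sg).
have mS sg : measurable (S sg) by exact: measurable_rind.
have Se sg : (mu (S sg) <= (c / N%:R)%:E)%E.
  have := @rind_measure K ((2 * d) *: sign_vec sg) N M cK mK KM.
  have H i : N%:R * `|((2 * d) *: sign_vec sg) ord0 i| <= M.
    rewrite !mxE normrM; have -> : `|(if sg i then 1 else -1 : R)| = 1.
      by case: (sg i); rewrite ?normrN normr1.
    have d2 : 0 <= 2 * d by lra.
    rewrite mulr1 (ger0_norm d2) /d.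
    have -> : N%:R * (2 * (M / (2 * N%:R))) = M by field; rewrite gt_eqF.
    exact: lexx.
  move=> /(_ H); have sfin : mu (S sg) \is a fin_num.
    rewrite ge0_fin_numE ?measure_ge0//; apply: le_lt_trans (lebesgue_obox_lty (fun=> - M) (fun=> M)).
    by apply: le_measure; rewrite ?inE//; [exact: measurable_obox|move=> x [/KM]].
  rewrite -/(S sg) -(fineK sfin) -EFinM -(fineK cfin) !lee_fin => h.
  by rewrite ler_pdivlMr// mulrC.
have KU : K `<=` A `|` \big[setU/set0]_(sg : {ffun 'I_n -> bool}) S sg.
  move=> x Kx; have [ix|nx] := pselect (inner K d x); first by left; exact: KA.
  right; have [sg hsg] := not_inner cK d0 nx.
  by rewrite -bigcup_seq; exists sg; rewrite /= ?mem_index_enum//; split.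
have mU : measurable (\big[setU/set0]_(sg : {ffun 'I_n -> bool}) S sg).
  by apply: bigsetU_measurable => sg _; exact: mS.
apply: le_trans (le_measure _ _ _ KU) _; rewrite ?inE//; first exact: measurableU.
apply: le_trans (measureU2 mu mA mU) _; rewrite leeD2l//.
have UB (r : seq {ffun 'I_n -> bool}) : (mu (\big[setU/set0]_(sg <- r) S sg) <= ((size r)%:R * (c / N%:R))%:E)%E.
  elim: r => [|sg r IH]; first by rewrite big_nil measure0 mul0r.
  rewrite big_cons; apply: le_trans (measureU2 mu (mS sg) _) _.
    by apply: bigsetU_measurable => ? _; exact: mS.
  by rewrite /= -natr1 mulrDl mul1r addrC EFinD; exact: leeD.
apply: le_trans (UB _) _.
have -> : size (index_enum {ffun 'I_n -> bool}) = #|{ffun 'I_n -> bool}|.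
  by rewrite cardT enumT.
rewrite lee_fin -/P mulrA ler_pdivrMr//.
by rewrite [leRHS]mulrC.
Qed.

Definition cubeat x d : set V := [set y | forall i, `|y ord0 i - x ord0 i| < d].

Lemma cubeat_obox x d : cubeat x d = obox (fun i => x ord0 i - d) (fun i => x ord0 i + d).
Proof.
apply/seteqP; split=> y h i; have := h i.
  by rewrite ltr_norml => /andP[? ?]; apply/andP; split; lra.
by move=> /andP[? ?]; rewrite ltr_norml; apply/andP; split; lra.
Qed.

Lemma open_obox (a b : 'I_n -> R) : open (obox a b : set V).
Proof.
rewrite openE => x ox; rewrite /interior.
exists (fun _ j => [set t | a j < t < b j]); last by move=> y h j; exact: h.
move=> i0 j; rewrite (ord1 i0) /=; have /andP[h1 h2] := ox j.
have : open `]a j, b j[%classic by exact: interval_open.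
rewrite openE => /(_ (x ord0 j)) /=; rewrite in_itv/= h1 h2 => /(_ isT).
by rewrite /interior; apply: filterS => t /=; rewrite in_itv.
Qed.

Lemma open_cubeat x d : open (cubeat x d).
Proof. by rewrite cubeat_obox; exact: open_obox. Qed.

Lemma cubeat_center x d : 0 < d -> cubeat x d x.
Proof. by move=> d0 i; rewrite subrr normr0. Qed.

Lemma nbhs_cubeat x A : nbhs x A -> exists2 d, 0 < d & cubeat x d `<=` A.
Proof.
move=> /nbhs_ballP[e /= e0 he]; exists e => // y hy; apply: he; split=> // i0 j.
by rewrite (ord1 i0) /ball/= distrC; exact: hy.
Qed.

Lemma cvx_connected K : cvx K -> connected K.
Proof.
move=> cK; have [->|/set0P[x0 Kx0]] := eqVneq K set0; first exact: connected0.
pose seg y : set V := (fun t : R => t *: y + (1 - t) *: x0) @` `[0, 1]%classic.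
have -> : K = \bigcup_(y in K) seg y.
  apply/seteqP; split=> [y Ky|z [y Ky [t]]].
    by exists y => //; exists 1; rewrite /= ?in_itv/= ?ler01 ?lexx// subrr scale0r addr0 scale1r.
  by rewrite /= in_itv/= => /andP[t0 t1] <-; exact: cK.
apply: bigcup_connected.
  exists x0 => y Ky; exists 0; first by rewrite /= in_itv/= lexx ler01.
  by rewrite scale0r add0r subr0 scale1r.
move=> y Ky; apply: connected_continuous_connected; first exact: segment_connected.
apply: continuous_subspaceT => t.
apply: cvgD; first by apply: cvgZr_tmp; exact: cvg_id.
by apply: cvgZr_tmp; apply: cvgB; [exact: cvg_cst|exact: cvg_id].
Qed.

Lemma eball_cube r : (eball r : set V) `<=` cube r.
Proof.
move=> x; rewrite /eball /= => xr i; rewrite -ltr_norml.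
apply: le_lt_trans xr; rewrite /enorm -sqrtr_sqr ler_sqrt.
  by apply: (@term_le_sum R n (fun i => x ord0 i ^+ 2) i) => j; exact: sqr_ge0.
by apply: sumr_ge0 => j _; exact: sqr_ge0.
Qed.

End convex_geometry.

(** * Limits of convex domains along an ultrafilter *)

Section limit_domain.
Context {R : realType} {n : nat}.
Local Notation V := 'rV[R]_n.
Local Notation mu := (@lebesgue_rV R n).
Implicit Types (K A L : set V) (x y z : V).

Definition ccube (m : R) : set V := [set x | forall i, `[- m, m]%classic (x ord0 i)].

Lemma compact_ccube m : compact (ccube m).
Proof. by apply: (@rV_compact R n (fun=> `[- m, m]%classic)) => i; exact: segment_compact. Qed.

Lemma cube_ccube m : cube m `<=` ccube m.
Proof. by move=> x h i; have /andP[h1 h2] := h i; rewrite /= in_itv/= !ltW. Qed.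

Lemma cubeat_nbhs x y d : cubeat x d y -> nbhs y (cubeat x d).
Proof. by move=> xy; apply: open_nbhs_nbhs; split => //; exact: open_cubeat. Qed.

(** If c x lies in K, with x0 as origin, then x is the convex combination of c
    x and x0 with weights 1/c and 1 - 1/c; as a cube of radius e around x0
    lies in K, so does a cube of radius (1 - 1/c) e around x. *)
Lemma inner_dilation K L phi c e d x0 : cvx K -> 1 < c -> cubeat x0 e `<=` K ->
  0 < e -> d < (1 - c^-1) * e -> inner K d `<=` L ->
  test_function K phi -> test_function L (phi \o dil c x0).
Proof.
move=> cK c1 x0K e0 de KL tphi.
have c0 : 0 < c by lra.
have ci1 : c^-1 < 1 by rewrite invf_lt1.
have ci0 : 0 < c^-1 by rewrite invr_gt0.
apply: (test_function_affine c0 tphi) => x Kx; apply: KL => z zx.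
have s0 : 0 < 1 - c^-1 by lra.
pose w : V := x0 + (1 - c^-1)^-1 *: (z - x).
have -> : z = c^-1 *: affine c ((1 - c) *: x0) x + (1 - c^-1) *: w.
  rewrite -/(dil c x0 x) dilE /w; apply/rowP => i; rewrite !mxE.
  have -> : (1 - c^-1) * (x0 ord0 i + (1 - c^-1)^-1 * (z ord0 i - x ord0 i)) =
    (1 - c^-1) * x0 ord0 i + ((1 - c^-1) * (1 - c^-1)^-1) * (z ord0 i - x ord0 i) by ring.
  rewrite mulfV ?gt_eqF// mul1r.
  have -> : c^-1 * (c * (x ord0 i - x0 ord0 i) + x0 ord0 i) = (c^-1 * c) * (x ord0 i - x0 ord0 i) + c^-1 * x0 ord0 i by ring.
  rewrite mulVf ?gt_eqF// mul1r; ring.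
apply: cK => //; [exact: ltW|exact: ltW|].
apply: x0K => i; rewrite /w !mxE addrAC subrr add0r normrM gtr0_norm ?invr_gt0//.
rewrite mulrC ltr_pdivrMr//; have := zx i => h.
by apply: le_lt_trans h _; rewrite mulrC.
Qed.

Context (r c1 : R) (r0 : 0 < r) (c10 : 0 < c1).
Context (Om_ : nat -> set V) (hOm : forall k, convex_domains r c1 (Om_ k)).
Context (U : set_system nat) (UU : UltraFilter U).

(** Requiring a neighbourhood common to U-almost all domains makes the limit
    open and discards the boundary. *)
Definition limdom : set V := [set x | exists2 d, 0 < d & U [set k | cubeat x d `<=` Om_ k]].

Local Lemma ultra_filter_proper : ProperFilter U. Proof. exact: ultra_proper. Qed.
#[local] Existing Instance ultra_filter_proper.

Lemma Om_cvx k : cvx (Om_ k).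
Proof. by have [_ /convex_setE + _ _] := hOm k. Qed.

Lemma Om_eball k : Om_ k `<=` eball r. Proof. by have [] := hOm k. Qed.

Lemma Om_cube k : Om_ k `<=` cube r.
Proof. by move=> x /Om_eball/eball_cube. Qed.

Lemma Om_open k : open (Om_ k). Proof. by have [_ _ []] := hOm k. Qed.

Lemma Om_measure k : mu (Om_ k) = c1%:E. Proof. by have [] := hOm k. Qed.

Lemma limdom_eball : limdom `<=` eball r.
Proof.
move=> x [d d0 /filter_ex[k hk]]; apply: (@Om_eball k).
exact: hk (cubeat_center _ d0).
Qed.

Lemma limdom_cube : limdom `<=` cube r.
Proof. by move=> x /limdom_eball/eball_cube. Qed.

Lemma limdom_cvx : cvx limdom.
Proof.
move=> x y t t0 t1 [d d0 xd] [e e0 ye].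
have m0 : 0 < Num.min d e by rewrite lt_min d0.
exists (Num.min d e) => //; apply: filterS2 xd ye => k xk yk z zh.
pose w := z - (t *: x + (1 - t) *: y).
have -> : z = t *: (x + w) + (1 - t) *: (y + w).
  by rewrite /w; apply/rowP => i; rewrite !mxE; ring.
apply: Om_cvx => //.
  apply: xk => i; rewrite mxE addrAC subrr add0r; have := zh i.
  by rewrite /w !mxE lt_min => /andP[].
apply: yk => i; rewrite mxE addrAC subrr add0r; have := zh i.
by rewrite /w !mxE lt_min => /andP[].
Qed.

Lemma limdom_open : open limdom.
Proof.
rewrite openE => x [d d0 xd]; rewrite /interior.
have d2 : 0 < d / 2 by rewrite divr_gt0.
apply: filterS (cubeat_nbhs (cubeat_center x d2)) => y hy; exists (d / 2) => //.
apply: filterS xd => k xk z hz; apply: xk => i.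
have -> : z ord0 i - x ord0 i = (z ord0 i - y ord0 i) + (y ord0 i - x ord0 i) by ring.
apply: le_lt_trans (ler_normD _ _) _.
by have := hz i; have := hy i; lra.
Qed.

(** Finitely many of the neighbourhoods in the definition of the limit cover
    K, and the ultrafilter is closed under finite intersections. *)
Lemma limdom_compact K : compact K -> K `<=` limdom -> U [set k | K `<=` Om_ k].
Proof.
move=> cK KL.
have H x : exists d : R, K x -> 0 < d /\ U [set k | cubeat x d `<=` Om_ k].
  have [Kx|nK] := pselect (K x); last by exists 0.
  by have [d d0 h] := KL x Kx; exists d.
have [d hd] := boolp.choice H.
move: cK; rewrite compact_cover => /(_ V K (fun x => cubeat x (d x))).
case=> [x _|x Kx|D DK KD]; first exact: open_cubeat.
  by exists x => //; apply: cubeat_center; have [] := hd x Kx.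
have := @filter_bigI _ _ D (fun x => [set k | cubeat x (d x) `<=` Om_ k]) U ultra_filter_proper.
move=> /(_ (fun x xD => (hd x (set_mem (DK x xD))).2)).
apply: filterS => k hk x /KD[y yD]; exact: hk.
Qed.

(** Finitely many small cubes cover the ball.  For each of them the
    ultrafilter decides whether it lies in U-almost all domains, so that, for
    a typical k, a small cube contained in the k-th domain is contained in the
    limit. *)
Lemma limdom_inner d : 0 < d -> U [set k | inner (Om_ k) d `<=` limdom].
Proof.
move=> d0; have d2 : 0 < d / 2 by rewrite divr_gt0.
have := @compact_ccube r; rewrite compact_cover => /(_ V (ccube r) (fun x => cubeat x (d / 2))).
case=> [x _|x Kx|D DK KD]; first exact: open_cubeat.
  by exists x => //; exact: cubeat_center.
pose G x := [set k | cubeat x (d / 2) `<=` Om_ k].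
have H x : U [set k | U (G x) \/ ~ G x k].
  have [UG|UG] := in_ultra_setVsetC (G x) UU.
    by apply: filterS filterT => k _; left.
  by apply: filterS UG => k nk; right.
have := @filter_bigI _ _ D _ U ultra_filter_proper (fun x _ => H x).
apply: filterS => k hk x ix.
have Ox : Om_ k x by apply: ix => i; rewrite subrr normr0 ltW.
have [p pD px] := KD x (cube_ccube (Om_cube Ox)).
have [UG|[]] := hk p pD; last first.
  move=> z zp; apply: ix => i.
  have -> : z ord0 i - x ord0 i = (z ord0 i - p ord0 i) - (x ord0 i - p ord0 i) by ring.
  apply: le_trans (ler_normB _ _) _.
  by have := zp i; have := px i; lra.
have [e e0 he] := nbhs_cubeat (cubeat_nbhs px).
by exists e => //; apply: filterS UG => l Gl z hz; exact/Gl/he.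
Qed.

(** Two uses of [thin_rind]: a domain deprived of its boundary layer lies in
    the limit, and the limit deprived of its own is relatively compact in it,
    hence lies in a domain. *)
Lemma limdom_measure : mu limdom = c1%:E.
Proof.
have mO k : measurable (Om_ k) by apply: open_rV_measurable; exact: Om_open.
have mL : measurable limdom by apply: open_rV_measurable; exact: limdom_open.
apply/eqP; rewrite eq_le; apply/andP; split; apply/lee_addgt0Pr => e e0;
  have [d d0 hd] := @thin_rind R n r e r0 e0.
  (* The closure stays in the limit, since the points of [inner limdom d] keep
     a distance d from the complement. *)
  pose C := closure (inner limdom d).
  have CL : C `<=` limdom.
    move=> x cx.
    have [y [iy xy]] := cx _ (cubeat_nbhs (cubeat_center x d0)).
    by apply: iy => i; rewrite distrC ltW//; exact: xy.
  have cC : compact C.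
    apply: subclosed_compact (@compact_ccube r) _; first exact: closed_closure.
    by move=> x /CL/limdom_cube/cube_ccube.
  have [k hk] := filter_ex (limdom_compact cC CL).
  rewrite -(Om_measure k); apply: hd => //; [exact: limdom_cvx|exact: limdom_cube|].
  by move=> x ix; apply: hk; exact: subset_closure.
have [k hk] := filter_ex (limdom_inner d0).
by rewrite -(Om_measure k); apply: hd => //; [exact: Om_cvx|exact: Om_cube].
Qed.

Lemma limdom_convex_domains : convex_domains r c1 limdom.
Proof.
split; [exact: limdom_eball|exact/convex_setE/limdom_cvx| |exact: limdom_measure].
split; [|exact: limdom_open|exact/cvx_connected/limdom_cvx].
apply/set0P/eqP => L0; have := limdom_measure; rewrite L0 measure0 => -[] h.
by move: c10; rewrite -h ltxx.
Qed.

End limit_domain.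

(** * Existence and a priori bounds of near minimizers *)

Section energy_bounds.
Context {R : realType} {n : nat}.
Local Notation V := 'rV[R]_n.
Local Notation mu := (@lebesgue_rV R n).
Local Notation ip := (ip mu).
Local Notation L2 := (L2 mu).
Implicit Types (phi psi : V -> R).
Variables (m : R) (F : V -> R) (gam c : R).
Hypotheses (m0 : 0 < m) (LF : L2 F).

(** Minus this number bounds the energy from below. *)
Definition energy_floor : R := (4 * m ^+ 2) ^+ 2 / c * ip F F.

Lemma energy_floor_ge0 : 0 < c -> 0 <= energy_floor.
Proof. by move=> c0; rewrite mulr_ge0 ?ip_ge0// divr_ge0 ?sqr_ge0// ltW. Qed.

(** Young's inequality, weighted so that the Poincare inequality turns the
    term F phi into at most half of the coercive term. *)
Lemma lap_le_energy Om (i0 : 'I_n) phi : Om `<=` cube m -> coercive Om gam c ->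
  test_function Om phi -> c / 4 * lap_sq phi <= energy F gam phi + energy_floor.
Proof.
move=> Om_m [c0 hc] tp; have := hc _ tp.
have hi := ip_le_lap m0 Om_m i0 tp.
pose K := (4 * m ^+ 2) ^+ 2; rewrite -/K in hi.
have K0 : 0 < K by rewrite exprn_gt0// mulr_gt0// exprn_gt0.
have e0 : 0 < c / (2 * K) by rewrite divr_gt0// mulr_gt0.
have := ip_young (test_function_L2 tp) LF e0.
rewrite (ipC mu phi) /energy_floor -/K /energy /quad.
have -> : (c / (2 * K))^-1 = 2 * (K / c) by field; rewrite !gt_eqF.
have : c / (2 * K) * ip phi phi <= c / 2 * lap_sq phi.
  have -> : c / 2 * lap_sq phi = c / (2 * K) * (K * lap_sq phi) by field; rewrite gt_eqF.
  by rewrite ler_pM2l.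
have arith (a b x l g y : R) : a <= c / 2 * l -> 2 * x <= a + 2 * (K / c) * y ->
  c * l <= l + gam * g -> c / 4 * l <= (l + gam * g) / 2 - x + K / c * y by lra.
exact: arith.
Qed.

Lemma near_min_ex Om (i0 : 'I_n) e : Om `<=` cube m -> coercive Om gam c -> 0 < e ->
  exists phi, near_min Om F gam e phi.
Proof.
move=> Om_m co e0; pose S : set R := [set energy F gam phi | phi in test_function Om].
have lS : has_lbound S.
  exists (- energy_floor) => _ [phi tp <-].
  have := lap_le_energy i0 Om_m co tp; have [c0 _] := co.
  have : 0 <= c / 4 * lap_sq phi by rewrite mulr_ge0 ?lap_sq_ge0// divr_ge0// ltW.
  lra.
have hS : has_inf S by split => //; exists (energy F gam 0); exists 0 => //; exact: test_function0.
have [_ [phi tp <-] hp] := inf_adherent e0 hS.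
exists phi; split => // psi tq.
have h : inf S <= energy F gam psi by apply: (ge_inf lS); exists psi.
by apply: ltW; apply: lt_le_trans hp _; rewrite lerD2r.
Qed.

Definition lap_bound : R := 4 / c * (1 + energy_floor).

(** A near minimizer has energy at most 1, by comparison with the zero
    function. *)
Lemma near_min_lap_bound Om (i0 : 'I_n) e phi : Om `<=` cube m -> coercive Om gam c ->
  e <= 1 -> near_min Om F gam e phi -> lap_sq phi <= lap_bound.
Proof.
move=> Om_m co e1 [tp hp]; have [c0 _] := co.
have := lap_le_energy i0 Om_m co tp.
have := hp 0 (test_function0 Om).
have -> : energy F gam 0 = 0.
  have t0 := @test_function0 R n Om.
  have := @lap_sqZ R n Om 0 0 t0; have := @grad_sqZ R n Om 0 0 t0.
  rewrite scale0r expr0n /= !mul0r /energy => -> ->.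
  by rewrite mulr0 addr0 mul0r sub0r ip0r oppr0.
have arith (l E : R) : E <= 0 + e -> c / 4 * l <= E + energy_floor -> c / 4 * l <= 1 + energy_floor by lra.
move=> h1 h2; have := arith _ _ h1 h2.
have -> : c / 4 * lap_sq phi = lap_sq phi / (4 / c) by field; rewrite gt_eqF.
by rewrite ler_pdivrMr ?divr_gt0// mulrC.
Qed.

End energy_bounds.

(** * Lower semicontinuity along the limit of domains *)

Lemma real_between {R : realType} (x : \bar R) (b : R) : (x < b%:E)%E -> exists2 a : R, (x < a%:E)%E & a < b.
Proof.
case: x => [y| |] //; last by move=> _; exists (b - 1); rewrite ?ltNyr// gtrBl.
rewrite lte_fin => yb; exists ((y + b) / 2); last by lra.
by rewrite lte_fin; lra.
Qed.

Lemma le_of_reals_gt {R : realType} (x y : \bar R) : (forall a : R, (y < a%:E)%E -> (x <= a%:E)%E) -> (x <= y)%E.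
Proof.
case: y => [y| |] h; last 1 first.
- case: x h => [x| |] h //; last by have := h 0 (ltNyr 0).
  have := h (x - 1) (ltNyr _); rewrite lee_fin => ?; exfalso; lra.
- by apply/lee_addgt0Pr => e e0; apply: h; rewrite lte_fin ltrDl.
- exact: leey.
Qed.

Lemma Linfty_L2 {R : realType} {n : nat} (r : R) (f : 'rV[R]_n -> R) :
  Lp (eball r) +oo%E f -> L2 (@lebesgue_rV R n) (f \_ (eball r)).
Proof.
rewrite /Lp inE => /andP[/=]; rewrite !inE /= => mf; rewrite /finite_norm unlock /=.
set mu := @lebesgue_rV R n; set u := f \_ (eball r) => hf.
have [M hM] : exists M, {ae mu, forall x, `|u x| <= M}.
  move: hf; case: ifPn => [_ h|]; first exact: (ess_supr_bounded h).
  rewrite -leNgt => m0 _; exists 0; exists setT; split => //.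
  by apply/eqP; rewrite eq_le m0 measure_ge0.
apply: (@bounded_cube_L2 R n r M _ mf hM) => x nx.
by rewrite /u patchE memNset// => /eball_cube.
Qed.

Section lower_semicontinuity.
Context {R : realType} {n : nat}.
Local Notation V := 'rV[R]_n.
Local Notation mu := (@lebesgue_rV R n).
Local Notation ip := (ip mu).
Local Notation L2 := (L2 mu).
Implicit Types (phi psi : V -> R).
Context (r c1 : R) (r0 : 0 < r) (c10 : 0 < c1).
Context (Om_ : nat -> set V) (hOm : forall k, convex_domains r c1 (Om_ k)).
Context (U : set_system nat) (UU : UltraFilter U) (i0 : 'I_n).
Local Notation Om := (limdom Om_ U).

Local Lemma ultra_proper_filter : ProperFilter U. Proof. exact: ultra_proper. Qed.
#[local] Existing Instance ultra_proper_filter.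

Lemma limdom_test phi : test_function Om phi -> U [set k | test_function (Om_ k) phi].
Proof.
move=> [sp cp pO]; apply: filterS (limdom_compact UU cp pO) => k hk.
by split.
Qed.

(** Each inequality involves a single test function, which the limit shares
    with some domain of the sequence. *)
Lemma limdom_rayleigh lam : U [set k | rayleigh_ge (Om_ k) lam] -> rayleigh_ge Om lam.
Proof.
move=> h phi /limdom_test tp.
by have [k [hk tk]] := filter_ex (filterI h tp); exact: hk.
Qed.

(** Three small errors add up: that of the near minimizer phi on a domain, the
    change of its energy when it is dilated into the limit, and that of a near
    minimizer psi0 on the limit, which is also a competitor of phi. *)
Lemma limdom_near_min F gam c e : L2 F -> (forall x, ~ cube r x -> F x = 0) ->
  coercive Om gam c -> 0 < e ->
  U [set k | coercive (Om_ k) gam c /\ forall e, 0 < e -> exists phi,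
       near_min (Om_ k) F gam e phi /\ ip (neg_part phi) (neg_part phi) <= e] ->
  exists phi, near_min Om F gam e phi /\ ip (neg_part phi) (neg_part phi) <= e.
Proof.
move=> LF F0 co e0 hU; have [c0 _] := co.
pose Bl := lap_bound r F c; pose B := (1 + 4 * r ^+ 2) * Bl.
have Bl0 : 0 <= Bl.
  by rewrite mulr_ge0 ?divr_ge0 ?addr_ge0 ?energy_floor_ge0// ltW.
have r2 : 0 <= 4 * r ^+ 2 by rewrite mulr_ge0 ?sqr_ge0.
have B0 : 0 <= B by rewrite mulr_ge0// addr_ge0.
(* One third of e for each of the three errors; at most 1 for the a priori
   bound. *)
pose e1 := Num.min (e / 3) 1.
have e10 : 0 < e1 by rewrite lt_min ltr01 andbT divr_gt0.
have e1e : 3 * e1 <= e by rewrite mulrC -ler_pdivlMr// ge_min lexx.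
have e11 : e1 <= 1 by rewrite ge_min lexx orbT.
have [d d0 hd] := energy_dilation gam LF F0 r0 B0 e10.
have C1 : 1 < 1 + d by rewrite ltrDl.
have C0 : 0 < 1 + d by lra.
have [x0 [a a0 x0a]] : Om !=set0 by have [_ _ []] := limdom_convex_domains r0 c10 hOm UU.
have x0r : cube r x0 by apply: (limdom_cube hOm UU); exists a.
pose s := (1 - (1 + d)^-1) * (a / 2).
have ci : (1 + d)^-1 < 1 by rewrite invf_lt1.
have s0 : 0 < s by rewrite mulr_gt0 ?subr_gt0// divr_gt0.
have sa : s < (1 - (1 + d)^-1) * a by rewrite ltr_pM2l ?subr_gt0// ltr_pdivrMr// ltr_pMr// ltr1n.
have [psi0 [tpsi0 hpsi0]] := near_min_ex r0 LF i0 (limdom_cube hOm UU) co e10.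
have [k [ik [tk [xk [cok /(_ _ e10)[phi [mphi nphi]]]]]]] :=
  filter_ex (filterI (limdom_inner hOm UU s0)
    (filterI (limdom_test tpsi0) (filterI x0a hU))).
have [tphi hphi] := mphi.
have lphi : lap_sq phi <= Bl by exact: (near_min_lap_bound r0 LF i0 (Om_cube hOm (k:=k)) cok e11 mphi).
have gphi := grad_le_lap r0 (Om_cube hOm (k:=k)) tphi.
have L0 := lap_sq_ge0 phi.
have lB : lap_sq phi <= B by apply: le_trans lphi _; rewrite ler_peMl// lerDl.
have gB : grad_sq phi <= B.
  apply: le_trans gphi _; apply: le_trans (ler_wpM2l r2 lphi) _.
  by rewrite ler_wpM2r// lerDr.
have C1' : 1 <= 1 + d <= 1 + d by rewrite lexx andbT ltW.
have hE := hd _ C1' _ _ _ tphi x0r lB gB.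
exists (phi \o dil (1 + d) x0); split; last first.
  have -> : neg_part (phi \o dil (1 + d) x0) = neg_part phi \o dil (1 + d) x0 by [].
  have Ln := L2_neg_part (test_function_L2 tphi).
  rewrite /dil (ip_affine _ C0 Ln Ln).
  have h1 : (1 + d)^-1 ^+ n <= 1 by rewrite exprn_ile1// ?invr_ge0 ltW.
  apply: le_trans (_ : ip (neg_part phi) (neg_part phi) <= _).
    by apply: ler_piMl h1; exact: ip_ge0.
  by lra.
split; first exact: (inner_dilation (Om_cvx hOm (k:=k)) C1 xk a0 sa ik tphi).
move=> psi tpsi; have h1 := hpsi0 _ tpsi; have h2 := hphi _ tk.
move: hE; rewrite ler_norml => /andP[_ h3]; lra.
Qed.

(** Let gam1 lie strictly between lam and gam.  U-almost all domains are
    admissible at gam1, which yields the buckling inequality at - gam1 for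
    them and for the limit, and hence coercivity, with the same constant, at
    all parameters from gam on. *)
Lemma limdom_gamma_f f lam : Lp (eball r) +oo%E f ->
  (forall gam : R, (lam < gam%:E)%E -> U [set k | (gamma_f f (Om_ k) < gam%:E)%E]) ->
  (gamma_f f Om <= lam)%E.
Proof.
move=> fLoo hlam.
have LF : L2 (f \_ (eball r)) by exact: Linfty_L2.
have F0 x : ~ cube r x -> (f \_ (eball r)) x = 0.
  by move=> nx; rewrite patchE memNset// => /eball_cube.
have Ff k x : Om_ k x -> (f \_ (eball r)) x = f x.
  by move=> /(Om_eball hOm) xr; rewrite patchE mem_set.
have Ff' x : Om x -> (f \_ (eball r)) x = f x.
  by move=> /(limdom_eball hOm UU) xr; rewrite patchE mem_set.
have Omo := limdom_open UU (Om_ := Om_).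
have Omr := limdom_cube hOm UU.
apply: le_of_reals_gt => gam lg.
have [gam1 lg1 g1g] := real_between lg.
have hU := hlam _ lg1.
have adm k : (gamma_f f (Om_ k) < gam1%:E)%E -> rayleigh_ge (Om_ k) (- gam1) /\
    forall gam', gam1 <= gam' -> nonneg_solution (Om_ k) f gam'.
  move=> /ereal_inf_lt[_ [g [hg1 hg2] <-]]; rewrite lte_fin => gg1; split.
    by apply: (buckling_rayleigh (Om_open hOm (k:=k)) (Om_cube hOm (k:=k))); apply: lt_trans hg1 _; rewrite lte_fin.
  by move=> g' g1g'; apply: hg2; apply: le_trans g1g'; exact: ltW.
have ray : rayleigh_ge Om (- gam1).
  by apply: limdom_rayleigh; apply: filterS hU => k /adm[].
apply: ereal_inf_lbound; exists gam => //; split.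
  have hb := rayleigh_buckling r0 Omo Omr i0 ray.
  rewrite lteNl; apply: lt_le_trans hb; by rewrite lte_fin ltrN2.
move=> gam' gg'.
have g1g' : gam1 < gam' by exact: lt_le_trans g1g gg'.
have co := coercive_of_rayleigh g1g' ray.
apply: (near_min_weak_solution r0 Omo Omr LF i0 Ff' co) => e e0.
apply: (limdom_near_min LF F0 co e0); apply: filterS hU => k /adm[rk sk].
have cok := coercive_of_rayleigh g1g' rk; split => // e' e'0.
have [u su u0] := sk gam' (ltW g1g').
exact: (weak_solution_near_min r0 (Om_open hOm (k:=k)) (Om_cube hOm (k:=k)) LF i0 (Ff k) cok su u0 e'0).
Qed.

End lower_semicontinuity.

(** * Existence of an optimal domain *)

Lemma minimizing_sequence {R : realType} (T : Type) (A : set T) (J : T -> \bar R) :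
  A !=set0 -> exists2 x_ : nat -> T, (forall k, A (x_ k)) &
    forall a : R, (ereal_inf (J @` A) < a%:E)%E -> \forall k \near \oo, (J (x_ k) < a%:E)%E.
Proof.
move=> [x0 Ax0]; set L := ereal_inf _.
have [Loo|Loo] := eqVneq L +oo%E; first by exists (fun=> x0) => // a; rewrite Loo.
have [b hb1 hb2] : exists2 b : nat -> \bar R, (forall k, L < b k)%E &
    forall a : R, (L < a%:E)%E -> \forall k \near \oo, (b k <= a%:E)%E.
  move: L Loo => [y| |] // _.
    exists (fun k => (y + k.+1%:R^-1)%:E) => [k|a]; first by rewrite lte_fin ltrDl invr_gt0.
    rewrite lte_fin -subr_gt0 => ya; have := near_infty_natSinv_lt (PosNum ya).
    by apply: filterS => k /= h; rewrite lee_fin -lerBrDl ltW.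
  exists (fun k => (- k%:R)%:E) => [k|a _]; first exact: ltNyr.
  have := nbhs_infty_ger (- a).
  by apply: filterS => k /= h; rewrite lee_fin lerNl.
have H k : exists x, A x /\ (J x < b k)%E.
  by have /ereal_inf_lt[_ [x Ax <-] h] := hb1 k; exists x.
have [x_ hx] := boolp.choice H.
exists x_ => [k|a /hb2]; first by have [] := hx k.
by apply: filterS => k; apply: lt_le_trans; have [] := hx k.
Qed.

Theorem theorem1p1 (R : realType) (n : nat) (hn : n = 2%N \/ n = 3%N)
    (r c1 : R) (hr : 0 < r) (hc1 : 0 < c1)
    (f : 'rV[R]_n -> R) (fLoo : Lp (eball r) +oo%E f)
    (f_ge0 : {ae @lebesgue_rV R n, forall x, eball r x -> 0 <= f x})
    (hM : @convex_domains R n r c1 !=set0) :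
  exists2 Omega_f : set 'rV[R]_n, convex_domains r c1 Omega_f &
    forall Omega : set 'rV[R]_n, convex_domains r c1 Omega ->
      (gamma_f f Omega_f <= gamma_f f Omega)%E.
Proof.
have n0 : (0 < n)%N by case: hn => ->.
have i0 : 'I_n := Ordinal n0.
have [Om_ hOm hlim] := minimizing_sequence (gamma_f f) hM.
have [U [UU oU]] := @ultraFilterLemma nat \oo _.
exists (limdom Om_ U); first exact: limdom_convex_domains.
move=> Omega hOmega; apply: le_trans (_ : ereal_inf (gamma_f f @` convex_domains r c1) <= _)%E.
  by apply: (limdom_gamma_f hr hc1 hOm UU i0 fLoo) => gam /hlim; exact: oU.
by apply: ereal_inf_lbound; exists Omega.
Qed.
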